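(* Let $0\le\underline{\sigma}^2\le\overline{\sigma}^2$. The functional $\hat{\mathbb{E}}[\cdot]$ constructed in the context is a sublinear expectation on $L_{ip}(\mathcal{F})$, and the canonical process $(\mathbf{W}_\gamma)_{\gamma\in\Gamma}$ is a $1$-dimensional spatial-temporal $G$-white noise on $(\Omega,L_{ip}(\mathcal{F}),\hat{\mathbb{E}})$.
   Context: $C_{l.Lip}(\mathbb{R}^k)$ is the space of $\varphi:\mathbb{R}^k\to\mathbb{R}$ with $|\varphi(x)-\varphi(y)|\le C(1+|x|^q+|y|^q)|x-y|$ for some $C>0,q\in\mathbb{N}$. A sublinear expectation space $(\Omega,\mathcal{H},\hat{\mathbb{E}})$: $\mathcal{H}$ a linear space of real functions on $\Omega$ closed under composition with $C_{l.Lip}$ functions, $\hat{\mathbb{E}}:\mathcal{H}\to\mathbb{R}$ monotone, constant preserving, sub-additive, positively homogeneous. $X_1\overset{d}{=}X_2$ means equality of $\hat{\mathbb{E}}_i[\varphi(X_i)]$ for all $\varphi\in C_{l.Lip}$. $Y$ is independent from $X$ if $\hat{\mathbb{E}}[\varphi(X,Y)]=\hat{\mathbb{E}}[\hat{\mathbb{E}}[\varphi(x,Y)]_{x=X}]$ for all $\varphi\in C_{l.Lip}$. $X$ is $G$-normally distributed if $aX+b\bar X\overset{d}{=}\sqrt{a^2+b^2}X$ for $a,b\ge0$, $\bar X$ an independent copy of $X$ ($\bar X\overset{d}{=}X$, $\bar X$ independent from $X$, realised on a larger space if necessary). A random field is $G$-Gaussian if all its finite subvectors are $G$-normally distributed.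 Random variables $X,Y$ with $\hat{\mathbb{E}}[|X-Y|]=0$ are identified. $\mathcal{B}_0(\mathbb{R}^d)$: Borel sets of finite Lebesgue measure, $\lambda_A$ the Lebesgue measure of $A$. A $1$-dimensional spatial $G$-white noise is a $1$-dimensional $G$-Gaussian random field $(\mathbb{W}_A)_{A\in\mathcal{B}_0(\mathbb{R}^d)}$ with $\hat{\mathbb{E}}[\mathbb{W}_A^2]=\overline{\sigma}^2\lambda_A$, $-\hat{\mathbb{E}}[-\mathbb{W}_A^2]=\underline{\sigma}^2\lambda_A$, and, for disjoint $A_1,A_2$, $\hat{\mathbb{E}}[\pm\mathbb{W}_{A_1}\mathbb{W}_{A_2}]=0$ and $\hat{\mathbb{E}}[(\mathbb{W}_{A_1\cup A_2}-\mathbb{W}_{A_1}-\mathbb{W}_{A_2})^2]=0$. Throughout, the reference spatial $G$-white noise $(\mathbb{W}_A)$ is the one for which $\frac12\hat{\mathbb{E}}[\sum_{i,j}q_{ij}\mathbb{W}_{A_i}\mathbb{W}_{A_j}]=G(\sum_{i,j}q_{ij}\lambda_{A_i\cap A_j})$, where $G(q)=\frac{\overline{\sigma}^2}{2}q^+-\frac{\underline{\sigma}^2}{2}q^-$. Let $\Gamma=\{[s,t)\times A:0\le s\le t<\infty,\ A\in\mathcal{B}_0(\mathbb{R}^d)\}$. A random field $(\mathbf{W}([s,t)\times A))$ indexed by $\Gamma$ is a $1$-dimensional spatial-temporal $G$-white noise if: (i) for each fixed $[s,t)$, $\{\mathbf{W}([s,t)\times A)\}_{A\in\mathcal{B}_0(\mathbb{R}^d)}$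 is a $1$-dimensional spatial white noise with the same finite dimensional distributions as $(\sqrt{t-s}\,\mathbb{W}_A)_{A\in\mathcal{B}_0(\mathbb{R}^d)}$; (ii) $\mathbf{W}([r,s)\times A)+\mathbf{W}([s,t)\times A)=\mathbf{W}([r,t)\times A)$ for $r\le s\le t$, $A\in\mathcal{B}_0(\mathbb{R}^d)$; (iii) $\mathbf{W}([s,t)\times A)$ is independent from $(\mathbf{W}([s_1,t_1)\times A_1),\dots,\mathbf{W}([s_n,t_n)\times A_n))$ whenever $t_i<s$ and $A_i\in\mathcal{B}_0(\mathbb{R}^d)$ for all $i$. Construction. Let $\Omega=\mathbb{R}^\Gamma$ and $\mathbf{W}([s,t)\times A)(\omega)=\omega([s,t)\times A)$. $L_{ip}(\mathcal{F}_T)$ is the set of $\varphi(\mathbf{W}([s_1,t_1)\times A_1),\dots,\mathbf{W}([s_n,t_n)\times A_n))$ with $n\in\mathbb{N}$, $s_i\le t_i\le T$, $A_i\in\mathcal{B}_0(\mathbb{R}^d)$, $\varphi\in C_{l.Lip}(\mathbb{R}^n)$, and $L_{ip}(\mathcal{F})=\bigcup_{n\ge1}L_{ip}(\mathcal{F}_n)$. Using additivity in time and space (all $\mathbf{W}([s,t)\times A)$ being expressed as sums over a common refinement), each $X\in L_{ip}(\mathcal{F})$ is written as $X=\varphi\big((\mathbf{W}([t_{i-1},t_i)\times A_j))_{1\le i\le n,1\le j\le m}\big)$ with $0=t_0\le t_1<\dots<t_n<\infty$, $A_1,\dots,A_m\in\mathcal{B}_0(\mathbb{R}^d)$ mutually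 disjoint, $\varphi\in C_{l.Lip}(\mathbb{R}^{m\times n})$. Let $\xi_1,\dots,\xi_n$ be $m$-dimensional $G$-normally distributed vectors on some sublinear expectation space with expectation $\tilde{\mathbb{E}}$, with $\xi_{i+1}$ independent from $(\xi_1,\dots,\xi_i)$ and $\frac12\tilde{\mathbb{E}}[\langle Q\xi_i,\xi_i\rangle]=G(\sum_{j=1}^mq_{jj}\lambda_{A_j})$ for all symmetric $m\times m$ matrices $Q=(q_{jk})$. Set $\hat{\mathbb{E}}[X]=\tilde{\mathbb{E}}\big[\varphi\big((\sqrt{t_i-t_{i-1}}\,\xi_i^{(j)})_{1\le i\le n,1\le j\le m}\big)\big]$. *)

(* Defs.v *)
(* The reals are an arbitrary realType R, and R^d is 'rV[R]_d. *)
From HB Require Import structures.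
From mathcomp Require Import all_boot all_order all_algebra.
From mathcomp Require Import all_classical all_reals all_analysis.
Set Implicit Arguments.
Unset Strict Implicit.
Unset Printing Implicit Defensive.
Import Order.TTheory GRing.Theory Num.Theory.
Import numFieldNormedType.Exports.

Local Open Scope classical_set_scope.
Local Open Scope ring_scope.

(** * Sublinear expectations *)

(* The norm that MathComp-Analysis puts on matrices is the sup norm. *)
Definition enorm (R : realType) (m n : nat) (x : 'M[R]_(m, n)) : R :=
  Num.sqrt (\sum_(i < m) \sum_(j < n) x i j ^+ 2).

(* C_{l.Lip}(R^{m x n}); C_{l.Lip}(R^k) is the case 'M_(1, k) = 'rV_k. *)
Definition C_lLip (R : realType) (m n : nat) : set ('M[R]_(m, n) -> R) :=
  [set phi | exists (C : R) (q : nat), 0 < C /\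
     forall x y, `|phi x - phi y|
                 <= C * (1 + enorm x ^+ q + enorm y ^+ q) * enorm (x - y)].

Definition random_vector (R : realType) (T : Type) (H : set (T -> R))
    (n : nat) (X : T -> 'rV[R]_n) : Prop :=
  forall i : 'I_n, H (fun w => X w 0 i).

(* An expectation on H is encoded as a function on all of T -> R; its values
   outside H are never used. *)
Record sublinear_expectation_space (R : realType) (T : Type)
    (H : set (T -> R)) (E : (T -> R) -> R) : Prop := SublinearExpectationSpace {
  sle_zero : H (fun=> 0) ;
  sle_linear : forall (c : R) (X Y : T -> R),
    H X -> H Y -> H (fun w => c * X w + Y w) ;
  sle_comp : forall (n : nat) (X : T -> 'rV[R]_n) (phi : 'rV[R]_n -> R),
    random_vector H X -> C_lLip phi -> H (fun w => phi (X w)) ;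
  sle_monotone : forall X Y : T -> R,
    H X -> H Y -> (forall w, Y w <= X w) -> E Y <= E X ;
  sle_const : forall c : R, E (fun=> c) = c ;
  sle_subadditive : forall X Y : T -> R,
    H X -> H Y -> E (fun w => X w + Y w) <= E X + E Y ;
  sle_pos_homogeneous : forall (c : R) (X : T -> R),
    0 <= c -> H X -> E (fun w => c * X w) = c * E X }.

Definition eq_dist (R : realType) (n : nat)
    (T1 : Type) (E1 : (T1 -> R) -> R) (X1 : T1 -> 'rV[R]_n)
    (T2 : Type) (E2 : (T2 -> R) -> R) (X2 : T2 -> 'rV[R]_n) : Prop :=
  forall phi : 'rV[R]_n -> R, C_lLip phi ->
    E1 (fun w => phi (X1 w)) = E2 (fun w => phi (X2 w)).

(* Y is independent from X; the relation is not symmetric. *)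
Definition independent_from (R : realType) (T : Type) (E : (T -> R) -> R)
    (n m : nat) (Y : T -> 'rV[R]_n) (X : T -> 'rV[R]_m) : Prop :=
  forall phi : 'rV[R]_(m + n) -> R, C_lLip phi ->
    E (fun w => phi (row_mx (X w) (Y w))) =
    E (fun w => E (fun w' => phi (row_mx (X w) (Y w')))).

(* The space (T', H', E') carries a copy X' of X together with an independent
   copy Xbar of it: it plays the role of the larger space. *)
Definition G_normal (R : realType) (T : Type) (H : set (T -> R))
    (E : (T -> R) -> R) (n : nat) (X : T -> 'rV[R]_n) : Prop :=
  random_vector H X /\
  exists (T' : Type) (H' : set (T' -> R)) (E' : (T' -> R) -> R)
         (X' Xbar : T' -> 'rV[R]_n),
    [/\ sublinear_expectation_space H' E',
        random_vector H' X' /\ random_vector H' Xbar,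
        eq_dist E' X' E X,
        eq_dist E' Xbar E' X' /\ independent_from E' Xbar X' &
        forall a b : R, 0 <= a -> 0 <= b ->
          eq_dist E' (fun w => a *: X' w + b *: Xbar w)
                  E (fun w => Num.sqrt (a ^+ 2 + b ^+ 2) *: X w)].

Definition subvector (R : realType) (T I : Type) (W : I -> T -> R)
    (n : nat) (g : 'I_n -> I) (w : T) : 'rV[R]_n := \row_(i < n) W (g i) w.

Definition G_gaussian_field (R : realType) (T : Type) (H : set (T -> R))
    (E : (T -> R) -> R) (I : Type) (W : I -> T -> R) : Prop :=
  forall (n : nat) (g : 'I_n -> I), G_normal H E (subvector W g).

(** * Borel sets of finite Lebesgue measure *)

Definition half_open_box (R : realType) (d : nat) (a b : 'rV[R]_d) :
    set 'rV[R]_d :=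
  [set x | forall i, a 0 i <= x 0 i < b 0 i].

(* Lebesgue outer measure, used below on Borel sets only, where it is the
   Lebesgue measure. It is degenerate for d = 0: no box of R^0 is empty. *)
Definition lebesgue (R : realType) (d : nat) (A : set 'rV[R]_d) : \bar R :=
  ereal_inf [set v | exists a b : nat -> 'rV[R]_d,
    [/\ forall k i, a k 0 i <= b k 0 i,
        A `<=` \bigcup_k half_open_box (a k) (b k) &
        v = (\sum_(0 <= k <oo) (\prod_(i < d) (b k 0 i - a k 0 i))%:E)%E]].

Record B0 (R : realType) (d : nat) : Type := MkB0 {
  B0_set :> set 'rV[R]_d ;
  B0_borel : <<s [set U : set 'rV[R]_d | open U] >> B0_set ;
  B0_finite : (lebesgue B0_set < +oo)%E }.

Definition lambda (R : realType) (d : nat) (A : set 'rV[R]_d) : R :=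
  fine (lebesgue A).

(** * Spatial white noise *)

Definition Gfun (R : realType) (s2lo s2up : R) (q : R) : R :=
  s2up / 2 * Num.max q 0 - s2lo / 2 * Num.max (- q) 0.

(* s2lo and s2up stand for the squares of the lower and upper sigma. *)
Record spatial_white_noise (R : realType) (d : nat) (s2lo s2up : R)
    (T : Type) (H : set (T -> R)) (E : (T -> R) -> R)
    (W : B0 R d -> T -> R) : Prop := SpatialWhiteNoise {
  swn_gaussian : G_gaussian_field H E W ;
  swn_upper : forall A, E (fun w => W A w ^+ 2) = s2up * lambda A ;
  swn_lower : forall A, - E (fun w => - W A w ^+ 2) = s2lo * lambda A ;
  swn_uncorrelated : forall A1 A2 : B0 R d, A1 `&` A2 = set0 ->
    E (fun w => W A1 w * W A2 w) = 0 /\ E (fun w => - (W A1 w * W A2 w)) = 0 ;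
  swn_additive : forall A1 A2 A12 : B0 R d,
    A1 `&` A2 = set0 -> A12 = A1 `|` A2 :> set _ ->
    E (fun w => (W A12 w - W A1 w - W A2 w) ^+ 2) = 0 }.

Definition reference_white_noise (R : realType) (d : nat) (s2lo s2up : R)
    (T : Type) (H : set (T -> R)) (E : (T -> R) -> R)
    (W : B0 R d -> T -> R) : Prop :=
  spatial_white_noise s2lo s2up H E W /\
  forall (n : nat) (A : 'I_n -> B0 R d) (Q : 'M[R]_n), Q^T = Q ->
    2^-1 * E (fun w => \sum_(i < n) \sum_(j < n) Q i j * W (A i) w * W (A j) w)
    = Gfun s2lo s2up (\sum_(i < n) \sum_(j < n) Q i j * lambda (A i `&` A j)).

(** * Spatial-temporal white noise *)

(* Indices are subsets of time x space, not triples (s, t, A): all the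
   [s, s) x A and all the [s, t) x set0 are the same index. *)
Record Gamma (R : realType) (d : nat) : Type := MkGamma {
  Gamma_set :> set (R * 'rV[R]_d) ;
  Gamma_rect : exists (s t : R) (A : B0 R d),
    0 <= s <= t /\ Gamma_set = `[s, t[%classic `*` A }.

Definition rect (R : realType) (d : nat) (s t : R) (hst : 0 <= s <= t)
    (A : B0 R d) : Gamma R d :=
  @MkGamma R d (`[s, t[%classic `*` A)
    (ex_intro _ s (ex_intro _ t (ex_intro _ A (conj hst erefl)))).

(* Equality of random variables is equality up to E |X - Y| = 0. *)
Definition qs_eq (R : realType) (T : Type) (E : (T -> R) -> R)
    (X Y : T -> R) : Prop := E (fun w => `|X w - Y w|) = 0.

Definition spatial_temporal_white_noise (R : realType) (d : nat)
    (s2lo s2up : R) (T : Type) (H : set (T -> R)) (E : (T -> R) -> R)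
    (W : Gamma R d -> T -> R) : Prop :=
  exists (T0 : Type) (H0 : set (T0 -> R)) (E0 : (T0 -> R) -> R)
         (W0 : B0 R d -> T0 -> R),
  [/\ sublinear_expectation_space H0 E0 /\
      reference_white_noise s2lo s2up H0 E0 W0,
      forall (s t : R) (hst : 0 <= s <= t),
        spatial_white_noise ((t - s) * s2lo) ((t - s) * s2up) H E
          (fun A => W (rect hst A)) /\
        forall (n : nat) (A : 'I_n -> B0 R d),
          eq_dist E (subvector (fun A => W (rect hst A)) A)
                  E0 (subvector (fun A w => Num.sqrt (t - s) * W0 A w) A),
      forall (r s t : R) (hrs : 0 <= r <= s) (hst : 0 <= s <= t)
             (hrt : 0 <= r <= t) (A : B0 R d),
        qs_eq E (fun w => W (rect hrs A) w + W (rect hst A) w)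
                (W (rect hrt A)) &
      forall (s t : R) (hst : 0 <= s <= t) (A : B0 R d)
             (n : nat) (s_ t_ : 'I_n -> R) (h_ : forall i, 0 <= s_ i <= t_ i)
             (A_ : 'I_n -> B0 R d),
        (forall i, t_ i < s) ->
        independent_from E (fun w => \row_(_ < 1) W (rect hst A) w)
                           (subvector W (fun i => rect (h_ i) (A_ i)))].

(** * The canonical_process space *)

Definition Omega (R : realType) (d : nat) : Type := Gamma R d -> R.

Definition canonical_process (R : realType) (d : nat) (g : Gamma R d)
    (w : Omega R d) : R := w g.

Definition Lip_upto (R : realType) (d : nat) (T : R) : set (Omega R d -> R) :=
  [set X | exists (n : nat) (s t : 'I_n -> R) (h : forall i, 0 <= s i <= t i)
                  (A : 'I_n -> B0 R d) (phi : 'rV[R]_n -> R),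
     [/\ forall i, t i <= T, C_lLip phi &
         X = fun w => phi (subvector (@canonical_process R d)
                             (fun i => rect (h i) (A i)) w)]].

Definition Lip (R : realType) (d : nat) : set (Omega R d -> R) :=
  \bigcup_(n in [set n : nat | (1 <= n)%N]) @Lip_upto R d n%:R.

(* On R^Gamma the coordinates are not additive as functions; they are so once
   random variables are identified. An identity obtained from additivity in
   time and space is one that holds on all the additive paths. *)
Definition additive_path (R : realType) (d : nat) (w : Omega R d) : Prop :=
  (forall (r s t : R) (hrs : 0 <= r <= s) (hst : 0 <= s <= t)
          (hrt : 0 <= r <= t) (A : B0 R d),
     w (rect hrs A) + w (rect hst A) = w (rect hrt A)) /\
  (forall (s t : R) (hst : 0 <= s <= t) (A1 A2 A12 : B0 R d),
     A1 `&` A2 = set0 -> A12 = A1 `|` A2 :> set _ ->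
     w (rect hst A1) + w (rect hst A2) = w (rect hst A12)).

(* X = phi ((W([t_(i-1), t_i) x A_j))_(i, j)) by additivity, where
   0 = t_0 <= t_1 < ... < t_n and the A_j are mutually disjoint.
   Rows and times are numbered from 0, and only t 0, ..., t n matter. *)
Definition represents (R : realType) (d n m : nat) (t : nat -> R)
    (A : 'I_m -> B0 R d) (phi : 'M[R]_(n, m) -> R) (X : Omega R d -> R) :
    Prop :=
  exists ht : forall i : 'I_n, 0 <= t i <= t i.+1,
  [/\ t 0%N = 0 /\ (forall i : nat, (0 < i < n)%N -> t i < t i.+1),
      forall j k : 'I_m, j != k -> A j `&` A k = set0,
      C_lLip phi &
      forall w, additive_path w ->
        X w = phi (\matrix_(i < n, j < m)
                     canonical_process (rect (ht i) (A j)) w)].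

(* xi 0, ..., xi n.-1 are the m-dimensional G-normal vectors of the
   construction; the other values of xi are irrelevant. *)
Definition normal_sequence (R : realType) (d n m : nat) (s2lo s2up : R)
    (A : 'I_m -> B0 R d) (T : Type) (H : set (T -> R)) (E : (T -> R) -> R)
    (xi : nat -> T -> 'rV[R]_m) : Prop :=
  [/\ sublinear_expectation_space H E,
      forall i, (i < n)%N -> G_normal H E (xi i),
      forall i, (0 < i < n)%N ->
        independent_from E (xi i)
          (fun w => mxvec (\matrix_(k < i, j < m) xi k w 0 j)) &
      forall i (Q : 'M[R]_m), (i < n)%N -> Q^T = Q ->
        2^-1 * E (fun w => (xi i w *m Q *m (xi i w)^T) 0 0)
        = Gfun s2lo s2up (\sum_(j < m) Q j j * lambda (A j))].

Definition constructed_value (R : realType) (d : nat) (s2lo s2up : R)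
    (X : Omega R d -> R) : set R :=
  [set v | exists (n m : nat) (t : nat -> R) (A : 'I_m -> B0 R d)
             (phi : 'M[R]_(n, m) -> R)
             (T : Type) (H : set (T -> R)) (E : (T -> R) -> R)
             (xi : nat -> T -> 'rV[R]_m),
     [/\ represents t A phi X, normal_sequence n s2lo s2up A H E xi &
         v = E (fun w => phi (\matrix_(i < n, j < m)
                               (Num.sqrt (t i.+1 - t i) * xi i w 0 j)))]].

(* The default value 0 is used only where the construction gives no value. *)
Definition Ehat (R : realType) (d : nat) (s2lo s2up : R)
    (X : Omega R d -> R) : R :=
  xget 0 (constructed_value s2lo s2up X).

(* Main.v *)
Require Import Defs.
From HB Require Import structures.
From mathcomp Require Import all_boot all_order all_algebra.
From mathcomp Require Import all_classical all_reals all_analysis.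
From mathcomp Require Import ring lra zify.
Import Order.TTheory GRing.Theory Num.Theory.
Import numFieldNormedType.Exports.
Local Open Scope classical_set_scope.
Local Open Scope ring_scope.
Set Implicit Arguments.
Unset Strict Implicit.
Unset Printing Implicit Defensive.


(** The value attached to a random variable X depends on a grid of times and of
    disjoint sets through whose increments X is expressed, and on a model of
    the independent G-normal vectors over that grid. Everything rests on the
    fact that a G-normal law is determined by its second moments ([law_unique]).

    This is the uniqueness of the G-heat semigroup in disguise. If nu is a
    G-normal law, stability makes t |-> nu (f (sqrt t *: _)) a semigroup of
    sublinear functionals under convolution ([law_csg]). Two such semigroups
    that agree on polynomials of degree two agree on all test functions
    ([csg_unique]): averaging a Lipschitz function with a smooth weight
    replaces it, around every point, by a quadratic polynomial up to a cubic
    error ([mollify]); subadditivity turns the averaged value function of one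
    semigroup into a supersolution for the other ([csg_step]); over a time step
    h the loss is of order h ^ (3/2), so the accumulated loss vanishes with h,
    and then the width of the averaging is sent to 0. No differential equation
    is solved, and the weight is a finite lattice sum, so that nothing has to be
    integrated.

    Existence of the G-normal laws comes from the same uniqueness. A symmetric
    random walk whose step may be chosen at each time between a short and a
    long one has, along an ultrafilter, a limit as the mesh is refined
    ([gsg]); the limit is a semigroup ([gsg_csg]) with the expected second
    moments, and comparing it with its own rescalings shows that its time 1
    functional is a G-normal law ([std_law]). Iterated expectation over the
    rows of a matrix ([En]) then realises sequences of independent vectors.

    Two representations of X can be transferred to one common grid
    ([frame_exists]) without changing the value: the weighted sum of consecutive
    independent vectors has by stability the law of one vector ([En_blocks]),
    and the sums over cells have the right law by their second moments
    ([cell_law_coarse]). What makes the transfer rigorous is that sums of point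
    masses over marked cells are additive paths with arbitrary increments
    ([pmass_additive], [pmass_values]), so that X is known on them. Hence the
    expectation is well defined ([constructed_unique]) and is an iterated
    expectation over any sufficiently fine grid ([EhatE]); sublinearity, the
    joint law of the field over a time interval ([rect_law]) and independence of
    the future from the past ([rect_independent]) are read off from this
    formula. The reference noise is the canonical process over [0, 1). *)

(** * Locally Lipschitz functions of polynomial growth *)

Section Norm.
Variable R : realType.

(** The l1 norm: sums over coordinates are exact for it, so no square root
    appears in any estimate. [slipP] shows that the class of test functions is
    the same as with the Euclidean norm. *)
Definition nrm (m n : nat) (x : 'M[R]_(m, n)) : R :=
  \sum_(i < m) \sum_(j < n) `|x i j|.

Lemma nrm_ge0 m n (x : 'M[R]_(m, n)) : 0 <= nrm x.
Proof. by apply: sumr_ge0 => i _; apply: sumr_ge0. Qed.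

Lemma nrm0 m n : nrm (0 : 'M[R]_(m, n)) = 0.
Proof. by rewrite /nrm big1 // => i _; rewrite big1 // => j _; rewrite mxE normr0. Qed.

Lemma nrmD m n (x y : 'M[R]_(m, n)) : nrm (x + y) <= nrm x + nrm y.
Proof.
rewrite -big_split; apply: ler_sum => i _; rewrite -big_split.
by apply: ler_sum => j _; rewrite mxE ler_normD.
Qed.

Lemma nrmZ m n (c : R) (x : 'M[R]_(m, n)) : nrm (c *: x) = `|c| * nrm x.
Proof.
rewrite /nrm mulr_sumr; apply: eq_bigr => i _; rewrite mulr_sumr.
by apply: eq_bigr => j _; rewrite mxE normrM.
Qed.

Lemma nrmN m n (x : 'M[R]_(m, n)) : nrm (- x) = nrm x.
Proof. by rewrite -scaleN1r nrmZ normrN1 mul1r. Qed.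

Lemma nrmB m n (x y : 'M[R]_(m, n)) : nrm (x - y) <= nrm x + nrm y.
Proof. by rewrite (le_trans (nrmD _ _)) // nrmN. Qed.

Lemma nrm_sum m n (I : Type) (r : seq I) (P : pred I) (F : I -> 'M[R]_(m, n)) :
  nrm (\sum_(i <- r | P i) F i) <= \sum_(i <- r | P i) nrm (F i).
Proof.
elim/big_rec2: _ => [|i y x _ h]; first by rewrite nrm0.
by rewrite (le_trans (nrmD _ _)) // lerD2l.
Qed.

Lemma nrm_coord m n (x : 'M[R]_(m, n)) i j : `|x i j| <= nrm x.
Proof.
rewrite /nrm (bigD1 i) //= (bigD1 j) //= -addrA lerDl addr_ge0 // ?sumr_ge0 //.
by move=> k _; exact: sumr_ge0.
Qed.

Lemma nrm_row n (x : 'rV[R]_n) : nrm x = \sum_(j < n) `|x 0 j|.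
Proof. by rewrite /nrm big_ord1. Qed.

Lemma enorm_ge0 m n (x : 'M[R]_(m, n)) : 0 <= enorm x.
Proof. exact: sqrtr_ge0. Qed.

Lemma sum_sqr_le (I : Type) (r : seq I) (F : I -> R) :
  (forall i, 0 <= F i) -> \sum_(i <- r) F i ^+ 2 <= (\sum_(i <- r) F i) ^+ 2.
Proof.
move=> F0; elim: r => [|a r ih]; first by rewrite !big_nil expr0n.
rewrite !big_cons sqrrD (le_trans (y := F a ^+ 2 + (\sum_(i <- r) F i) ^+ 2)) ?lerD2l //.
by rewrite lerD2r lerDl mulrn_wge0 // mulr_ge0 // sumr_ge0.
Qed.

Lemma enorm_le m n (x : 'M[R]_(m, n)) : enorm x <= nrm x.
Proof.
rewrite -(ger0_norm (nrm_ge0 x)) -sqrtr_sqr.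
apply: ler_wsqrtr; rewrite /nrm.
apply: le_trans (sum_sqr_le _ _); last by move=> i; exact: sumr_ge0.
apply: ler_sum => i _; under eq_bigr do rewrite -real_normK ?num_real //.
exact: sum_sqr_le.
Qed.

Lemma enorm_coord m n (x : 'M[R]_(m, n)) i j : `|x i j| <= enorm x.
Proof.
rewrite -sqrtr_sqr; apply: ler_wsqrtr.
rewrite (bigD1 i) //= (bigD1 j) //= -addrA lerDl addr_ge0 ?sumr_ge0 //.
- by move=> k _; exact: sqr_ge0.
- by move=> k _; apply: sumr_ge0 => l _; exact: sqr_ge0.
Qed.

Lemma nrm_le_enorm m n (x : 'M[R]_(m, n)) : nrm x <= (m * n)%:R * enorm x.
Proof.
have -> : (m * n)%:R * enorm x = \sum_(i < m) \sum_(j < n) enorm x.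
  by rewrite !(sumr_const, card_ord) -mulrnA mulr_natl mulnC.
by apply: ler_sum => i _; apply: ler_sum => j _; exact: enorm_coord.
Qed.

(** A multiplicative form of the weight: powers of it are stable under
    products and, up to constants, under composition. *)
Definition wgt m n (x y : 'M[R]_(m, n)) : R := 1 + nrm x + nrm y.

Lemma wgt_ge1 m n (x y : 'M[R]_(m, n)) : 1 <= wgt x y.
Proof. by rewrite /wgt -addrA lerDl addr_ge0 ?nrm_ge0. Qed.

Lemma wgt_ge0 m n (x y : 'M[R]_(m, n)) : 0 <= wgt x y.
Proof. exact: le_trans (wgt_ge1 x y). Qed.

Lemma wgtX_le m n (x y : 'M[R]_(m, n)) p q :
  (p <= q)%N -> wgt x y ^+ p <= wgt x y ^+ q.
Proof. by move=> pq; apply: ler_weXn2l => //; exact: wgt_ge1. Qed.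

(** Maps between matrix spaces that are locally Lipschitz with polynomial
    growth; for scalar maps this is the class C_lLip. *)
Definition vlip m n m' n' (f : 'M[R]_(m, n) -> 'M[R]_(m', n')) :=
  exists (C : R) (q : nat), 0 <= C /\
    forall x y, nrm (f x - f y) <= C * wgt x y ^+ q * nrm (x - y).

Definition slip m n (f : 'M[R]_(m, n) -> R) :=
  exists (C : R) (q : nat), 0 <= C /\
    forall x y, `|f x - f y| <= C * wgt x y ^+ q * nrm (x - y).

Lemma slipP m n (f : 'M[R]_(m, n) -> R) : C_lLip f <-> slip f.
Proof.
split=> -[C [q [C0 h]]].
- exists (C * 3), q; split; first by rewrite mulr_ge0 // ltW.
  move=> x y; apply: (le_trans (h x y)).
  apply: ler_pM; rewrite ?enorm_ge0 ?enorm_le //.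
    by rewrite mulr_ge0 ?addr_ge0 ?exprn_ge0 ?enorm_ge0 // ltW.
  rewrite -mulrA ler_wpM2l ?(ltW C0) //.
  have a1 : 1 <= wgt x y ^+ q by rewrite exprn_ege1 ?wgt_ge1.
  have a2 : enorm x ^+ q <= wgt x y ^+ q.
    apply: lerXn2r; rewrite ?nnegrE ?enorm_ge0 ?wgt_ge0 //.
    by rewrite (le_trans (enorm_le x)) // /wgt; have := nrm_ge0 y; lra.
  have a3 : enorm y ^+ q <= wgt x y ^+ q.
    apply: lerXn2r; rewrite ?nnegrE ?enorm_ge0 ?wgt_ge0 //.
    by rewrite (le_trans (enorm_le y)) // /wgt; have := nrm_ge0 x; lra.
  lra.
- pose k : R := (m * n)%:R.
  have k0 : 0 <= k by rewrite ler0n.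
  exists (C * (1 + 2 * k) ^+ q * k + 1), q; split.
    by rewrite ltr_wpDl // ?mulr_ge0 ?exprn_ge0 // addr_ge0 ?mulr_ge0.
  move=> x y; apply: (le_trans (h x y)).
  set a := enorm x; set b := enorm y.
  have a0 : 0 <= a := enorm_ge0 _.
  have b0 : 0 <= b := enorm_ge0 _.
  have W : wgt x y ^+ q <= (1 + 2 * k) ^+ q * (1 + a ^+ q + b ^+ q).
    have [M [M1 [Ma Mb] Mq]] : exists M : R, [/\ 1 <= M, a <= M /\ b <= M & M ^+ q <= 1 + a ^+ q + b ^+ q].
      have aq := exprn_ge0 q a0; have bq := exprn_ge0 q b0.
      have [ab|/ltW ba] := leP a b.
        have [b1|/ltW b1] := leP b 1.
          by exists 1; split=> //; [split=> //; exact: le_trans b1|rewrite expr1n; lra].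
        by exists b; split=> //; lra.
      have [b1|/ltW b1] := leP a 1.
        by exists 1; split=> //; [split=> //; exact: le_trans b1|rewrite expr1n; lra].
      by exists a; split=> //; lra.
    apply: (@le_trans _ _ ((1 + 2 * k) ^+ q * M ^+ q)); last first.
      by rewrite ler_wpM2l // exprn_ge0 // addr_ge0 // mulr_ge0.
    rewrite -exprMn; apply: lerXn2r; rewrite ?nnegrE ?wgt_ge0 //.
      by rewrite mulr_ge0 ?addr_ge0 ?mulr_ge0 // (le_trans _ M1).
    have := nrm_le_enorm x; have := nrm_le_enorm y; rewrite -/k -/a -/b /wgt => hy hx.
    have : k * a <= k * M by rewrite ler_wpM2l.
    have : k * b <= k * M by rewrite ler_wpM2l.
    nra.
  have E := nrm_le_enorm (x - y); rewrite -/k in E.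
  apply: (@le_trans _ _ (C * ((1 + 2 * k) ^+ q * (1 + a ^+ q + b ^+ q)) * (k * enorm (x - y)))).
    apply: ler_pM => //; rewrite ?nrm_ge0 ?mulr_ge0 ?exprn_ge0 ?wgt_ge0 //.
    by rewrite ler_wpM2l.
  rewrite [leRHS](_ : _ = C * ((1 + 2 * k) ^+ q * (1 + a ^+ q + b ^+ q)) * (k * enorm (x - y)) + (1 + a ^+ q + b ^+ q) * enorm (x - y)); last by ring.
  by rewrite lerDl mulr_ge0 ?enorm_ge0 ?addr_ge0 ?exprn_ge0.
Qed.

End Norm.

Section Lip.
Variable R : realType.
Implicit Types m n : nat.

Lemma weight_bound (C a w : R) q : 0 <= C -> 0 <= a -> a <= C * w -> 1 <= w ->
  a ^+ q <= C ^+ q * w ^+ q.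
Proof.
move=> C0 a0 aw w1; rewrite -exprMn; apply: lerXn2r; rewrite ?nnegrE //.
by rewrite mulr_ge0 // (le_trans _ w1).
Qed.

Lemma slip_cst m n (c : R) : slip (fun _ : 'M[R]_(m, n) => c).
Proof.
by exists 0, 0%N; split=> // x y; rewrite subrr normr0 !mul0r.
Qed.

Lemma slip_coord m n i j : slip (fun x : 'M[R]_(m, n) => x i j).
Proof.
exists 1, 0%N; split=> // x y; rewrite expr0 !mul1r.
by have := nrm_coord (x - y) i j; rewrite !mxE.
Qed.

Lemma slip_nrm m n : slip (@nrm R m n).
Proof.
exists 1, 0%N; split=> // x y; rewrite expr0 !mul1r.
have h1 := nrmD (x - y) y; have h2 := nrmD (y - x) x.
rewrite subrK in h1; rewrite subrK -opprB nrmN in h2.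
by rewrite ler_norml; apply/andP; split; lra.
Qed.

Lemma slip_bound m n (f : 'M[R]_(m, n) -> R) : slip f ->
  exists C q, 0 <= C /\ forall x, `|f x| <= C * (1 + nrm x) ^+ q.
Proof.
move=> [C [q [C0 h]]]; exists (`|f 0| + C), q.+1; split; first exact: addr_ge0.
move=> x.
have h1 : `|f x| <= `|f 0| + `|f x - f 0|.
  by rewrite -lerBlDl (le_trans (lerB_dist _ _)).
apply: (le_trans h1); rewrite mulrDl; apply: lerD.
  by rewrite ler_peMr // exprn_ege1 // lerDl nrm_ge0.
apply: (le_trans (h x 0)); rewrite /wgt nrm0 addr0 subr0 -mulrA ler_wpM2l //.
rewrite exprSr ler_wpM2l ?exprn_ge0 ?addr_ge0 ?nrm_ge0 //.
by rewrite lerDr.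
Qed.

Lemma slip_le m n (C C' : R) q q' (x y : 'M[R]_(m, n)) :
  0 <= C -> C <= C' -> (q <= q')%N ->
  C * wgt x y ^+ q * nrm (x - y) <= C' * wgt x y ^+ q' * nrm (x - y).
Proof.
move=> C0 CC qq; rewrite ler_wpM2r ?nrm_ge0 //.
by apply: ler_pM => //; rewrite ?exprn_ge0 ?wgt_ge0 ?wgtX_le.
Qed.

Lemma slipD m n (f g : 'M[R]_(m, n) -> R) : slip f -> slip g ->
  slip (fun x => f x + g x).
Proof.
move=> [C [q [C0 hf]]] [D [p [D0 hg]]].
exists (C + D), (maxn q p); split; first exact: addr_ge0.
move=> x y; rewrite opprD addrACA (le_trans (ler_normD _ _)) //.
rewrite !mulrDl; apply: lerD.
  by apply: (le_trans (hf x y)); apply: slip_le => //; rewrite leq_maxl.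
by apply: (le_trans (hg x y)); apply: slip_le => //; rewrite leq_maxr.
Qed.

Lemma slipZ m n (c : R) (f : 'M[R]_(m, n) -> R) : slip f -> slip (fun x => c * f x).
Proof.
move=> [C [q [C0 h]]]; exists (`|c| * C), q; split; first exact: mulr_ge0.
by move=> x y; rewrite -mulrBr normrM -!mulrA ler_wpM2l // mulrA.
Qed.

Lemma slipN m n (f : 'M[R]_(m, n) -> R) : slip f -> slip (fun x => - f x).
Proof.
move=> /(slipZ (-1)); rewrite (_ : (fun x => _) = (fun x => - f x)) //.
by apply/funext => x; rewrite mulN1r.
Qed.

Lemma slipB m n (f g : 'M[R]_(m, n) -> R) : slip f -> slip g ->
  slip (fun x => f x - g x).
Proof. by move=> hf hg; apply: slipD => //; exact: slipN. Qed.

Lemma slip_abs m n (f : 'M[R]_(m, n) -> R) : slip f -> slip (fun x => `|f x|).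
Proof.
move=> [C [q [C0 h]]]; exists C, q; split=> // x y.
exact: le_trans (ler_dist_dist _ _) (h x y).
Qed.

Lemma slipM m n (f g : 'M[R]_(m, n) -> R) : slip f -> slip g ->
  slip (fun x => f x * g x).
Proof.
move=> hf hg; have [A [a [A0 bf]]] := slip_bound hf.
have [B [b [B0 bg]]] := slip_bound hg.
move: hf hg => [C [q [C0 hf]]] [D [p [D0 hg]]].
exists (A * D + B * C), (maxn (a + p) (b + q)); split.
  by rewrite addr_ge0 ?mulr_ge0.
move=> x y.
have -> : f x * g x - f y * g y = f x * (g x - g y) + g y * (f x - f y) by ring.
rewrite (le_trans (ler_normD _ _)) // !normrM !mulrDl; apply: lerD.
- apply: (@le_trans _ _ (A * D * wgt x y ^+ (a + p) * nrm (x - y))); last first.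
    by apply: slip_le; rewrite ?mulr_ge0 ?leq_maxl.
  rewrite exprD (_ : _ * _ = (A * wgt x y ^+ a) * (D * wgt x y ^+ p * nrm (x - y))); last by ring.
  apply: ler_pM => //; apply: (le_trans (bf x)); rewrite ler_wpM2l //.
  by apply: lerXn2r; rewrite ?nnegrE ?wgt_ge0 ?addr_ge0 ?nrm_ge0 // /wgt lerDl nrm_ge0.
- apply: (@le_trans _ _ (B * C * wgt x y ^+ (b + q) * nrm (x - y))); last first.
    by apply: slip_le; rewrite ?mulr_ge0 ?leq_maxr.
  rewrite exprD (_ : _ * _ = (B * wgt x y ^+ b) * (C * wgt x y ^+ q * nrm (x - y))); last by ring.
  apply: ler_pM => //; apply: (le_trans (bg y)); rewrite ler_wpM2l //.
  apply: lerXn2r; rewrite ?nnegrE ?wgt_ge0 ?addr_ge0 ?nrm_ge0 // /wgt.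
  by rewrite addrAC lerDl nrm_ge0.
Qed.

Lemma slipX m n (f : 'M[R]_(m, n) -> R) k : slip f -> slip (fun x => f x ^+ k).
Proof.
move=> hf; elim: k => [|k ih].
  by rewrite (_ : (fun x => _) = (fun=> 1)) //; exact: slip_cst.
rewrite (_ : (fun x => _) = (fun x => f x * f x ^+ k)); first exact: slipM.
by apply/funext => x; rewrite exprS.
Qed.

Lemma slip_sum m n (I : Type) (r : seq I) (F : I -> 'M[R]_(m, n) -> R) :
  (forall i, slip (F i)) -> slip (fun x => \sum_(i <- r) F i x).
Proof.
move=> h; elim: r => [|a r ih].
  rewrite (_ : (fun x => _) = (fun=> 0)); first exact: slip_cst.
  by apply/funext => x; rewrite big_nil.
rewrite (_ : (fun x => _) = (fun x => F a x + \sum_(i <- r) F i x)).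
  exact: slipD.
by apply/funext => x; rewrite big_cons.
Qed.

(** The coordinates come with different constants and exponents; finitely many
    of them have a common bound. *)
Lemma vlipP m n m' n' (f : 'M[R]_(m, n) -> 'M[R]_(m', n')) :
  (forall i j, slip (fun x => f x i j)) -> vlip f.
Proof.
move=> h.
have [C [q [C0 Cq]]] : exists C q, 0 <= C /\ forall i j x y,
    `|f x i j - f y i j| <= C * wgt x y ^+ q * nrm (x - y).
  pose c i j := projT1 (cid (h i j)).
  have hc i j := projT2 (cid (h i j)); rewrite -/(c _ _) in hc.
  pose d i j := projT1 (cid (hc i j)).
  have hd i j := projT2 (cid (hc i j)); rewrite -/(d _ _) in hd.
  exists (\sum_i \sum_j c i j), (\max_i \max_j d i j)%N; split.
    by apply: sumr_ge0 => i _; apply: sumr_ge0 => j _; case: (hd i j).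
  move=> i j x y; have [c0 hh] := hd i j; apply: (le_trans (hh x y)).
  apply: slip_le => //.
    rewrite (bigD1 i) //= (bigD1 j) //= -addrA lerDl addr_ge0 // ?sumr_ge0 //.
      by move=> k _; case: (hd i k).
    by move=> k _; apply: sumr_ge0 => l _; case: (hd k l).
  exact: leq_trans (leq_bigmax (F := d i) j) (leq_bigmax (F := fun i => \max_j d i j)%N i).
exists (\sum_(i < m') \sum_(j < n') C), q; split.
  by apply: sumr_ge0 => i _; apply: sumr_ge0.
move=> x y; rewrite -mulrA mulr_suml; apply: ler_sum => i _.
rewrite mulr_suml; apply: ler_sum => j _; rewrite !mxE mulrA; exact: Cq.
Qed.

Lemma slip_comp m n m' n' (f : 'M[R]_(m', n') -> R)
    (g : 'M[R]_(m, n) -> 'M[R]_(m', n')) :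
  slip f -> vlip g -> slip (fun x => f (g x)).
Proof.
move=> [C [q [C0 hf]]] [D [p [D0 hg]]].
pose K : R := 1 + 2 * nrm (g 0) + 2 * D.
have K0 : 0 <= K by rewrite ?addr_ge0 ?mulr_ge0 ?nrm_ge0.
exists (C * K ^+ q * D), (p.+1 * q + p)%N; split.
  by rewrite ?mulr_ge0 ?exprn_ge0.
move=> x y; apply: (le_trans (hf _ _)).
have W1 := wgt_ge1 x y; have W0 := wgt_ge0 x y.
have gb z : 1 + nrm z <= wgt x y -> nrm (g z) <= nrm (g 0) + D * wgt x y ^+ p.+1.
  move=> hz; have := nrmD (g z - g 0) (g 0); rewrite subrK => h.
  rewrite (le_trans h) // addrC lerD2l (le_trans (hg z 0)) // /wgt nrm0 addr0 subr0.
  rewrite -mulrA ler_wpM2l // exprSr; apply: ler_pM; rewrite ?nrm_ge0 ?exprn_ge0 ?addr_ge0 ?nrm_ge0 //.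
    by apply: lerXn2r; rewrite ?nnegrE ?addr_ge0 ?nrm_ge0.
  by rewrite (le_trans _ hz) // lerDr.
have gx := gb x _; have gy := gb y _.
have {}gx : nrm (g x) <= nrm (g 0) + D * wgt x y ^+ p.+1 by apply: gx; rewrite /wgt lerDl nrm_ge0.
have {}gy : nrm (g y) <= nrm (g 0) + D * wgt x y ^+ p.+1 by apply: gy; rewrite /wgt addrAC lerDl nrm_ge0.
have P1 : 1 <= wgt x y ^+ p.+1 by exact: exprn_ege1.
have WW : wgt (g x) (g y) <= K * wgt x y ^+ p.+1.
  rewrite /K {1}/wgt; have g0 := nrm_ge0 (g 0).
  have : nrm (g 0) <= nrm (g 0) * wgt x y ^+ p.+1 by rewrite ler_peMr.
  nra.
apply: (@le_trans _ _ (C * (K ^+ q * wgt x y ^+ (p.+1 * q)) * (D * wgt x y ^+ p * nrm (x - y)))).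
  apply: ler_pM; rewrite ?nrm_ge0 ?mulr_ge0 ?exprn_ge0 ?wgt_ge0 //.
  rewrite ler_wpM2l // exprM; apply: weight_bound => //; exact: wgt_ge0.
by rewrite exprD le_eqVlt; apply/orP; left; apply/eqP; ring.
Qed.

Lemma lin_bound m n m' n' (f : 'M[R]_(m, n) -> 'M[R]_(m', n')) : linear f ->
  exists K, 0 <= K /\ forall x y, nrm (f x - f y) <= K * nrm (x - y).
Proof.
move=> lf.
have f0 : f 0 = 0 by have := lf (-1) 0 0; rewrite scaleN1r oppr0 addr0 scaleN1r addNr.
have fD x y : f (x + y) = f x + f y by have := lf 1 x y; rewrite !scale1r.
have fZ a x : f (a *: x) = a *: f x by have := lf a x 0; rewrite !addr0 f0 addr0.
have fS (I : Type) (r : seq I) F : f (\sum_(i <- r) F i) = \sum_(i <- r) f (F i).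
  by elim: r => [|a r ih]; rewrite ?big_nil ?f0 // !big_cons fD ih.
exists (\sum_i \sum_j nrm (f (delta_mx i j))); split.
  by apply: sumr_ge0 => i _; apply: sumr_ge0 => j _; exact: nrm_ge0.
move=> x y; have -> : f x - f y = f (x - y).
  by rewrite fD -scaleN1r -[- y]scaleN1r fZ.
move: (x - y) => z.
rewrite {1}(matrix_sum_delta z) fS (le_trans (nrm_sum _ _ _)) // mulr_suml.
apply: ler_sum => i _; rewrite fS (le_trans (nrm_sum _ _ _)) // mulr_suml.
apply: ler_sum => j _; rewrite fZ nrmZ mulrC ler_wpM2l ?nrm_ge0 //.
exact: nrm_coord.
Qed.

Lemma lin_vlip m n m' n' (f : 'M[R]_(m, n) -> 'M[R]_(m', n')) : linear f -> vlip f.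
Proof.
move=> /lin_bound[K [K0 h]]; exists K, 0%N; split=> // x y.
by rewrite expr0 mulr1.
Qed.

(** Joint regularity of a function of two matrices. *)
Definition slip2 m n m' n' (f : 'M[R]_(m, n) -> 'M[R]_(m', n') -> R) :=
  exists (C : R) (q : nat), 0 <= C /\ forall x x' y y',
    `|f x y - f x' y'| <=
      C * ((1 + nrm x + nrm x') * (1 + nrm y + nrm y')) ^+ q *
      (nrm (x - x') + nrm (y - y')).

(** The weight of a sum is at most the product of the weights of its terms,
    which is why [slip2] is stated with a product. *)
Lemma slip2_lin m n m' n' m'' n'' (f : 'M[R]_(m'', n'') -> R)
   (L1 : 'M[R]_(m, n) -> 'M[R]_(m'', n'')) (L2 : 'M[R]_(m', n') -> 'M[R]_(m'', n'')) :
  slip f -> linear L1 -> linear L2 -> slip2 (fun x y => f (L1 x + L2 y)).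
Proof.
move=> [C [q [C0 hf]]] l1 l2.
have [K1 [K10 h1]] := lin_bound l1; have [K2 [K20 h2]] := lin_bound l2.
have L10 : L1 0 = 0 by have := l1 (-1) 0 0; rewrite scaleN1r oppr0 addr0 scaleN1r addNr.
have L20 : L2 0 = 0 by have := l2 (-1) 0 0; rewrite scaleN1r oppr0 addr0 scaleN1r addNr.
have b1 x : nrm (L1 x) <= K1 * nrm x by have := h1 x 0; rewrite L10 !subr0.
have b2 x : nrm (L2 x) <= K2 * nrm x by have := h2 x 0; rewrite L20 !subr0.
pose K := 1 + K1 + K2.
exists (C * K ^+ q * K), q; split.
  by rewrite ?mulr_ge0 ?exprn_ge0 ?addr_ge0.
move=> x x' y y'; apply: (le_trans (hf _ _)).
have K0 : 0 <= K by rewrite ?addr_ge0.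
have n1 := nrm_ge0 x; have n2 := nrm_ge0 x'; have n3 := nrm_ge0 y; have n4 := nrm_ge0 y'.
have WW : wgt (L1 x + L2 y) (L1 x' + L2 y') <=
    K * ((1 + nrm x + nrm x') * (1 + nrm y + nrm y')).
  apply: (@le_trans _ _ (1 + K1 * (nrm x + nrm x') + K2 * (nrm y + nrm y'))).
    rewrite /wgt; have := nrmD (L1 x) (L2 y); have := nrmD (L1 x') (L2 y').
    have := b1 x; have := b1 x'; have := b2 y; have := b2 y'; lra.
  move: (addr_ge0 n1 n2) (addr_ge0 n3 n4); rewrite -!(addrA 1).
  move: (nrm x + nrm x') (nrm y + nrm y') => a b a0 b0; rewrite /K.
  have := mulr_ge0 a0 b0; have := mulr_ge0 K10 a0; have := mulr_ge0 K20 b0.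
  have := mulr_ge0 K10 b0; have := mulr_ge0 K20 a0.
  have := mulr_ge0 K10 (mulr_ge0 a0 b0); have := mulr_ge0 K20 (mulr_ge0 a0 b0); nra.
have DD : nrm (L1 x + L2 y - (L1 x' + L2 y')) <= K * (nrm (x - x') + nrm (y - y')).
  rewrite opprD addrACA (le_trans (nrmD _ _)) //.
  have := h1 x x'; have := h2 y y'; rewrite /K.
  have m1 := nrm_ge0 (x - x'); have m2 := nrm_ge0 (y - y').
  have := mulr_ge0 K10 m2; have := mulr_ge0 K20 m1; nra.
rewrite [leRHS](_ : _ = C * (K ^+ q * ((1 + nrm x + nrm x') * (1 + nrm y + nrm y')) ^+ q) * (K * (nrm (x - x') + nrm (y - y')))); last by ring.
apply: ler_pM; rewrite ?nrm_ge0 ?mulr_ge0 ?exprn_ge0 ?wgt_ge0 //.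
rewrite ler_wpM2l // -exprMn; apply: lerXn2r; rewrite ?nnegrE ?wgt_ge0 //.
by rewrite ?mulr_ge0 ?addr_ge0.
Qed.

Lemma slip2_sec m n m' n' (f : 'M[R]_(m, n) -> 'M[R]_(m', n') -> R) x :
  slip2 f -> slip (f x).
Proof.
move=> [C [q [C0 h]]]; exists (C * (1 + nrm x + nrm x) ^+ q), q; split.
  by rewrite mulr_ge0 ?exprn_ge0 ?addr_ge0 ?nrm_ge0.
move=> y y'; apply: (le_trans (h x x y y')).
by rewrite subrr nrm0 add0r exprMn /wgt !mulrA.
Qed.

End Lip.

(** * Sublinear functionals on test functions *)

Section Sublin.
Variable R : realType.
Implicit Types m n : nat.

Record sublin m n (mu : ('M[R]_(m, n) -> R) -> R) : Prop := Sublin {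
  sub_mono : forall f g, slip f -> slip g -> (forall x, f x <= g x) -> mu f <= mu g ;
  sub_cst : forall c, mu (fun=> c) = c ;
  sub_add : forall f g, slip f -> slip g -> mu (fun x => f x + g x) <= mu f + mu g ;
  sub_hom : forall c f, 0 <= c -> slip f -> mu (fun x => c * f x) = c * mu f }.

Section Theory.
Variables (m n : nat) (mu : ('M[R]_(m, n) -> R) -> R).
Hypothesis hmu : sublin mu.

Lemma sub_diff f g : slip f -> slip g -> mu f - mu g <= mu (fun x => f x - g x).
Proof.
move=> hf hg; rewrite lerBlDr.
rewrite {1}(_ : f = (fun x => (f x - g x) + g x)); last by apply/funext => x; rewrite subrK.
by apply: sub_add => //; exact: slipB.
Qed.

(** Subadditivity gives mu f - mu g <= mu (f - g), whence a pointwise bound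
    passes through mu. This is the only way in which errors are propagated
    below. *)
Lemma sub_close f g e : slip f -> slip g -> slip e ->
  (forall x, `|f x - g x| <= e x) -> `|mu f - mu g| <= mu e.
Proof.
move=> hf hg he h; rewrite ler_norml; apply/andP; split.
  rewrite lerNl opprB; apply: (le_trans (sub_diff hg hf)); apply: sub_mono => //.
    exact: slipB.
  by move=> x; rewrite (le_trans (ler_norm _)) // distrC.
apply: (le_trans (sub_diff hf hg)); apply: sub_mono => //; first exact: slipB.
by move=> x; rewrite (le_trans (ler_norm _)).
Qed.

Lemma sub_addc f c : slip f -> mu (fun x => f x + c) = mu f + c.
Proof.
move=> hf; apply/eqP; rewrite eq_le; apply/andP; split.
  by rewrite -[in leRHS](sub_cst hmu c); apply: sub_add => //; exact: slip_cst.
have h : slip (fun x => f x + c) by apply: slipD => //; exact: slip_cst.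
have := sub_diff hf h; rewrite (_ : (fun x => f x - _) = (fun=> - c)).
  by rewrite sub_cst //; lra.
by apply/funext => x; ring.
Qed.

Lemma sub_ge0 f : slip f -> (forall x, 0 <= f x) -> 0 <= mu f.
Proof.
by move=> hf h; rewrite -[leLHS](sub_cst hmu); apply: sub_mono => //; exact: slip_cst.
Qed.

Lemma sub_sum (I : Type) (r : seq I) (F : I -> 'M[R]_(m, n) -> R) (c : I -> R) :
  (forall i, 0 <= c i) -> (forall i, slip (F i)) ->
  mu (fun x => \sum_(i <- r) c i * F i x) <= \sum_(i <- r) c i * mu (F i).
Proof.
move=> c0 hF; elim: r => [|a r ih].
  rewrite big_nil (_ : (fun x => _) = (fun=> 0)) ?sub_cst //.
  by apply/funext => x; rewrite big_nil.
rewrite big_cons (_ : (fun x => _) = (fun x => c a * F a x + \sum_(i <- r) c i * F i x)).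
  apply: (le_trans (sub_add _ _ _)) => //; first exact: slipZ.
    by apply: slip_sum => i; exact: slipZ.
  by rewrite sub_hom // lerD2l.
by apply/funext => x; rewrite big_cons.
Qed.

(** The y-dependent part of the Lipschitz constant of x |-> f x y has
    polynomial growth, so it is integrated by mu into a constant. *)
Lemma slip_param m' n' (f : 'M[R]_(m', n') -> 'M[R]_(m, n) -> R) :
  slip2 f -> slip (fun x => mu (f x)).
Proof.
move=> hf; have hs x := slip2_sec x hf.
move: hf => [C [q [C0 h]]].
pose e (y : 'M[R]_(m, n)) := (1 + 2 * nrm y) ^+ q.
have he : slip e.
  apply: slipX; apply: slipD; first exact: slip_cst.
  by apply: slipZ; exact: slip_nrm.
have e0 : 0 <= mu e by apply: sub_ge0 => // y; rewrite exprn_ge0 // addr_ge0 ?mulr_ge0 ?nrm_ge0.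
exists (C * mu e), q; split; first exact: mulr_ge0.
move=> x x'; pose k := C * wgt x x' ^+ q * nrm (x - x').
have k0 : 0 <= k by rewrite ?mulr_ge0 ?exprn_ge0 ?wgt_ge0 ?nrm_ge0.
apply: (@le_trans _ _ (mu (fun y => k * e y))).
  apply: sub_close => //; first exact: slipZ.
  move=> y; apply: (le_trans (h x x' y y)); rewrite subrr nrm0 addr0 /k /e /wgt.
  by rewrite exprMn (_ : 1 + nrm y + nrm y = 1 + 2 * nrm y) ?le_eqVlt; [apply/orP; left; apply/eqP; ring|ring].
by rewrite sub_hom // /k le_eqVlt; apply/orP; left; apply/eqP; ring.
Qed.

Lemma sublin_image m' n' (L : 'M[R]_(m, n) -> 'M[R]_(m', n')) : vlip L ->
  sublin (fun f => mu (fun x => f (L x))).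
Proof.
move=> hL; split.
- by move=> f g hf hg h; apply: sub_mono => //; exact: slip_comp.
- by move=> c; rewrite sub_cst.
- by move=> f g hf hg; apply: sub_add => //; exact: slip_comp.
- by move=> c f c0 hf; rewrite sub_hom //; exact: slip_comp.
Qed.

End Theory.
End Sublin.

(** * Second-order expansion of averaged Lipschitz functions *)

Section Lattice.
Variable k : nat.

(** The lattice points of a cube of half-side M, centred at 0. *)
Definition cube (M : nat) : seq 'rV[int]_k :=
  [seq (\row_i ((f i : nat)%:Z - M%:Z)) | f : {ffun 'I_k -> 'I_(M.*2.+1)}].

Lemma size_cube M : size (cube M) = (M.*2.+1 ^ k)%N.
Proof. by rewrite size_map -cardT card_ffun !card_ord. Qed.

Lemma cube_uniq M : uniq (cube M).
Proof.
rewrite map_inj_uniq ?enum_uniq // => f g /rowP h; apply/ffunP => i.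
by apply/val_inj; have := h i; rewrite !mxE => /addIr [].
Qed.

Lemma mem_cube M (c : 'rV[int]_k) : (c \in cube M) = [forall i, `|c 0 i| <= M%:Z].
Proof.
apply/idP/forallP => [/mapP[f _ ->] i|h].
  rewrite mxE; have := ltn_ord (f i); move: (nat_of_ord (f i)) => a ha.
  by rewrite ler_norml; apply/andP; split; lia.
apply/mapP; exists [ffun i => inord (absz (c 0 i + M%:Z)%R)]; first by rewrite mem_enum.
apply/rowP => i; rewrite !mxE ffunE.
have := h i; rewrite ler_norml => /andP[h1 h2].
move: h1 h2; set a := c 0 i => h1 h2; rewrite inordK; lia.
Qed.

End Lattice.

(** A sum over a lattice window is invariant under translation as long as the
    window contains the supports of the function and of its translate. *)
Lemma big_shift (V : zmodType) (R : nmodType) (S : seq V) (F : V -> R) (z : V) :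
  uniq S -> (forall c, F c != 0 -> c \in S) -> (forall c, F (c + z) != 0 -> c \in S) ->
  \sum_(c <- S) F (c + z) = \sum_(c <- S) F c.
Proof.
move=> uS h1 h2.
rewrite (bigID (fun c => F (c + z) != 0)) /= [X in _ + X]big1 ?addr0; last first.
  by move=> c /negPn/eqP.
rewrite [RHS](bigID (fun c => F c != 0)) /= [X in _ = _ + X]big1 ?addr0; last first.
  by move=> c /negPn/eqP.
rewrite -big_filter -[RHS]big_filter -(big_map (fun c => c + z) xpredT F).
apply: perm_big; apply: uniq_perm.
- by rewrite map_inj_uniq ?filter_uniq //; exact: addIr.
- exact: filter_uniq.
- move=> c; rewrite mem_filter; apply/mapP/andP => [[b]|[Fc cS]].
    by rewrite mem_filter => /andP[Fb bS] ->; split=> //; exact: h1.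
  exists (c - z); last by rewrite subrK.
  by rewrite mem_filter subrK Fc; apply: h2; rewrite subrK.
Qed.

Section Kernel.
Variable R : realType.

Definition pospart (a : R) := Num.max a 0.

(** The cube of the positive part has a Lipschitz second derivative, hence a
    second-order Taylor formula with cubic remainder. *)
Lemma cube_taylor (a d : R) :
  `|pospart (a + d) ^+ 3 - pospart a ^+ 3 - 3 * pospart a ^+ 2 * d - 3 * pospart a * d ^+ 2|
  <= `|d| ^+ 3.
Proof.
rewrite /pospart; case: (leP (a + d) 0) => h1; case: (leP a 0) => h2.
- by rewrite (_ : _ - _ = 0) ?normr0 ?exprn_ge0 //; ring.
- rewrite (_ : _ - _ = d ^+ 3 - (a + d) ^+ 3); last by ring.
  have -> : `|d| = - d by rewrite ler0_norm //; lra.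
  have hb : 0 <= (- (a + d)) ^+ 3 by rewrite exprn_ge0 //; lra.
  have hc : (- (a + d)) ^+ 3 <= (- d) ^+ 3 by apply: lerXn2r; rewrite ?nnegrE; lra.
  by rewrite ler_norml; apply/andP; split; lra.
- rewrite (_ : _ - _ = (a + d) ^+ 3); last by ring.
  have -> : `|d| = d by rewrite ger0_norm //; lra.
  rewrite ger0_norm ?exprn_ge0 //; last by lra.
  by apply: lerXn2r; rewrite ?nnegrE; lra.
- by rewrite (_ : _ - _ = d ^+ 3) ?normrX //; ring.
Qed.

Variable k : nat.
Implicit Types y r z : 'rV[R]_k.

Definition dot y z : R := \sum_i y 0 i * z 0 i.

(** A compactly supported weight which is a cube of a positive part: it is
    twice differentiable with a Lipschitz second derivative, and its Taylor
    polynomial is explicit. *)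
Definition kern y : R := pospart (1 - dot y y) ^+ 3.

Lemma dot_ge0 y : 0 <= dot y y.
Proof. by apply: sumr_ge0 => i _; rewrite -expr2 sqr_ge0. Qed.

Lemma dot_sub y r : dot (y - r) (y - r) = dot y y - 2 * dot y r + dot r r.
Proof.
rewrite /dot mulr_sumr -sumrB -big_split; apply: eq_bigr => i _ /=.
by rewrite !mxE; ring.
Qed.

Lemma pospart_ge0 (a : R) : 0 <= pospart a.
Proof. by rewrite /pospart le_max lexx orbT. Qed.

Lemma pospart_le1 y : pospart (1 - dot y y) <= 1.
Proof. by rewrite /pospart ge_max ler01 andbT; have := dot_ge0 y; lra. Qed.

Lemma kern_ge0 y : 0 <= kern y.
Proof. by rewrite exprn_ge0 // pospart_ge0. Qed.

Lemma kern_supp y i : kern y != 0 -> `|y 0 i| < 1.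
Proof.
rewrite /kern expf_eq0 /= /pospart; case: (leP (1 - dot y y) 0) => [_ /eqP []//|h _].
have : y 0 i ^+ 2 < 1.
  have h2 : dot y y < 1 by lra.
  apply: le_lt_trans h2.
  rewrite /dot (bigD1 i) //= -expr2 lerDl sumr_ge0 // => j _.
  by rewrite -expr2 sqr_ge0.
by rewrite -(real_normK (num_real (y 0 i))) expr_lt1.
Qed.

(** First and second order parts of the expansion of the kernel at y in the
    direction -r. *)
Definition klin y r : R := 6 * pospart (1 - dot y y) ^+ 2 * dot y r.

Definition kquad y r : R :=
  12 * pospart (1 - dot y y) * dot y r ^+ 2 - 3 * pospart (1 - dot y y) ^+ 2 * dot r r.

Lemma kern_taylor y r : (forall i, `|y 0 i| <= 2) -> (forall i, `|r 0 i| <= 1) ->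
  `|kern (y - r) - kern y - (klin y r + kquad y r)|
    <= ((4 + k%:R) ^+ 3 + 3 * (8 + k%:R)) * nrm r ^+ 3.
Proof.
move=> hy hr; rewrite /kern /klin /kquad dot_sub.
set a := 1 - dot y y; set q := dot r r; set D := dot y r; set s := nrm r.
have s0 : 0 <= s := nrm_ge0 r.
have sk : s <= k%:R.
  rewrite /s nrm_row -[k in leRHS]card_ord -sumr_const; exact: ler_sum.
have q0 : 0 <= q := dot_ge0 r.
have qs : q <= s ^+ 2.
  rewrite /q /s nrm_row /dot; apply: le_trans (sum_sqr_le _ _) => //.
  by apply: ler_sum => i _; rewrite -expr2 real_normK ?num_real.
have Ds : `|D| <= 2 * s.
  rewrite /D /dot /s nrm_row mulr_sumr (le_trans (ler_norm_sum _ _ _)) //.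
  by apply: ler_sum => i _; rewrite normrM ler_wpM2r.
have -> : 1 - (dot y y - 2 * D + q) = a + (2 * D - q) by rewrite /a; ring.
set d := 2 * D - q; set P := pospart a.
have P0 : 0 <= P := pospart_ge0 a.
have P1 : P <= 1 := pospart_le1 y.
have dq : `|d| <= (4 + k%:R) * s.
  rewrite (le_trans (ler_normB _ _)) // normrM (ger0_norm q0) ger0_norm //.
  have : s ^+ 2 <= k%:R * s by rewrite expr2 ler_wpM2r.
  lra.
have := cube_taylor a d; rewrite -/P => T.
set X := pospart (a + d) ^+ 3 in T *.
have -> : X - P ^+ 3 - (6 * P ^+ 2 * D + (12 * P * D ^+ 2 - 3 * P ^+ 2 * q))
  = (X - P ^+ 3 - 3 * P ^+ 2 * d - 3 * P * d ^+ 2) + 3 * P * (q ^+ 2 - 4 * D * q).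
  by rewrite /d; ring.
rewrite (le_trans (ler_normD _ _)) // [leRHS]mulrDl; apply: lerD.
  by rewrite (le_trans T) // -exprMn; apply: lerXn2r; rewrite ?nnegrE // mulr_ge0 // addr_ge0.
rewrite !normrM (ger0_norm P0) ger0_norm // -!mulrA ler_wpM2l //.
apply: (@le_trans _ _ (1 * `|q ^+ 2 - 4 * (D * q)|)); first by rewrite ler_wpM2r.
rewrite mul1r (le_trans (ler_normB _ _)) // ?normrX !normrM ?normrX ?(ger0_norm q0) ger0_norm //.
have e1 : q ^+ 2 <= k%:R * s ^+ 3.
  apply: (@le_trans _ _ (s ^+ 4)).
    by rewrite (exprM s 2 2); apply: lerXn2r; rewrite ?nnegrE ?exprn_ge0.
  by rewrite exprS ler_wpM2r // exprn_ge0.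
have e2 : `|D| * q <= 2 * s ^+ 3.
  rewrite exprS mulrA; apply: ler_pM => //.
lra.
Qed.

End Kernel.

Section Mollify.
Variables (R : realType) (k : nat).
Implicit Types y r z : 'rV[R]_k.

Definition linquad (p : 'rV[R]_k) (Q : 'M[R]_k) z : R :=
  \sum_i p 0 i * z 0 i + \sum_i \sum_j Q i j * z 0 i * z 0 j.

Definition emb (N : nat) (c : 'rV[int]_k) : 'rV[R]_k :=
  \row_i ((c 0 i)%:~R / N%:R).

Lemma embD N c e : emb N (c + e) = emb N c + emb N e.
Proof. by apply/rowP => i; rewrite !mxE intrD mulrDl. Qed.

Lemma emb_le N (c : 'rV[int]_k) (M : nat) i : (0 < N)%N ->
  (`|emb N c 0 i| <= M%:R) = (`|c 0 i| <= (M * N)%:Z).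
Proof.
move=> N0; have N0' : 0 < N%:R :> R by rewrite ltr0n.
rewrite !mxE normrM normfV normr_nat ler_pdivrMr // -natrM -intr_norm.
by rewrite -(ler_int R).
Qed.

Lemma emb_lt1 N (c : 'rV[int]_k) i : (0 < N)%N ->
  `|emb N c 0 i| < 1 -> `|c 0 i| <= N%:Z.
Proof.
by move=> N0 /ltW h; have := emb_le c 1 i N0; rewrite mul1n => <-.
Qed.

Section Resolution.
Variable N : nat.
Hypothesis N0 : (0 < N)%N.
Let S := @cube k N.*2.

(** Summation by parts: for a lattice vector zeta, shifting the argument of F
    is the same as shifting the kernel, so all the smoothness needed is that
    of the kernel. *)
Lemma kern_shift (zeta : 'rV[int]_k) (F : 'rV[R]_k -> R) :
  (forall i, `|zeta 0 i| <= N%:Z) ->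
  \sum_(c <- S) kern (emb N c) * F (emb N zeta + emb N c) =
  \sum_(c <- S) kern (emb N c - emb N zeta) * F (emb N c).
Proof.
move=> hz.
pose G c := kern (emb N c - emb N zeta) * F (emb N c).
transitivity (\sum_(c <- S) G (c + zeta)).
  by apply: eq_bigr => c _; rewrite /G embD addrK [_ + emb N zeta]addrC.
apply: big_shift; first exact: cube_uniq.
- move=> c; rewrite /G mulf_eq0 negb_or => /andP[h _]; rewrite mem_cube; apply/forallP => i.
  have e : emb N c - emb N zeta = emb N (c - zeta).
    by apply/eqP; rewrite subr_eq -embD subrK.
  rewrite e in h; have := emb_lt1 N0 (kern_supp i h); have := hz i.
  rewrite !mxE; set a := c 0 i; set b := zeta 0 i; rewrite !ler_norml => /andP[h1 h2] /andP[h3 h4].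
  by apply/andP; split; lia.
- move=> c; rewrite /G embD addrK mulf_eq0 negb_or => /andP[h _]; rewrite mem_cube; apply/forallP => i.
  have := emb_lt1 N0 (kern_supp i h).
  set a := c 0 i; rewrite !ler_norml => /andP[h3 h4].
  by apply/andP; split; lia.
Qed.

Definition mass : R := \sum_(c <- S) kern (emb N c).

Lemma mass_shift (zeta : 'rV[int]_k) : (forall i, `|zeta 0 i| <= N%:Z) ->
  \sum_(c <- S) kern (emb N c - emb N zeta) = mass.
Proof.
move=> hz; have := kern_shift (fun=> 1) hz.
under eq_bigr do rewrite mulr1; under [RHS]eq_bigr do rewrite mulr1.
by move=> <-.
Qed.

Lemma emb_S c i : c \in S -> `|emb N c 0 i| <= 2.
Proof.
rewrite mem_cube => /forallP/(_ i); rewrite (emb_le _ 2 _ N0) mul2n //.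
Qed.

End Resolution.

(** A fixed proportion of the lattice points lies where the kernel is bounded
    below. The resolution is a multiple of 2 (k+1) so that this region, the
    sup ball of radius 1 / (2 (k+1)), has lattice vertices. *)
Lemma mass_ge (n0 : nat) : (0 < n0)%N ->
  (27 / 64) * (n0.*2.+1 ^ k)%:R <= mass ((2 * k.+1) * n0).
Proof.
move=> n00; set N := (2 * k.+1 * n0)%N.
have N0 : (0 < N)%N by rewrite /N !muln_gt0.
have N0' : 0 < N%:R :> R by rewrite ltr0n.
have big c : c \in @cube k n0 -> 27 / 64 <= kern (emb N c).
  rewrite mem_cube => /forallP h.
  have hd : dot (emb N c) (emb N c) <= 1 / 4.
    apply: (@le_trans _ _ (\sum_(i < k) (2 * k.+1%:R)^-1 ^+ 2)).
      apply: ler_sum => i _; rewrite -expr2 -(real_normK (num_real (emb N c 0 i))).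
      apply: lerXn2r; rewrite ?nnegrE ?invr_ge0 ?mulr_ge0 //.
      rewrite mxE normrM normfV normr_nat ler_pdivrMr // -intr_norm.
      have -> : (2 * k.+1%:R)^-1 * N%:R = n0%:R :> R.
        by rewrite /N !natrM mulrA mulVf ?mul1r // mulf_neq0 ?pnatr_eq0.
      by have := h i; rewrite -(ler_int R).
    rewrite sumr_const card_ord -[leLHS]mulr_natr exprVn exprMn.
    rewrite [leLHS]mulrC ler_pdivrMr ?mulr_gt0 ?exprn_gt0 // ?ltr0n //.
    rewrite (_ : 1 / 4 * (2 ^+ 2 * k.+1%:R ^+ 2) = k.+1%:R ^+ 2 :> R); last by field.
    rewrite -natrX ler_nat; nia.
  rewrite /kern /pospart maxElt; case: ltP => h0; first by lra.
  rewrite (_ : 27 / 64 = (3 / 4) ^+ 3); last by field.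
  by apply: lerXn2r; rewrite ?nnegrE; lra.
rewrite /mass -(size_cube k).
apply: (@le_trans _ _ (\sum_(c <- cube k N.*2 | c \in cube k n0) kern (emb N c))); last first.
  rewrite [leRHS](bigID (mem (cube k n0))) /= lerDl sumr_ge0 // => c _.
  exact: kern_ge0.
apply: (@le_trans _ _ (\sum_(c <- cube k N.*2 | c \in cube k n0) 27 / 64)).
  rewrite big_const_seq iter_addr addr0 -[leRHS]mulr_natr ler_wpM2l //.
  rewrite ler_nat -size_filter; apply: uniq_leq_size; first exact: cube_uniq.
  move=> c hc; rewrite mem_filter /= hc /=.
  move: hc; rewrite !mem_cube => /forallP h; apply/forallP => i; apply: le_trans (h i) _.
  by rewrite lez_nat /N; nia.
exact: ler_sum.
Qed.

(** Normalising the kernel costs a factor independent of the resolution. *)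
Lemma mass_ratio : exists K : R, 0 <= K /\ forall n0, (0 < n0)%N ->
  let N := ((2 * k.+1) * n0)%N in
  0 < mass N /\ (size (@cube k N.*2))%:R <= K * mass N.
Proof.
(* The larger cube has at most (4 (k+1)) ^ k times as many points as the
   smaller one, on which the kernel is at least (3/4) ^ 3. *)
exists ((4 * k.+1)%:R ^+ k * (64 / 27)); split; first by rewrite mulr_ge0 ?exprn_ge0.
move=> n0 n00 N; have h := mass_ge n00; rewrite -/N in h.
have p0 : 0 < (n0.*2.+1 ^ k)%:R :> R by rewrite ltr0n expn_gt0.
split; first by apply: lt_le_trans h; rewrite mulr_gt0.
rewrite -mulrA; apply: (@le_trans _ _ ((4 * k.+1)%:R ^+ k * (n0.*2.+1 ^ k)%:R)); last first.
  by rewrite ler_wpM2l ?exprn_ge0 //; lra.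
rewrite size_cube -natrX -natrM ler_nat -expnMn.
have hle : (N.*2.*2.+1 <= 4 * k.+1 * n0.*2.+1)%N by rewrite /N; nia.
by case: (posnP k) => [->//|k0]; rewrite leq_exp2r.
Qed.

End Mollify.

Section Expansion.
Variables (R : realType) (k : nat).
Implicit Types y r z : 'rV[R]_k.

Lemma linquad_bound (p : 'rV[R]_k) (Q : 'M[R]_k) (P : R) z :
  (forall i, `|p 0 i| <= P) -> (forall i j, `|Q i j| <= P) ->
  `|linquad p Q z| <= P * (nrm z + nrm z ^+ 2).
Proof.
move=> hp hQ; rewrite /linquad (le_trans (ler_normD _ _)) // mulrDr; apply: lerD.
  rewrite nrm_row mulr_sumr (le_trans (ler_norm_sum _ _ _)) //.
  by apply: ler_sum => i _; rewrite normrM ler_wpM2r.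
rewrite expr2 !nrm_row mulr_suml mulr_sumr (le_trans (ler_norm_sum _ _ _)) //.
apply: ler_sum => i _; rewrite mulr_sumr mulr_sumr (le_trans (ler_norm_sum _ _ _)) //.
by apply: ler_sum => j _; rewrite !normrM -mulrA ler_wpM2r // mulr_ge0.
Qed.

Lemma linquad_dist (p : 'rV[R]_k) (Q : 'M[R]_k) (P : R) z r :
  (forall i, `|p 0 i| <= P) -> (forall i j, `|Q i j| <= P) ->
  `|linquad p Q z - linquad p Q r| <= P * nrm (z - r) * (1 + nrm z + nrm r).
Proof.
move=> hp hQ.
have -> : linquad p Q z - linquad p Q r = \sum_i p 0 i * (z - r) 0 i +
    (\sum_i \sum_j Q i j * ((z - r) 0 i * z 0 j) + \sum_i \sum_j Q i j * (r 0 i * (z - r) 0 j)).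
  rewrite /linquad opprD addrACA; congr (_ + _).
    by rewrite -sumrB; apply: eq_bigr => i _; rewrite !mxE; ring.
  rewrite -sumrB -big_split; apply: eq_bigr => i _; rewrite -sumrB -big_split /=.
  by apply: eq_bigr => j _; rewrite !mxE; ring.
have B (a b : 'rV[R]_k) : `|\sum_i \sum_j Q i j * (a 0 i * b 0 j)| <= P * (nrm a * nrm b).
  rewrite !nrm_row mulr_suml mulr_sumr (le_trans (ler_norm_sum _ _ _)) //.
  apply: ler_sum => i _; rewrite mulr_sumr mulr_sumr (le_trans (ler_norm_sum _ _ _)) //.
  by apply: ler_sum => j _; rewrite !normrM ler_wpM2r // mulr_ge0.
have A : `|\sum_i p 0 i * (z - r) 0 i| <= P * nrm (z - r).
  rewrite nrm_row mulr_sumr (le_trans (ler_norm_sum _ _ _)) //.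
  by apply: ler_sum => i _; rewrite normrM ler_wpM2r.
rewrite (le_trans (ler_normD _ _)) //.
have := ler_normD (\sum_i \sum_j Q i j * ((z - r) 0 i * z 0 j)) (\sum_i \sum_j Q i j * (r 0 i * (z - r) 0 j)).
have := B (z - r) z; have := B r (z - r); lra.
Qed.

Variables (N : nat) (K0 : R).
Hypothesis N0 : (0 < N)%N.
Hypothesis Z0 : 0 < mass R k N.
Hypothesis ZK : (size (@cube k N.*2))%:R <= K0 * mass R k N.
Let S := @cube k N.*2.
Let Z := mass R k N.
Variables (u : 'rV[R]_k -> R) (L : R).
Hypothesis L0 : 0 <= L.
Hypothesis hu : forall x y, `|u x - u y| <= L * nrm (x - y).
Variable x : 'rV[R]_k.

Definition smooth z : R := Z^-1 * \sum_(c <- S) kern (emb R N c) * u (x + z + emb R N c).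

Let v (c : 'rV[int]_k) := u (x + emb R N c) - u x.
Let a (c : 'rV[int]_k) : R := pospart (1 - dot (emb R N c) (emb R N c)).

Definition grad : 'rV[R]_k :=
  \row_i (Z^-1 * \sum_(c <- S) v c * (6 * a c ^+ 2 * emb R N c 0 i)).

Definition hess : 'M[R]_k := \matrix_(i, j)
  (Z^-1 * \sum_(c <- S) v c * (12 * a c * (emb R N c 0 i * emb R N c 0 j) -
                               (i == j)%:R * (3 * a c ^+ 2))).

Lemma linquad_grad_hess r : linquad grad hess r =
  Z^-1 * \sum_(c <- S) v c * (klin (emb R N c) r + kquad (emb R N c) r).
Proof.
pose A := \sum_(c <- S) v c * klin (emb R N c) r.
pose B := \sum_(c <- S) v c * kquad (emb R N c) r.
have -> : \sum_(c <- S) v c * (klin (emb R N c) r + kquad (emb R N c) r) = A + B.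
  by rewrite /A /B -big_split; apply: eq_bigr => c _; rewrite mulrDr.
rewrite /linquad mulrDr; congr (_ + _).
  rewrite /A mulr_sumr; under eq_bigr do rewrite mxE mulr_sumr mulr_suml.
  rewrite exchange_big; apply: eq_bigr => c _ /=.
  rewrite /klin /dot !mulr_sumr; apply: eq_bigr => i _; rewrite -/(a c); ring.
rewrite /B mulr_sumr; under eq_bigr do under eq_bigr do rewrite mxE mulr_sumr !mulr_suml.
under eq_bigr do rewrite exchange_big /=.
rewrite exchange_big; apply: eq_bigr => c _ /=.
rewrite /kquad -/(a c).
transitivity (Z^-1 * v c * (12 * a c * (\sum_i \sum_j (emb R N c 0 i * r 0 i) * (emb R N c 0 j * r 0 j))
   - 3 * a c ^+ 2 * \sum_i \sum_j (i == j)%:R * (r 0 i * r 0 j))).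
  rewrite !mulr_sumr -sumrB mulr_sumr; apply: eq_bigr => i _.
  rewrite !mulr_sumr -sumrB mulr_sumr; apply: eq_bigr => j _; ring.
rewrite -mulrA; congr (_ * (_ * (_ * _ - _ * _))).
  rewrite /dot expr2 mulr_suml; apply: eq_bigr => i _; by rewrite mulr_sumr.
apply: eq_bigr => i _; rewrite (bigD1 i) //= eqxx mul1r big1 ?addr0 // => j ji.
by rewrite eq_sym (negbTE ji) mul0r.
Qed.

Lemma v_bound c : c \in S -> `|v c| <= L * (2 * k%:R).
Proof.
move=> cS; rewrite (le_trans (hu _ _)) // ler_wpM2l // addrC addKr nrm_row.
rewrite -[k in leRHS]card_ord mulr_natr -sumr_const; apply: ler_sum => i _.
exact: emb_S.
Qed.

Lemma avg_bound (g : 'rV[int]_k -> R) B : 0 <= B -> (forall c, c \in S -> `|g c| <= B) ->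
  `|Z^-1 * \sum_(c <- S) v c * g c| <= L * (2 * k%:R * K0 * B).
Proof.
move=> B0 hg; rewrite normrM ger0_norm ?invr_ge0 ?(ltW Z0) //.
rewrite mulrC ler_pdivrMr //.
apply: (@le_trans _ _ (\sum_(c <- S) L * (2 * k%:R) * B)).
  rewrite (le_trans (ler_norm_sum _ _ _)) // big_seq [leRHS]big_seq.
  apply: ler_sum => c cS; rewrite normrM; apply: ler_pM => //; [exact: v_bound|exact: hg].
rewrite big_const_seq count_predT iter_addr addr0 -[leLHS]mulr_natr.
rewrite (_ : L * (2 * k%:R * K0 * B) * Z = L * (2 * k%:R) * B * (K0 * Z)); last by ring.
by rewrite ler_wpM2l // ?mulr_ge0.
Qed.

Lemma grad_bound i : `|grad 0 i| <= L * (2 * k%:R * K0 * 51).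
Proof.
rewrite mxE; apply: avg_bound => // c cS.
have a0 : 0 <= a c := pospart_ge0 _; have a1 : a c <= 1 := pospart_le1 _.
have h := emb_S R N0 i cS.
rewrite !normrM ?normrX !(ger0_norm a0) normr_nat.
have : a c ^+ 2 <= 1 by rewrite expr_le1.
have := exprn_ge0 2 a0; move: h (normr_ge0 (emb R N c 0 i)); move: `|_| => t; nra.
Qed.

Lemma hess_bound i j : `|hess i j| <= L * (2 * k%:R * K0 * 51).
Proof.
rewrite mxE; apply: avg_bound => // c cS.
have a0 : 0 <= a c := pospart_ge0 _; have a1 : a c <= 1 := pospart_le1 _.
have h1 := emb_S R N0 i cS; have h2 := emb_S R N0 j cS.
have e : `|emb R N c 0 i * emb R N c 0 j| <= 4.
  by rewrite normrM (_ : 4 = 2 * 2) ?ler_pM //; ring.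
have a2 : a c ^+ 2 <= 1 by rewrite expr_le1.
have a3 := exprn_ge0 2 a0.
rewrite (le_trans (ler_normB _ _)) //.
have f1 : `|12 * a c * (emb R N c 0 i * emb R N c 0 j)| <= 48.
  rewrite normrM (_ : `|12 * a c| = 12 * a c); last by rewrite ger0_norm // mulr_ge0.
  move: e (normr_ge0 (emb R N c 0 i * emb R N c 0 j)); move: `|_| => t; nra.
have f2 : `|(i == j)%:R * (3 * a c ^+ 2)| <= 3.
  rewrite normrM normr_nat ger0_norm ?mulr_ge0 //.
  by case: (i == j); rewrite ?mul1r ?mul0r //; lra.
lra.
Qed.

Lemma smooth_lip z y : `|smooth z - smooth y| <= L * nrm (z - y).
Proof.
rewrite /smooth -mulrBr -sumrB normrM ger0_norm ?invr_ge0 ?(ltW Z0) //.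
rewrite mulrC ler_pdivrMr // (le_trans (ler_norm_sum _ _ _)) //.
rewrite /Z /mass mulr_sumr; apply: ler_sum => c _; rewrite -mulrBr normrM.
rewrite ger0_norm ?kern_ge0 // mulrC ler_wpM2r ?kern_ge0 //.
rewrite (le_trans (hu _ _)) // ler_wpM2l // le_eqVlt; apply/orP; left; apply/eqP; congr nrm.
by apply/rowP => i; rewrite !mxE; ring.
Qed.

(** At lattice displacements the increment of the average is a kernel-weighted
    sum of u, to which the Taylor formula of the kernel applies. The sum is
    recentred at u x, since u is controlled only relative to a value: the
    kernel differences sum to 0 by [mass_shift]. *)
Lemma smooth_lattice (zeta : 'rV[int]_k) : (forall i, `|zeta 0 i| <= N%:Z) ->
  forall r, r = emb R N zeta ->
  `|smooth r - smooth 0 - linquad grad hess r| <=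
    L * (2 * k%:R * K0 * ((4 + k%:R) ^+ 3 + 3 * (8 + k%:R)) * nrm r ^+ 3).
Proof.
move=> hz r rE.
have -> : smooth r - smooth 0 - linquad grad hess r = Z^-1 * \sum_(c <- S) v c *
   (kern (emb R N c - r) - kern (emb R N c) - (klin (emb R N c) r + kquad (emb R N c) r)).
  rewrite linquad_grad_hess /smooth -!mulrBr; congr (_ * _).
  under eq_bigr do rewrite -addrA.
  rewrite rE (kern_shift N0 (fun y => u (x + y)) hz).
  have e : \sum_(c <- S) (kern (emb R N c - r) - kern (emb R N c)) * u x = 0.
    by rewrite rE -mulr_suml sumrB (mass_shift R N0 hz) subrr mul0r.
  rewrite -[LHS]subr0 -[X in _ - X]e -!sumrB; apply: eq_bigr => c _.
  rewrite addr0 /v rE; ring.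
rewrite (_ : L * _ = L * (2 * k%:R * K0 * (((4 + k%:R) ^+ 3 + 3 * (8 + k%:R)) * nrm r ^+ 3))); last by ring.
apply: avg_bound.
  by rewrite mulr_ge0 ?exprn_ge0 ?nrm_ge0 // addr_ge0 ?exprn_ge0 ?mulr_ge0 ?addr_ge0.
move=> c cS; apply: kern_taylor => i; first exact: emb_S.
by rewrite rE (emb_le _ _ 1 i N0) mul1n.
Qed.

End Expansion.

Section MollifyMain.
Variables (R : realType) (k : nat).
Implicit Types y r z : 'rV[R]_k.

Lemma linquad_scale (p : 'rV[R]_k) (Q : 'M[R]_k) (a : R) z :
  linquad p Q (a *: z) = linquad (a *: p) (a ^+ 2 *: Q) z.
Proof.
rewrite /linquad; congr (_ + _).
  by apply: eq_bigr => i _; rewrite !mxE; ring.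
by apply: eq_bigr => i _; apply: eq_bigr => j _; rewrite !mxE; ring.
Qed.

Lemma linquad0 (p : 'rV[R]_k) (Q : 'M[R]_k) : linquad p Q 0 = 0.
Proof.
rewrite /linquad big1 => [|i _]; last by rewrite mxE mulr0.
rewrite add0r big1 // => i _; apply: big1 => j _; by rewrite mxE mulr0 mul0r.
Qed.

(** An arbitrary displacement z is rounded to a lattice vector; on a fine
    lattice this costs at most eta * (1 + nrm z). When z leaves the window of
    lattice vectors, its norm is at least 1 and the cubic term absorbs
    everything. *)
Lemma mollify_unit : exists K : R, 0 <= K /\ forall eta : R, 0 < eta ->
  exists (S : seq 'rV[int]_k) (wt : 'rV[int]_k -> R) (pt : 'rV[int]_k -> 'rV[R]_k),
  [/\ forall c, 0 <= wt c, \sum_(c <- S) wt c = 1, forall c, c \in S -> nrm (pt c) <= K &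
    forall (L : R) (u : 'rV[R]_k -> R), 0 <= L ->
    (forall x y, `|u x - u y| <= L * nrm (x - y)) -> forall x,
    exists (p : 'rV[R]_k) (Q : 'M[R]_k), forall z,
    `|\sum_(c <- S) wt c * u (x + z + pt c) - \sum_(c <- S) wt c * u (x + pt c) - linquad p Q z|
    <= L * (K * nrm z ^+ 3 + eta * (1 + nrm z))].
Proof.
have [K0 [K00 hK]] := mass_ratio R k.
pose K1 : R := 2 * k%:R * K0 * ((4 + k%:R) ^+ 3 + 3 * (8 + k%:R)).
pose P : R := 2 * k%:R * K0 * 51.
have K10 : 0 <= K1 by rewrite /K1 ?mulr_ge0 // addr_ge0 ?exprn_ge0 ?mulr_ge0 ?addr_ge0.
have P0 : 0 <= P by rewrite /P ?mulr_ge0.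
exists (4 * K1 + 1 + 2 * P + 2 * k%:R); split; first by rewrite ?addr_ge0 ?mulr_ge0.
move=> eta eta0.
pose C : R := 1 + 4 * K1 + 4 * P.
have C0 : 0 <= C by rewrite /C ?addr_ge0 ?mulr_ge0.
pose n0 := (Num.truncn (k%:R * (1 + C / eta))).+1.
have n00 : (0 < n0)%N by rewrite /n0.
pose N := (2 * k.+1 * n0)%N; have [Z0 ZK] := hK n0 n00; rewrite -/N in Z0 ZK.
have N0 : (0 < N)%N by rewrite /N !muln_gt0.
have N0' : 0 < N%:R :> R by rewrite ltr0n.
pose dl : R := k%:R / N%:R.
have dl0 : 0 <= dl by rewrite divr_ge0.
have ceta : 0 <= C / eta by rewrite divr_ge0 // ltW.
have hN : k%:R * (1 + C / eta) <= N%:R.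
  apply: (@le_trans _ _ n0%:R); first exact/ltW/truncnS_gt.
  by rewrite ler_nat /N; nia.
have dl1 : dl <= 1.
  rewrite /dl ler_pdivrMr // mul1r (le_trans _ hN) // ler_peMr //; lra.
have dlC : dl * C <= eta.
  rewrite /dl mulrAC ler_pdivrMr // -ler_pdivrMl // mulrC -mulrA (le_trans _ hN) //.
  by rewrite ler_wpM2l //; lra.
clearbody N; exists (cube k N.*2), (fun c => (mass R k N)^-1 * kern (emb R N c)), (emb R N); split.
- by move=> c; rewrite mulr_ge0 ?kern_ge0 // invr_ge0 ltW.
- by rewrite -mulr_sumr mulVf // gt_eqF.
- move=> c cS; apply: (@le_trans _ _ (2 * k%:R)); last by rewrite lerDr ?addr_ge0 ?mulr_ge0.
  rewrite nrm_row -[k in leRHS]card_ord mulr_natr -sumr_const; apply: ler_sum => i _.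
  exact: (emb_S R N0).
move=> L u L0 hu x; exists (grad N u x), (hess N u x) => z.
have sm z' : \sum_(c <- cube k N.*2) (mass R k N)^-1 * kern (emb R N c) * u (x + z' + emb R N c) = smooth N u x z'.
  by rewrite /smooth mulr_sumr; apply: eq_bigr => c _; rewrite -mulrA.
have s0 : \sum_(c <- cube k N.*2) (mass R k N)^-1 * kern (emb R N c) * u (x + emb R N c) = smooth N u x 0.
  by rewrite -sm addr0.
rewrite sm s0.
have gb i := grad_bound N0 Z0 ZK L0 hu x i.
have hb i j := hess_bound N0 Z0 ZK L0 hu x i j.
rewrite -/P in gb hb.
have sl := smooth_lip Z0 L0 hu x.
have LP0 : 0 <= L * P by rewrite mulr_ge0.
have z0 := nrm_ge0 z.
pose zeta : 'rV[int]_k := \row_i Num.floor (z 0 i * N%:R).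
have [/forallP hz|] := boolP [forall i, `|zeta 0 i| <= N%:Z]; last first.
  rewrite negb_forall => /existsP[i]; rewrite -ltNge => hi.
  have z1 : 1 <= nrm z.
    apply: le_trans (nrm_coord z 0 i).
    rewrite -(ler_pM2r N0') mul1r -[X in _ * X]ger0_norm ?ler0n // -normrM.
    move: hi; rewrite mxE ltr_normr ler_normr => /orP[] hi; apply/orP; [left|right].
      apply: le_trans (floor_le _); rewrite [N%:R]pmulrn ler_int; exact: ltW.
    rewrite lerNr; apply: ltW. apply: (lt_le_trans (floorD1_gt _)).
    have h9 : Num.floor (z 0 i * N%:R) + 1 <= - N%:Z.
      by move: hi; move: (Num.floor _) => t; clear; lia.
    rewrite -(ler_int R) mulrNz -pmulrn in h9; exact: h9.
  have b1 := sl z 0; rewrite subr0 in b1.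
  have b2 := linquad_bound z gb hb; rewrite -/P in b2.
  rewrite (le_trans (ler_normB _ _)) //.
  have e1 : nrm z <= nrm z ^+ 3 by rewrite -{1}[nrm z]expr1 ler_weXn2l.
  have e2 : nrm z ^+ 2 <= nrm z ^+ 3 by rewrite ler_weXn2l.
  have f1 : L * nrm z <= L * nrm z ^+ 3 by rewrite ler_wpM2l.
  have f2 : L * P * (nrm z + nrm z ^+ 2) <= L * P * (2 * nrm z ^+ 3) by rewrite ler_wpM2l //; lra.
  have f3 : 0 <= L * (4 * K1 * nrm z ^+ 3) by rewrite ?mulr_ge0 ?exprn_ge0.
  have f4 : 0 <= L * (2 * k%:R * nrm z ^+ 3) by rewrite ?mulr_ge0 ?exprn_ge0.
  have f5 : 0 <= L * (eta * (1 + nrm z)) by rewrite ?mulr_ge0 ?addr_ge0 // ltW.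
  rewrite (_ : L * _ = L * (4 * K1 * nrm z ^+ 3) + L * nrm z ^+ 3 + L * P * (2 * nrm z ^+ 3)
     + L * (2 * k%:R * nrm z ^+ 3) + L * (eta * (1 + nrm z))); last by ring.
  lra.
pose r := emb R N zeta.
have zr : nrm (z - r) <= dl.
  rewrite nrm_row /dl -[k in leRHS]card_ord mulrC mulr_natr -sumr_const; apply: ler_sum => i _.
  rewrite !mxE -(ler_pM2r N0') mulVf ?gt_eqF // -[X in _ * X]ger0_norm ?ler0n // -normrM.
  rewrite mulrBl divfK ?gt_eqF //.
  have := floor_le (z 0 i * N%:R); have := floorD1_gt (z 0 i * N%:R).
  by rewrite intrD => h1 h2; rewrite ler_norml; apply/andP; split; lra.
have rz : nrm r <= nrm z + dl.
  have := nrmB z (z - r); rewrite opprB addrCA subrr addr0; lra.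
have r0 := nrm_ge0 r.
have b1 := smooth_lattice N0 Z0 ZK L0 hu x hz (erefl r).
have b2 : `|smooth N u x z - smooth N u x r| <= L * dl.
  by rewrite (le_trans (sl z r)) // ler_wpM2l.
have b3 := linquad_dist z r gb hb; rewrite -/P in b3.
have {}b3 : `|linquad (grad N u x) (hess N u x) z - linquad (grad N u x) (hess N u x) r| <=
   L * P * dl * (2 + 2 * nrm z).
  apply: (le_trans b3); apply: ler_pM; rewrite ?mulr_ge0 ?nrm_ge0 ?addr_ge0 //.
    by rewrite ler_wpM2l.
  lra.
have b4 : nrm r ^+ 3 <= 4 * nrm z ^+ 3 + 4 * dl.
  apply: (@le_trans _ _ ((nrm z + dl) ^+ 3)).
    by apply: lerXn2r; rewrite ?nnegrE ?addr_ge0.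
  have d3 : dl ^+ 3 <= dl by rewrite -{2}[dl]expr1 ler_wiXn2l.
  have h3 : 0 <= 3 * (nrm z + dl) * (nrm z - dl) ^+ 2.
    by rewrite mulr_ge0 ?sqr_ge0 // mulr_ge0 // addr_ge0.
  have e3 : 4 * nrm z ^+ 3 + 4 * dl ^+ 3 - (nrm z + dl) ^+ 3 = 3 * (nrm z + dl) * (nrm z - dl) ^+ 2 by ring.
  by rewrite -e3 in h3; lra.
rewrite -/K1 in b1.
have {}b1 : `|smooth N u x r - smooth N u x 0 - linquad (grad N u x) (hess N u x) r| <= L * (K1 * (4 * nrm z ^+ 3 + 4 * dl)).
  apply: (le_trans b1); rewrite ler_wpM2l //.
  by rewrite ler_wpM2l.
have -> : smooth N u x z - smooth N u x 0 - linquad (grad N u x) (hess N u x) z =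
  (smooth N u x z - smooth N u x r) + (smooth N u x r - smooth N u x 0 - linquad (grad N u x) (hess N u x) r)
  - (linquad (grad N u x) (hess N u x) z - linquad (grad N u x) (hess N u x) r) by ring.
rewrite (le_trans (ler_normB _ _)) // (le_trans (lerD (ler_normD _ _) (lexx _))) //.
apply: (le_trans (lerD (lerD b2 b1) b3)).
have g1 : L * (dl * C * (1 + nrm z)) <= L * (eta * (1 + nrm z)).
  by rewrite ler_wpM2l // ler_wpM2r // addr_ge0.
apply: le_trans (_ : L * (4 * K1 * nrm z ^+ 3) + L * (dl * C * (1 + nrm z)) <= _); last first.
  rewrite [leRHS](_ : _ = L * (4 * K1 * nrm z ^+ 3) + L * (eta * (1 + nrm z)) + L * ((1 + 2 * P + 2 * k%:R) * nrm z ^+ 3)); last by ring.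
  have : 0 <= L * ((1 + 2 * P + 2 * k%:R) * nrm z ^+ 3).
    by rewrite mulr_ge0 // mulr_ge0 ?exprn_ge0 // ?addr_ge0 ?mulr_ge0.
  lra.
rewrite /C.
have q1 : 0 <= L * dl * nrm z by rewrite ?mulr_ge0.
have q2 : 0 <= L * dl * nrm z * K1 by rewrite ?mulr_ge0.
have q3 : 0 <= L * dl * nrm z * P by rewrite ?mulr_ge0.
have q4 : 0 <= L * dl * P by rewrite ?mulr_ge0.
set A := (X in X <= _).
rewrite [leRHS](_ : _ = A + (L * dl * nrm z + 4 * (L * dl * nrm z * K1) +
  2 * (L * dl * nrm z * P) + 2 * (L * dl * P))); last by rewrite /A; ring.
by rewrite lerDl ?addr_ge0 ?mulr_ge0.
Qed.

(** Rescaling of [mollify_unit] by eps: the average then differs from u by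
    O(eps), at the price of the factor eps ^- 2 in front of the cubic term. *)
Lemma mollify : exists K : R, 0 <= K /\ forall eps eta : R, 0 < eps -> eps <= 1 -> 0 < eta ->
  exists (S : seq 'rV[int]_k) (wt : 'rV[int]_k -> R) (pt : 'rV[int]_k -> 'rV[R]_k),
  [/\ forall c, 0 <= wt c, \sum_(c <- S) wt c = 1, forall c, c \in S -> nrm (pt c) <= K * eps &
    forall (L : R) (u : 'rV[R]_k -> R), 0 <= L ->
    (forall x y, `|u x - u y| <= L * nrm (x - y)) -> forall x,
    exists (p : 'rV[R]_k) (Q : 'M[R]_k), forall z,
    `|\sum_(c <- S) wt c * u (x + z + pt c) - \sum_(c <- S) wt c * u (x + pt c) - linquad p Q z|
    <= L * (K / eps ^+ 2 * nrm z ^+ 3 + eta * (1 + nrm z))].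
Proof.
have [K [K0 h]] := mollify_unit; exists K; split=> // eps eta e0 e1 eta0.
have [S [wt [pt [h1 h2 h3 h4]]]] := h eta eta0.
exists S, wt, (fun c => eps *: pt c); split=> //.
  by move=> c cS; rewrite nrmZ ger0_norm ?(ltW e0) // mulrC ler_wpM2r ?h3 // ltW.
move=> L u L0 hu x.
have hu' y y' : `|u (eps *: y) - u (eps *: y')| <= L * eps * nrm (y - y').
  by rewrite (le_trans (hu _ _)) // -scalerBr nrmZ ger0_norm ?(ltW e0) // mulrA.
have [p [Q hpQ]] := h4 (L * eps) (fun y => u (eps *: y)) (mulr_ge0 L0 (ltW e0)) hu' (eps^-1 *: x).
have en : eps != 0 by rewrite gt_eqF.
exists (eps^-1 *: p), (eps^-1 ^+ 2 *: Q) => z.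
have := hpQ (eps^-1 *: z); rewrite linquad_scale.
have ex (y : 'rV[R]_k) : eps *: (eps^-1 *: y) = y by rewrite scalerA divff // scale1r.
under eq_bigr do rewrite !scalerDr !ex.
under [X in _ - X - _]eq_bigr do rewrite !scalerDr !ex.
move=> hh; apply: (le_trans hh); rewrite nrmZ ger0_norm ?invr_ge0 ?(ltW e0) // -mulrA ler_wpM2l //.
rewrite (_ : eps * _ = K / eps ^+ 2 * nrm z ^+ 3 + eta * (eps + nrm z)); last by field.
by rewrite lerD2l ler_wpM2l ?(ltW eta0) // lerD2r.
Qed.

End MollifyMain.

(** * Uniqueness of sublinear convolution semigroups *)

Section Semigroup.
Variables (R : realType) (k : nat).
Implicit Types (x y z : 'rV[R]_k) (f g : 'rV[R]_k -> R).

(** Convolution semigroups of sublinear functionals. The third moment bound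
    says that in time t the mass stays at distance sqrt t, so that cubic
    Taylor errors are negligible in short time. *)
Record csg (mu : R -> ('rV[R]_k -> R) -> R) : Prop := Csg {
  csg_sub : forall t, 0 <= t -> sublin (mu t) ;
  csg_0 : forall f, mu 0 f = f 0 ;
  csg_add : forall s t f, 0 <= s -> 0 <= t -> slip f ->
    mu s (fun x => mu t (fun y => f (x + y))) = mu (s + t) f ;
  csg_third : exists M, 0 <= M /\
    forall t, 0 <= t -> mu t (fun x => nrm x ^+ 3) <= M * (t * Num.sqrt t) }.

(** Globally Lipschitz functions. The constant L is kept explicit because
    sublinear functionals and averages preserve it ([lipc_sub], [avg_lip]). *)
Definition lipc (L : R) f := forall x y, `|f x - f y| <= L * nrm (x - y).

Lemma lipc_slip L f : 0 <= L -> lipc L f -> slip f.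
Proof. by move=> L0 h; exists L, 0%N; split=> // x y; rewrite expr0 mulr1. Qed.

Lemma lipc_shift L f x : lipc L f -> lipc L (fun y => f (x + y)).
Proof. by move=> h y z; rewrite (le_trans (h _ _)) // opprD addrACA subrr add0r. Qed.

Lemma lipc_sub mu L f : sublin mu -> 0 <= L -> lipc L f ->
  lipc L (fun x => mu (fun y => f (x + y))).
Proof.
move=> hmu L0 hf x y; have := sub_cst hmu (L * nrm (x - y)) => <-.
apply: sub_close => //; try exact: (lipc_slip L0 (lipc_shift _ hf)).
  exact: slip_cst.
by move=> z; rewrite (le_trans (hf _ _)) // opprD addrACA subrr addr0.
Qed.

Lemma linquad_slip (p : 'rV[R]_k) (Q : 'M[R]_k) : slip (linquad p Q).
Proof.
apply: slipD; apply: slip_sum => i.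
  by apply: slipZ; exact: slip_coord.
apply: slip_sum => j.
by apply: slipM; [apply: slipZ|]; exact: slip_coord.
Qed.

Section Average.
Variables (S : seq 'rV[int]_k) (wt : 'rV[int]_k -> R) (pt : 'rV[int]_k -> 'rV[R]_k).
Hypothesis wt0 : forall c, 0 <= wt c.
Hypothesis wt1 : \sum_(c <- S) wt c = 1.

Definition avg f x : R := \sum_(c <- S) wt c * f (x + pt c).

Lemma avg_lip L f : lipc L f -> lipc L (avg f).
Proof.
move=> h x y; rewrite /avg -sumrB (le_trans (ler_norm_sum _ _ _)) //.
rewrite -[leRHS]mul1r -wt1 mulr_suml; apply: ler_sum => c _.
rewrite -mulrBr normrM ger0_norm // ler_wpM2l // (le_trans (h _ _)) //.
by rewrite opprD addrACA subrr addr0.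
Qed.

Lemma avg_close L f B : 0 <= L -> lipc L f -> (forall c, c \in S -> nrm (pt c) <= B) ->
  forall x, `|avg f x - f x| <= L * B.
Proof.
move=> L0 h hB x.
rewrite -[f x]mul1r -wt1 mulr_suml /avg -sumrB (le_trans (ler_norm_sum _ _ _)) //.
rewrite -[leRHS]mul1r -wt1 mulr_suml big_seq [leRHS]big_seq; apply: ler_sum => c cS.
rewrite -mulrBr normrM ger0_norm // ler_wpM2l // (le_trans (h _ _)) // ler_wpM2l //.
by rewrite addrC addKr hB.
Qed.
End Average.

Section Compare.
Variables (mu nu : R -> ('rV[R]_k -> R) -> R).
Hypothesis hmu : csg mu.
Hypothesis hnu : csg nu.
Hypothesis agree : forall t p Q, 0 <= t -> mu t (linquad p Q) = nu t (linquad p Q).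

(** Induction on the number of time steps. With u the value function of mu
    after j steps, one more step of nu applied to the average of u is compared
    with one more step of mu: both functionals give the same value to the
    quadratic approximation of the average, and mu of an average is at most
    the average of mu because mu is sublinear. That last inequality goes one
    way only, hence an inequality in the conclusion. *)
Lemma csg_step L f (S : seq 'rV[int]_k) wt pt (h K eta M : R) (j : nat) :
  0 <= L -> lipc L f ->
  (forall c, 0 <= wt c) -> \sum_(c <- S) wt c = 1 ->
  0 <= h -> 0 <= K -> 0 <= eta ->
  mu h (fun x => nrm x ^+ 3) <= M -> nu h (fun x => nrm x ^+ 3) <= M ->
  (forall u : 'rV[R]_k -> R, lipc L u -> forall x, exists p Q, forall z,
    `|avg S wt pt u (x + z) - avg S wt pt u x - linquad p Q z|
    <= L * (K * nrm z ^+ 3 + eta * (1 + nrm z))) ->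
  forall x, nu (j%:R * h) (fun y => avg S wt pt f (x + y)) <=
    avg S wt pt (fun x => mu (j%:R * h) (fun y => f (x + y))) x
    + j%:R * (2 * (L * (K * M + eta * (2 + M)))).
Proof.
move=> L0 hf wt0 wt1 h0 K0 eta0 hM1 hM2 hexp.
set e := 2 * _.
have jh0 i : 0 <= i%:R * h by rewrite mulr_ge0.
have lav u : lipc L u -> slip (avg S wt pt u).
  by move=> hu; apply: (lipc_slip L0); exact: avg_lip.
elim: j => [|j ih] x.
  rewrite !mul0r addr0 !csg_0 // addr0 /avg le_eqVlt; apply/orP; left; apply/eqP.
  by apply: eq_bigr => c _; rewrite csg_0 // addr0.
pose u := fun x => mu (j%:R * h) (fun y => f (x + y)).
have hu : lipc L u by exact: (lipc_sub (csg_sub hmu (jh0 j)) L0 hf).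
have E1 : j.+1%:R * h = h + j%:R * h by rewrite -natr1; ring.
rewrite E1 -(csg_add hnu h0 (jh0 j)); last first.
  exact: (lipc_slip L0 (lipc_shift _ (avg_lip pt wt0 wt1 hf))).
have s1 : slip (fun z => avg S wt pt u (x + z)).
  exact: (lipc_slip L0 (lipc_shift _ (avg_lip pt wt0 wt1 hu))).
apply: (@le_trans _ _ (nu h (fun z => avg S wt pt u (x + z) + j%:R * e))).
  apply: (sub_mono (csg_sub hnu h0)).
  - apply: (@lipc_slip L) => //.
    have := lipc_sub (csg_sub hnu (jh0 j)) L0 (lipc_shift x (avg_lip pt wt0 wt1 hf)).
    by [].
  - by apply: slipD => //; exact: slip_cst.
  - move=> z; have := ih (x + z); rewrite (_ : (fun y => avg S wt pt f (x + z + y)) = (fun y => avg S wt pt f (x + (z + y)))) //.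
    by apply/funext => y; rewrite addrA.
rewrite (sub_addc (csg_sub hnu h0)) //.
rewrite (_ : j.+1%:R * e = e + j%:R * e) ?addrA ?lerD2r; last by rewrite -natr1; ring.
have [p [Q hpQ]] := hexp u hu x.
pose Er z := L * (K * nrm z ^+ 3 + eta * (2 + nrm z ^+ 3)).
have sn3 : slip (fun z : 'rV[R]_k => nrm z ^+ 3) by apply: slipX; exact: slip_nrm.
have sE : slip Er.
  apply: slipZ; apply: slipD; apply: slipZ => //.
  by apply: slipD => //; exact: slip_cst.
have hE mm (sm : sublin mm) : mm (fun x => nrm x ^+ 3) <= M -> mm Er <= L * (K * M + eta * (2 + M)).
  move=> hm.
  rewrite (_ : Er = (fun z => L * (K + eta) * nrm z ^+ 3 + L * eta * 2)); last first.
    by apply/funext => z; rewrite /Er; ring.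
  rewrite (sub_addc sm); last exact: slipZ.
  rewrite (sub_hom sm) //; last by rewrite mulr_ge0 // addr_ge0.
  rewrite (_ : L * (K * M + _) = L * (K + eta) * M + L * eta * 2); last by ring.
  by rewrite lerD2r ler_wpM2l // mulr_ge0 // addr_ge0.
have bd z : `|avg S wt pt u (x + z) - avg S wt pt u x - linquad p Q z| <= Er z.
  apply: (le_trans (hpQ z)); rewrite /Er ler_wpM2l // lerD2l ler_wpM2l //.
  have z0 := nrm_ge0 z.
  case: (leP (nrm z) 1) => z1; first by have := exprn_ge0 3 z0; lra.
  have : nrm z <= nrm z ^+ 3 by rewrite -{1}[nrm z]expr1 ler_weXn2l // ltW.
  lra.
have slq := linquad_slip p Q.
have sLE : slip (fun z => linquad p Q z + Er z) by exact: (slipD slq sE).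
have sAE : slip (fun z => avg S wt pt u (x + z) + Er z) by exact: (slipD s1 sE).
have i1 : nu h (fun z => avg S wt pt u (x + z)) <= avg S wt pt u x + nu h (linquad p Q) + L * (K * M + eta * (2 + M)).
  apply: (@le_trans _ _ (nu h (fun z => (linquad p Q z + Er z) + avg S wt pt u x))).
    apply: (sub_mono (csg_sub hnu h0)) => //.
      exact: (slipD sLE (slip_cst _ _ _)).
    by move=> z; have := bd z; rewrite ler_norml => /andP[_]; lra.
  rewrite (sub_addc (csg_sub hnu h0)) //.
  have := sub_add (csg_sub hnu h0) slq sE; have := hE _ (csg_sub hnu h0) hM2; lra.
have i2 : mu h (linquad p Q) <= mu h (fun z => avg S wt pt u (x + z)) - avg S wt pt u x + L * (K * M + eta * (2 + M)).
  apply: (@le_trans _ _ (mu h (fun z => (avg S wt pt u (x + z) + Er z) + (- avg S wt pt u x)))).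
    apply: (sub_mono (csg_sub hmu h0)) => //.
      exact: (slipD sAE (slip_cst _ _ _)).
    by move=> z; have := bd z; rewrite ler_norml => /andP[]; lra.
  rewrite (sub_addc (csg_sub hmu h0)) //.
  have := sub_add (csg_sub hmu h0) s1 sE; have := hE _ (csg_sub hmu h0) hM1; lra.
have i3 : mu h (fun z => avg S wt pt u (x + z)) <=
   avg S wt pt (fun x => mu (h + j%:R * h) (fun y => f (x + y))) x.
  rewrite /avg; apply: (le_trans (sub_sum (csg_sub hmu h0) _ _ _)) => //.
    move=> c; apply: (@lipc_slip L) => // a b; rewrite (le_trans (hu _ _)) //.
    by rewrite opprD addrACA subrr addr0 opprD addrACA subrr add0r.
  apply: ler_sum => c _; rewrite ler_wpM2l // -(csg_add hmu h0 (jh0 j)); last first.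
    exact: (lipc_slip L0 (lipc_shift _ hf)).
  rewrite le_eqVlt; apply/orP; left; apply/eqP; congr (mu h _); apply/funext => z.
  congr (mu _ _); apply/funext => y; congr f; by rewrite -!addrA (addrCA z).
rewrite -(agree p Q h0) in i1.
rewrite /e; lra.
Qed.

Lemma sqrt_small (t B d : R) : 0 <= t -> 0 <= B -> 0 < d ->
  exists n : nat, (0 < n)%N /\ B * Num.sqrt (t / n%:R) <= d.
Proof.
move=> t0 B0 d0.
exists (Num.truncn (t * (B / d) ^+ 2)).+1; split=> //.
set n := _.+1; have n0 : 0 < n%:R :> R by rewrite ltr0n.
have hn : t * (B / d) ^+ 2 <= n%:R by exact/ltW/truncnS_gt.
rewrite -[d]gtr0_norm // -sqrtr_sqr -[B]ger0_norm // -sqrtr_sqr -sqrtrM ?sqr_ge0 //.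
apply: ler_wsqrtr; rewrite mulrA ler_pdivrMr // -ler_pdivrMl ?exprn_gt0 //.
rewrite (le_trans _ hn) // le_eqVlt; apply/orP; left; apply/eqP; field.
by rewrite gt_eqF.
Qed.

(** The width eps of the average is fixed first, then the number n of steps.
    The loss is n steps times O(h ^ (3/2)), with h = t / n; the smoothing
    tolerance eta is also taken to be h ^ (3/2). *)
Lemma csg_le_lip L f t : 0 <= L -> lipc L f -> 0 <= t -> nu t f <= mu t f.
Proof.
move=> L0 hf; rewrite le_eqVlt => /orP[/eqP<-|t0]; first by rewrite !csg_0.
have [K [K0 hK]] := mollify R k.
have [M1 [M10 hM1]] := csg_third hmu; have [M2 [M20 hM2]] := csg_third hnu.
pose M := M1 + M2.
have M0 : 0 <= M by rewrite addr_ge0.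
apply/ler_addgt0Pr => d d0.
pose eps := Num.min 1 (d / 2 / (2 * L * K + 1)).
have LK0 : 0 <= 2 * L * K by rewrite !mulr_ge0.
have eps0 : 0 < eps.
  by rewrite lt_min ltr01 /= !divr_gt0 // ltr_wpDl.
have eps1 : eps <= 1 by rewrite ge_min lexx.
have epsd : 2 * L * K * eps <= d / 2.
  apply: (@le_trans _ _ ((2 * L * K + 1) * eps)).
    by rewrite ler_wpM2r ?(ltW eps0) // lerDl.
  have ee : eps <= d / 2 / (2 * L * K + 1) by rewrite /eps ge_min lexx orbT.
  have pos : 0 < 2 * L * K + 1 by lra.
  by move: ee; rewrite ler_pdivlMr // [_ * (_ + 1)]mulrC.
pose Ke := K / eps ^+ 2.
have Ke0 : 0 <= Ke by rewrite divr_ge0 // exprn_ge0 // ltW.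
pose B := t * (2 * (L * (Ke * M + (2 + M * (t * Num.sqrt t))))).
have B0 : 0 <= B.
  have a1 : 0 <= M * (t * Num.sqrt t) by rewrite mulr_ge0 // mulr_ge0 ?sqrtr_ge0 // ltW.
  have a2 : 0 <= Ke * M by rewrite mulr_ge0.
  have a3 : 0 <= Ke * M + (2 + M * (t * Num.sqrt t)) by lra.
  by rewrite /B mulr_ge0 ?(ltW t0) // mulr_ge0 // mulr_ge0.
have [n [n0 hn]] := sqrt_small (ltW t0) B0 (divr_gt0 d0 (ltr0n R 2)).
have n0' : 0 < n%:R :> R by rewrite ltr0n.
pose h := t / n%:R.
have h0 : 0 < h by rewrite divr_gt0.
have ht : h <= t by rewrite ler_pdivrMr // ler_peMr ?(ltW t0) // ler1n.
pose eta := h * Num.sqrt h.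
have eta0 : 0 < eta by rewrite mulr_gt0 // sqrtr_gt0.
have [S [wt [pt [wt0 wt1 hpt hexp]]]] := hK eps eta eps0 eps1 eta0.
have hexp' : forall u : 'rV[R]_k -> R, lipc L u -> forall x, exists p Q, forall z,
    `|avg S wt pt u (x + z) - avg S wt pt u x - linquad p Q z|
    <= L * (Ke * nrm z ^+ 3 + eta * (1 + nrm z)).
  by move=> u hu x; exact: hexp.
have hm1 : mu h (fun x => nrm x ^+ 3) <= M * eta.
  apply: (le_trans (hM1 h (ltW h0))); rewrite ler_wpM2r ?(ltW eta0) // lerDl //.
have hm2 : nu h (fun x => nrm x ^+ 3) <= M * eta.
  apply: (le_trans (hM2 h (ltW h0))); rewrite ler_wpM2r ?(ltW eta0) // lerDr //.
have := csg_step n L0 hf wt0 wt1 (ltW h0) Ke0 (ltW eta0) hm1 hm2 hexp' 0.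
have -> : n%:R * h = t by rewrite /h mulrC divfK ?gt_eqF.
move=> main.
have hav := avg_close wt0 wt1 L0 hf hpt.
have su := csg_sub hmu (ltW t0); have sn := csg_sub hnu (ltW t0).
have sf := lipc_slip L0 hf.
have c1 : nu t f <= nu t (fun y => avg S wt pt f (0 + y)) + L * (K * eps).
  have sa : slip (avg S wt pt f) by apply: (@lipc_slip L) => //; exact: avg_lip.
  rewrite (_ : (fun y => avg S wt pt f (0 + y)) = avg S wt pt f); last first.
    by apply/funext => y; rewrite add0r.
  rewrite -(sub_addc sn) //; apply: (sub_mono sn) => //.
    by apply: slipD => //; exact: slip_cst.
  by move=> x; have := hav x; rewrite ler_norml => /andP[]; lra.
have lu : lipc L (fun x => mu t (fun y => f (x + y))) by exact: (lipc_sub su L0 hf).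
have c2 := avg_close wt0 wt1 L0 lu hpt 0.
have e0 : mu t (fun y => f (0 + y)) = mu t f.
  by congr (mu t _); apply/funext => y; rewrite add0r.
rewrite e0 ler_norml in c2; case/andP: c2 => _ c2.
have c3 : n%:R * (2 * (L * (Ke * (M * eta) + eta * (2 + M * eta)))) <= B * Num.sqrt h.
  have -> : n%:R * (2 * (L * (Ke * (M * eta) + eta * (2 + M * eta)))) =
     (n%:R * h) * (2 * (L * (Ke * M + (2 + M * eta)))) * Num.sqrt h by rewrite {1 2}/eta; ring.
  have -> : n%:R * h = t by rewrite /h mulrC divfK ?gt_eqF.
  rewrite ler_wpM2r ?sqrtr_ge0 // /B ler_wpM2l ?(ltW t0) // ler_wpM2l //.
  rewrite ler_wpM2l // lerD2l lerD2l ler_wpM2l //.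
  by apply: ler_pM; rewrite ?(ltW h0) ?sqrtr_ge0 // ler_wsqrtr.
rewrite -/h in hn; lra.
Qed.

End Compare.

(** Coordinatewise truncation turns a function of class C_lLip into a globally
    Lipschitz one. *)
Definition clip (N : R) x : 'rV[R]_k := \row_i Num.max (- N) (Num.min N (x 0 i)).

Lemma clip1 (N a b : R) : 0 <= N ->
  `|Num.max (- N) (Num.min N a) - Num.max (- N) (Num.min N b)| <= `|a - b|.
Proof.
move=> N0; rewrite ler_norml.
have e1 := ler_norm (a - b); have e2 := ler_norm (- (a - b)); rewrite normrN in e2.
rewrite !maxEle !minEle; repeat case: ifPn => //; rewrite -?ltNge; move=> *; apply/andP; split; lra.
Qed.

Lemma clip2 (N a : R) : 0 < N -> `|a - Num.max (- N) (Num.min N a)| <= a ^+ 2 / N.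
Proof.
move=> N0; rewrite ler_pdivlMr //.
rewrite !maxEle !minEle; repeat case: ifPn => //; rewrite -?ltNge; move=> *.
- rewrite ger0_norm; nra.
- by rewrite subrr normr0 mul0r sqr_ge0.
- nra.
- rewrite ler0_norm; nra.
Qed.

Lemma clip3 (N a : R) : 0 <= N -> `|Num.max (- N) (Num.min N a)| <= N.
Proof.
move=> N0; rewrite ler_norml !maxEle !minEle; repeat case: ifPn => //; rewrite -?ltNge; move=> *; apply/andP; split; lra.
Qed.

Lemma csg_le mu nu : csg mu -> csg nu ->
  (forall t p Q, 0 <= t -> mu t (linquad p Q) = nu t (linquad p Q)) ->
  forall t f, 0 <= t -> slip f -> nu t f <= mu t f.
Proof.
move=> hmu hnu agree t f t0 sf.
have [C [q [C0 hf]]] := sf.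
pose e (x : 'rV[R]_k) := C * ((1 + 2 * nrm x) ^+ q * nrm x ^+ 2).
have se : slip e.
  apply: slipZ; apply: slipM; apply: slipX; last exact: slip_nrm.
  apply: slipD; first exact: slip_cst.
  by apply: slipZ; exact: slip_nrm.
have su := csg_sub hmu t0; have sn := csg_sub hnu t0.
have e0 x : 0 <= e x.
  by rewrite !mulr_ge0 ?exprn_ge0 ?addr_ge0 ?mulr_ge0 ?nrm_ge0.
have me : 0 <= mu t e := sub_ge0 su se e0.
have ne : 0 <= nu t e := sub_ge0 sn se e0.
apply/ler_addgt0Pr => d d0.
pose N := 1 + (mu t e + nu t e) / d.
have N0 : 0 < N by rewrite ltr_pwDl // divr_ge0 ?addr_ge0 // ltW.
(* The truncation error is at most e / N, where e has finite expectation, so N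
   is chosen from d and from the expectations of e. *)
pose g x := f (clip N x).
have nclip x : nrm (clip N x) <= k%:R * N.
  rewrite nrm_row -[k in leRHS]card_ord mulr_natl -sumr_const; apply: ler_sum => i _.
  by rewrite mxE clip3 // ltW.
have nclip' x : nrm (clip N x) <= nrm x.
  rewrite !nrm_row; apply: ler_sum => i _; rewrite mxE.
  have := @clip1 N (x 0 i) 0 (ltW N0).
  by rewrite (min_r (ltW N0)) (max_r (_ : - N <= 0)) ?subr0 // oppr_le0 ltW.
have gl : lipc (C * (1 + 2 * (k%:R * N)) ^+ q) g.
  move=> x y; apply: (le_trans (hf _ _)); apply: ler_pM; rewrite ?nrm_ge0 ?mulr_ge0 ?exprn_ge0 ?wgt_ge0 //.
    rewrite ler_wpM2l //; apply: lerXn2r; rewrite ?nnegrE ?wgt_ge0 //.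
      by rewrite addr_ge0 // !mulr_ge0 // ltW.
    by rewrite /wgt; have := nclip x; have := nclip y; lra.
  rewrite !nrm_row; apply: ler_sum => i _; rewrite !mxE; apply: clip1; exact: ltW.
have L0 : 0 <= C * (1 + 2 * (k%:R * N)) ^+ q.
  by rewrite mulr_ge0 // exprn_ge0 // addr_ge0 // !mulr_ge0 // ltW.
have fg x : `|f x - g x| <= N^-1 * e x.
  apply: (le_trans (hf _ _)); rewrite /e mulrCA -mulrA ler_wpM2l // mulrCA.
  apply: ler_pM; rewrite ?nrm_ge0 ?exprn_ge0 ?wgt_ge0 //.
    apply: lerXn2r; rewrite ?nnegrE ?wgt_ge0 ?addr_ge0 ?mulr_ge0 ?nrm_ge0 //.
    by rewrite /wgt; have := nclip' x; lra.
  rewrite mulrC expr2 [nrm x in leRHS]nrm_row !mulr_suml nrm_row; apply: ler_sum => i _.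
  rewrite !mxE; apply: (le_trans (clip2 _ N0)); rewrite ler_wpM2r ?invr_ge0 ?(ltW N0) //.
  rewrite -real_normK ?num_real // expr2 ler_wpM2l //; have := nrm_coord x 0 i.
  by rewrite nrm_row.
have sg := lipc_slip L0 gl.
have Ni : 0 <= N^-1 by rewrite invr_ge0 ltW.
have sNe : slip (fun x => N^-1 * e x) by exact: slipZ.
have h1 := sub_close su sf sg sNe fg.
have h2 := sub_close sn sf sg sNe fg.
rewrite (sub_hom su) // in h1; rewrite (sub_hom sn) // in h2.
have h3 := csg_le_lip hmu hnu agree L0 gl t0.
have h4 : N^-1 * (mu t e + nu t e) <= d.
  rewrite mulrC ler_pdivrMr // /N mulrDr mulr1 mulrCA divff ?gt_eqF // mulr1.
  by rewrite lerDr ltW.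
rewrite !ler_norml in h1 h2; move/andP: h1 => [h1 _]; move/andP: h2 => [_ h2].
lra.
Qed.

(** The comparison is one-sided but its hypotheses are symmetric in the two
    semigroups. *)
Theorem csg_unique mu nu : csg mu -> csg nu ->
  (forall t p Q, 0 <= t -> mu t (linquad p Q) = nu t (linquad p Q)) ->
  forall t f, 0 <= t -> slip f -> mu t f = nu t f.
Proof.
move=> hmu hnu agree t f t0 sf; apply/eqP; rewrite eq_le.
by rewrite !csg_le // => s p Q s0; rewrite agree.
Qed.

End Semigroup.

(** * Random walks with a controlled step length *)

Section Operators.
Variables (R : realType) (k : nat).
Implicit Types (x y z : 'rV[R]_k) (f g : 'rV[R]_k -> R).
Let Op := ('rV[R]_k -> R) -> 'rV[R]_k -> R.

(** Translation invariant sublinear operators; the value at 0 of their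
    iterates is what converges to a semigroup. *)
Record subop (T : Op) : Prop := Subop {
  op_mono : forall f g, (forall x, f x <= g x) -> forall x, T f x <= T g x ;
  op_cst : forall c x, T (fun=> c) x = c ;
  op_add : forall f g x, T (fun y => f y + g y) x <= T f x + T g x ;
  op_hom : forall c f x, 0 <= c -> T (fun y => c * f y) x = c * T f x ;
  op_shift : forall f z x, T (fun y => f (z + y)) x = T f (z + x) }.

Lemma subop_iter (T : Op) n : subop T -> subop (iter n T).
Proof.
move=> hT; elim: n => [|n ih]; first by split.
split=> /=.
- by move=> f g h x; apply: (op_mono hT) => y; exact: (op_mono ih).
- move=> c x; rewrite (_ : iter n T (fun=> c) = (fun=> c)) ?(op_cst hT) //.
  by apply/funext => y; rewrite (op_cst ih).
- move=> f g x; apply: le_trans (op_add hT _ _ _); apply: (op_mono hT) => y.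
  exact: (op_add ih).
- move=> c f x c0; rewrite -(op_hom hT) //; congr (T _ x); apply/funext => y.
  exact: (op_hom ih).
- move=> f z x; rewrite -(op_shift hT); congr (T _ x); apply/funext => y.
  exact: (op_shift ih).
Qed.

Lemma subop_dist (T : Op) f g e x : subop T -> (forall y, `|f y - g y| <= e y) ->
  `|T f x - T g x| <= T e x.
Proof.
move=> hT h.
have half f' g' : (forall y, `|f' y - g' y| <= e y) -> T f' x - T g' x <= T e x.
  move=> h'; rewrite lerBlDr; apply: le_trans (op_add hT _ _ _).
  by apply: (op_mono hT) => y; have := h' y; rewrite ler_norml => /andP[_]; lra.
rewrite ler_norml; apply/andP; split; last exact: half.
by rewrite lerNl opprB half // => y; rewrite distrC.
Qed.

Lemma subop_addc (T : Op) f c x : subop T -> T (fun y => f y + c) x = T f x + c.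
Proof.
move=> hT; apply/eqP; rewrite eq_le; apply/andP; split.
  by rewrite -[in leRHS](op_cst hT c x); exact: (op_add hT).
have := op_add hT (fun y => f y + c) (fun=> - c) x.
rewrite (op_cst hT) (_ : (fun y => f y + c + - c) = f); first lra.
by apply/funext => y; rewrite addrK.
Qed.

Definition evec (i : 'I_k) : 'rV[R]_k := delta_mx 0 i.

(** One step of a symmetric walk of length s along a uniformly chosen axis. *)
Definition walk (s : R) : Op := fun f x =>
  (2 * k%:R)^-1 * \sum_i (f (x + s *: evec i) + f (x - s *: evec i)).

(** The choice between the two step lengths may depend on the point, hence on
    the past when the operator is iterated. *)
Definition maxwalk (s1 s2 : R) : Op := fun f x => Num.max (walk s1 f x) (walk s2 f x).

Hypothesis k0 : (0 < k)%N.
Let k0' : 0 < k%:R :> R. Proof. by rewrite ltr0n. Qed.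
Let w0 : 0 <= (2 * k%:R)^-1 :> R. Proof. by rewrite invr_ge0 mulr_ge0. Qed.

Lemma walk_subop s : subop (walk s).
Proof.
split.
- by move=> f g h x; rewrite ler_wpM2l //; apply: ler_sum => i _; exact: lerD.
- move=> c x; rewrite /walk sumr_const card_ord -mulr_natr; field.
  by rewrite gt_eqF.
- move=> f g x; rewrite /walk -mulrDr -big_split ler_wpM2l // le_eqVlt; apply/orP; left.
  by apply/eqP; apply: eq_bigr => i _ /=; ring.
- move=> c f x c0; rewrite /walk [RHS]mulrCA; congr (_ * _).
  by rewrite mulr_sumr; apply: eq_bigr => i _; rewrite mulrDr.
- by move=> f z x; rewrite /walk; congr (_ * _); apply: eq_bigr => i _; rewrite !addrA.
Qed.

Lemma maxwalk_subop s1 s2 : subop (maxwalk s1 s2).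
Proof.
have h1 := walk_subop s1; have h2 := walk_subop s2; split.
- move=> f g h x; rewrite /maxwalk ge_max !le_max.
  by rewrite (op_mono h1 h) (op_mono h2 h) orbT.
- by move=> c x; rewrite /maxwalk (op_cst h1) (op_cst h2) maxxx.
- move=> f g x; rewrite /maxwalk ge_max; apply/andP; split.
    by apply: (le_trans (op_add h1 _ _ _)); apply: lerD; rewrite le_max lexx.
  by apply: (le_trans (op_add h2 _ _ _)); apply: lerD; rewrite le_max lexx orbT.
- by move=> c f x c0; rewrite /maxwalk (op_hom h1) // (op_hom h2) // maxr_pMr.
- by move=> f z x; rewrite /maxwalk (op_shift h1) (op_shift h2).
Qed.

(** One step adds a constant to a polynomial of degree two, because the linear
    part cancels between opposite steps; [iter_linquad] follows with no
    approximation. *)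
Lemma walk_linquad s (p : 'rV[R]_k) (Q : 'M[R]_k) c x :
  walk s (fun y => linquad p Q y + c) x = linquad p Q x + c + s ^+ 2 / k%:R * \tr Q.
Proof.
have ev i j : evec i 0 j = (i == j)%:R by rewrite mxE eqxx andTb eq_sym.
have one i : linquad p Q (x + s *: evec i) + c + (linquad p Q (x - s *: evec i) + c) =
   2 * (linquad p Q x + c) + 2 * s ^+ 2 * Q i i.
  have l0 w : linquad 0 Q w = \sum_i \sum_j Q i j * w 0 i * w 0 j.
    by rewrite /linquad big1 ?add0r // => j _; rewrite mxE mul0r.
  have qe : linquad 0 Q (evec i) = Q i i.
    rewrite l0 (bigD1 i) //= [X in _ + X]big1 ?addr0 => [|j ji].
      rewrite (bigD1 i) //= big1 ?addr0 => [|l li]; first by rewrite ev eqxx !mulr1.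
      by rewrite !ev [i == l]eq_sym (negbTE li) mulr0.
    by apply: big1 => l _; rewrite !ev [i == j]eq_sym (negbTE ji) mulr0 mul0r.
  have par y z : linquad p Q (y + z) + linquad p Q (y - z) = 2 * linquad p Q y + 2 * linquad 0 Q z.
    rewrite l0 /linquad mulrDr addrACA -[RHS]addrA; congr (_ + _).
      by rewrite mulr_sumr -big_split; apply: eq_bigr => j _ /=; rewrite !mxE; ring.
    rewrite !mulr_sumr -!big_split; apply: eq_bigr => j _ /=.
    rewrite !mulr_sumr -!big_split; apply: eq_bigr => l _ /=.
    by rewrite !mxE; ring.
  rewrite addrACA par (_ : linquad 0 Q (s *: evec i) = s ^+ 2 * linquad 0 Q (evec i)).
    by rewrite qe; ring.
  rewrite !l0 mulr_sumr; apply: eq_bigr => j _; rewrite mulr_sumr; apply: eq_bigr => l _.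
  by rewrite !mxE; ring.
rewrite /walk (eq_bigr _ (fun i _ => one i)) big_split /= sumr_const card_ord -mulr_sumr -/(\tr Q) -mulr_natr.
by field; rewrite gt_eqF.
Qed.

Lemma iter_linquad s1 s2 (p : 'rV[R]_k) (Q : 'M[R]_k) n x :
  iter n (maxwalk s1 s2) (linquad p Q) x =
  linquad p Q x + n%:R * (Num.max (s1 ^+ 2 / k%:R * \tr Q) (s2 ^+ 2 / k%:R * \tr Q)).
Proof.
elim: n x => [|n ih] x; first by rewrite mul0r addr0.
set m := Num.max _ _ in ih *.
rewrite iterS (_ : iter n _ _ = (fun y => linquad p Q y + n%:R * m)); last exact/funext.
rewrite /maxwalk !walk_linquad -addr_maxr -/m -natr1; ring.
Qed.

Lemma pow_expand p (t : R) : -1 <= t <= 2 ->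
  (1 + t) ^+ p <= 1 + p%:R * t + 4 ^+ p * t ^+ 2.
Proof.
move=> /andP[t1 t2]; elim: p => [|p ih].
  by rewrite !expr0 mul0r addr0 mul1r lerDl sqr_ge0.
have p4 : p%:R <= 4 ^+ p :> R by rewrite -natrX ler_nat ltnW // ltn_expl.
have t10 : 0 <= 1 + t by lra.
rewrite exprS; apply: (le_trans (ler_wpM2l t10 ih)).
have q0 : 0 <= (4 : R) ^+ p by rewrite exprn_ge0.
have a1 : 0 <= t ^+ 2 * (4 ^+ p - p%:R) by apply: mulr_ge0; [exact: sqr_ge0|lra].
have a2 : 0 <= t ^+ 2 * 4 ^+ p * (2 - t).
  by apply: mulr_ge0; [apply: mulr_ge0 => //; exact: sqr_ge0|lra].
move: a1 a2; rewrite [4 ^+ p.+1]exprS -[p.+1%:R]natr1.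
by move: (4 ^+ p : R) (p%:R : R) => a b; lra.
Qed.

Definition Cmom p : R := p%:R + 4 * 4 ^+ p.

Lemma Cmom_ge0 p : 0 <= Cmom p.
Proof. by rewrite addr_ge0 // mulr_ge0 ?exprn_ge0. Qed.

(** The first-order terms of the two opposite steps cancel, so that the moment
    grows by a factor 1 + O(s ^ 2 / c). *)
Lemma two_point p (c a s : R) : 0 < c -> s ^+ 2 <= c ->
  (c + (a + s) ^+ 2) ^+ p + (c + (a - s) ^+ 2) ^+ p <=
  2 * (c + a ^+ 2) ^+ p * (1 + Cmom p * (s ^+ 2 / c)).
Proof.
move=> c0 sc; set D := c + a ^+ 2.
have a0 := sqr_ge0 a; have s0 := sqr_ge0 s.
have D0 : 0 < D by rewrite ltr_pwDl.
have Dn : D != 0 by rewrite gt_eqF.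
have sD0 : 0 <= s ^+ 2 / D by rewrite divr_ge0 // ltW.
have sD : s ^+ 2 / D <= s ^+ 2 / c.
  by rewrite ler_wpM2l // lef_pV2 ?posrE // lerDl.
have sc1 : s ^+ 2 / c <= 1 by rewrite ler_pdivrMr // mul1r.
have key b : b ^+ 2 = s ^+ 2 -> (c + (a + b) ^+ 2) ^+ p <=
   D ^+ p * (1 + p%:R * ((2 * a * b + b ^+ 2) / D) + 4 ^+ p * (4 * (s ^+ 2 / c))).
  move=> b2; set t := (2 * a * b + b ^+ 2) / D.
  have e : c + (a + b) ^+ 2 = D * (1 + t) by rewrite /t /D; field.
  have t2 : t ^+ 2 <= 4 * (s ^+ 2 / c).
    have u1 : t ^+ 2 <= 2 * (4 * a ^+ 2 * s ^+ 2 / D ^+ 2 + (s ^+ 2 / D) ^+ 2).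
      rewrite -b2 (_ : 2 * _ = t ^+ 2 + ((2 * a * b - b ^+ 2) / D) ^+ 2).
        by rewrite lerDl sqr_ge0.
      by rewrite /t; field.
    have u2 : 4 * a ^+ 2 * s ^+ 2 / D ^+ 2 <= s ^+ 2 / c.
      rewrite ler_pdivrMr ?exprn_gt0 // mulrC mulrA -mulrA mulrC.
      rewrite -subr_ge0 (_ : _ - _ = s ^+ 2 / c * (c - a ^+ 2) ^+ 2).
        by apply: mulr_ge0; [apply: divr_ge0 => //; exact: ltW|exact: sqr_ge0].
      by rewrite /D; field; rewrite gt_eqF.
    have u3 : (s ^+ 2 / D) ^+ 2 <= s ^+ 2 / c.
      apply: (le_trans _ sD); rewrite expr2 ler_piMr //; exact: (le_trans sD sc1).
    lra.
  have t4 : t ^+ 2 <= 4 by lra.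
  have tr : -1 <= t <= 2.
    apply/andP; split.
      rewrite -subr_ge0 opprK addrC -(pmulr_rge0 _ D0) -e addr_ge0 ?sqr_ge0 //; exact: ltW.
    by clear -t4; nra.
  rewrite e exprMn ler_wpM2l ?exprn_ge0 ?(ltW D0) // (le_trans (pow_expand p tr)) //.
  by rewrite lerD2l ler_wpM2l ?exprn_ge0.
have h1 := key s erefl; have h2 := key (- s) (sqrrN s).
apply: (le_trans (lerD h1 h2)).
rewrite -mulrDr [leRHS](_ : _ = D ^+ p * (2 * (1 + Cmom p * (s ^+ 2 / c)))); last by ring.
rewrite ler_wpM2l ?exprn_ge0 ?(ltW D0) //.
rewrite /Cmom.
have : p%:R * (s ^+ 2 / D) <= p%:R * (s ^+ 2 / c) by rewrite ler_wpM2l.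
have -> : (2 * a * s + s ^+ 2) / D = 2 * a * s / D + s ^+ 2 / D by rewrite mulrDl.
have -> : (2 * a * - s + (- s) ^+ 2) / D = - (2 * a * s / D) + s ^+ 2 / D.
  by rewrite sqrrN mulrN mulrDl mulNr.
move: (2 * a * s / D) (s ^+ 2 / D) (s ^+ 2 / c) (4 ^+ p) (p%:R) => v1 v2 v3 v4 v5.
lra.
Qed.

(** The shift c keeps the moment away from 0, so that one step multiplies it
    by a factor 1 + O(s ^ 2 / c) at every point, and iteration gives an
    exponential bound. *)
Definition vmom p (c : R) x : R := \sum_j (c + x 0 j ^+ 2) ^+ p.

Lemma walk_vmom p c s x : 0 < c -> s ^+ 2 <= c ->
  walk s (vmom p c) x <= (1 + Cmom p * (s ^+ 2 / (k%:R * c))) * vmom p c x.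
Proof.
move=> c0 sc; rewrite /walk mulrC ler_pdivrMr ?mulr_gt0 //.
have one i : vmom p c (x + s *: evec i) + vmom p c (x - s *: evec i) <=
   2 * vmom p c x + 2 * (c + x 0 i ^+ 2) ^+ p * (Cmom p * (s ^+ 2 / c)).
  rewrite /vmom !(bigD1 (P := xpredT) i) //=.
  have E b : \sum_(j | j != i) (c + (x + b *: evec i) 0 j ^+ 2) ^+ p =
     \sum_(j | j != i) (c + x 0 j ^+ 2) ^+ p.
    by apply: eq_bigr => j ji; rewrite !mxE eqxx (negbTE ji) mulr0 addr0.
  rewrite -scaleNr !E !mxE !eqxx !mulr1.
  have := two_point p (x 0 i) c0 sc; set T := \sum_(j | _) _; lra.
apply: (le_trans (ler_sum _ (fun i _ => one i))).
rewrite big_split /= sumr_const card_ord -mulr_suml -mulr_sumr -/(vmom p c x) -[_ *+ k]mulr_natr.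
rewrite le_eqVlt; apply/orP; left; apply/eqP; field.
by rewrite !gt_eqF.
Qed.

Lemma vmom_ge0 p c x : 0 <= c -> 0 <= vmom p c x.
Proof. by move=> c0; apply: sumr_ge0 => j _; rewrite exprn_ge0 // addr_ge0 ?sqr_ge0. Qed.

Lemma iter_vmom p c s1 s2 n x : 0 < c -> 0 <= s1 -> s1 <= s2 -> s2 ^+ 2 <= c ->
  iter n (maxwalk s1 s2) (vmom p c) x <=
  expR (Cmom p * (n%:R * s2 ^+ 2 / (k%:R * c))) * vmom p c x.
Proof.
move=> c0 s10 s12 sc.
have s1s : s1 ^+ 2 <= s2 ^+ 2 by apply: lerXn2r; rewrite ?nnegrE // (le_trans s10).
set r := 1 + Cmom p * (s2 ^+ 2 / (k%:R * c)).
have r0 : 0 <= r.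
  by rewrite addr_ge0 // mulr_ge0 ?Cmom_ge0 // divr_ge0 ?sqr_ge0 // mulr_ge0 // ltW.
have step y : maxwalk s1 s2 (vmom p c) y <= r * vmom p c y.
  rewrite /maxwalk ge_max; apply/andP; split; last exact: walk_vmom.
  apply: (le_trans (walk_vmom p y c0 (le_trans s1s sc))).
  rewrite ler_wpM2r ?vmom_ge0 ?(ltW c0) // lerD2l ler_wpM2l ?Cmom_ge0 //.
  by rewrite ler_wpM2r // invr_ge0 mulr_ge0 // ltW.
have it m y : iter m (maxwalk s1 s2) (vmom p c) y <= r ^+ m * vmom p c y.
  elim: m y => [|m ih] y; first by rewrite expr0 mul1r.
  have hJ := maxwalk_subop s1 s2.
  rewrite iterS; apply: (le_trans (op_mono hJ ih _)).
  by rewrite (op_hom hJ) ?exprn_ge0 // exprSr -mulrA ler_wpM2l ?exprn_ge0.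
apply: (le_trans (it n x)); rewrite ler_wpM2r ?vmom_ge0 ?(ltW c0) //.
rewrite (_ : Cmom p * _ = n%:R * (Cmom p * (s2 ^+ 2 / (k%:R * c)))); last by ring.
rewrite expRM_natl lerXn2r ?nnegrE ?expR_ge0 //.
exact: expR_ge1Dx.
Qed.

Lemma nrm_vmom p c x : 0 <= c -> nrm x ^+ (2 * p) <= (k%:R ^+ (2 * p)) * vmom p c x.
Proof.
move=> c0; pose i0 : 'I_k := Ordinal k0.
have [j hj] : exists j, forall i, `|x 0 i| <= `|x 0 j|.
  by case: (@Order.TotalTheory.arg_maxP _ R 'I_k i0 xpredT (fun i => `|x 0 i|)) => // j _ h; exists j => i; exact: h.
have h1 : nrm x <= k%:R * `|x 0 j|.
  have -> : k%:R * `|x 0 j| = \sum_(i < k) `|x 0 j|.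
    by rewrite sumr_const card_ord mulr_natl.
  rewrite nrm_row; exact: ler_sum.
apply: (@le_trans _ _ ((k%:R * `|x 0 j|) ^+ (2 * p))).
  by apply: lerXn2r; rewrite ?nnegrE ?nrm_ge0 ?mulr_ge0.
rewrite exprMn ler_wpM2l ?exprn_ge0 //.
rewrite exprM real_normK ?num_real // /vmom (bigD1 j) //= -[leLHS]addr0; apply: lerD.
  by apply: lerXn2r; rewrite ?nnegrE ?sqr_ge0 ?addr_ge0 ?sqr_ge0 // lerDr.
by apply: sumr_ge0 => i _; rewrite exprn_ge0 // addr_ge0 ?sqr_ge0.
Qed.

End Operators.

(** * Limits along an ultrafilter on the integers *)

(** Along an ultrafilter every bounded sequence converges, and the limit
    preserves the linear operations and the order. This avoids extracting
    subsequences that work for all test functions at once. *)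
Section UltraLimit.
Variables (R : realType) (U : set_system nat).
Hypothesis UU : UltraFilter U.
Let PU : ProperFilter U := @ultra_proper _ _ UU.
Local Existing Instance PU.

Definition ubounded (a : nat -> R) := exists B, \forall n \near U, `|a n| <= B.

Definition ulim (a : nat -> R) : R := sup [set r | \forall n \near U, r <= a n].

Lemma ulimP a : ubounded a -> forall e, 0 < e -> \forall n \near U, `|a n - ulim a| <= e.
Proof.
move=> [B hB] e e0; set A := [set r | \forall n \near U, r <= a n].
have hs : has_sup A.
  split; first by exists (- B); apply: filterS hB => n; rewrite ler_norml => /andP[].
  exists B => r hr; have [n [/= h1]] := filter_ex (filterI hr hB).
  by rewrite ler_norml => /andP[_]; exact: le_trans.
have [r hr rs] := sup_adherent e0 hs.
have hr' : \forall n \near U, ulim a - e <= a n.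
  by apply: filterS hr => n; apply: le_trans; exact: ltW.
have hu : \forall n \near U, a n <= ulim a + e.
  have [h|h] := in_ultra_setVsetC [set n | ulim a + e <= a n] UU.
    have : A (ulim a + e) by [].
    by move/(ub_le_sup hs.2); rewrite -/(ulim a) gerDl leNgt e0.
  by apply: filterS h => n /= /negP; rewrite -ltNge => /ltW.
by apply: filterS2 hr' hu => n h1 h2; rewrite ler_norml; apply/andP; split; lra.
Qed.

Lemma ulim_unique a l : (forall e, 0 < e -> \forall n \near U, `|a n - l| <= e) -> ulim a = l.
Proof.
move=> h.
have hb : ubounded a.
  exists (`|l| + 1); apply: filterS (h 1 ltr01) => n hn.
  have := ler_normD (a n - l) l; rewrite subrK; lra.
apply/eqP; rewrite -subr_eq0 -normr_le0; apply/ler_addgt0Pr => e e0.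
have e2 : 0 < e / 2 by rewrite divr_gt0.
have [n [/= h1 h2]] := filter_ex (filterI (ulimP hb e2) (h _ e2)).
rewrite add0r; have := ler_normB (a n - l) (a n - ulim a).
rewrite (_ : a n - l - (a n - ulim a) = ulim a - l); first lra.
by ring.
Qed.

Lemma ulim_cst c : ulim (fun=> c) = c.
Proof. by apply: ulim_unique => e e0; apply: nearW => n; rewrite subrr normr0 ltW. Qed.

Lemma ulim_le a b : ubounded a -> ubounded b -> (\forall n \near U, a n <= b n) -> ulim a <= ulim b.
Proof.
move=> ha hb h; apply/ler_addgt0Pr => e e0.
have e2 : 0 < e / 2 by rewrite divr_gt0.
have [n [/= h1 [/= h2 h3]]] := filter_ex (filterI h (filterI (ulimP ha e2) (ulimP hb e2))).
rewrite !ler_norml in h2 h3; case/andP: h2 => h2 _; case/andP: h3 => _ h3; lra.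
Qed.

Lemma uboundedD a b : ubounded a -> ubounded b -> ubounded (fun n => a n + b n).
Proof.
move=> [A hA] [B hB]; exists (A + B); apply: filterS2 hA hB => n h1 h2.
by rewrite (le_trans (ler_normD _ _)) // lerD.
Qed.

Lemma ubounded_cst c : ubounded (fun=> c).
Proof. by exists `|c|; exact: nearW. Qed.

Lemma ulimD a b : ubounded a -> ubounded b -> ulim (fun n => a n + b n) = ulim a + ulim b.
Proof.
move=> ha hb; apply: ulim_unique => e e0.
have e2 : 0 < e / 2 by rewrite divr_gt0.
apply: filterS2 (ulimP ha e2) (ulimP hb e2) => n h1 h2.
by rewrite opprD addrACA (le_trans (ler_normD _ _)) //; lra.
Qed.

Lemma ulimZ c a : ubounded a -> ulim (fun n => c * a n) = c * ulim a.
Proof.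
move=> ha; apply: ulim_unique => e e0.
have c0 : 0 < `|c| + 1 by rewrite ltr_wpDl.
apply: filterS (ulimP ha (divr_gt0 e0 c0)) => n h; rewrite -mulrBr normrM.
apply: (@le_trans _ _ ((`|c| + 1) * `|a n - ulim a|)); first by rewrite ler_wpM2r // lerDl.
by rewrite mulrC -ler_pdivlMr.
Qed.

Lemma ulim_near a b : ubounded a -> ubounded b ->
  (forall e, 0 < e -> \forall n \near U, `|a n - b n| <= e) -> ulim a = ulim b.
Proof.
move=> ha hb h; apply: ulim_unique => e e0.
have e2 : 0 < e / 2 by rewrite divr_gt0.
apply: filterS2 (h _ e2) (ulimP hb e2) => n h1 h2.
have := ler_normD (a n - b n) (b n - ulim b); rewrite addrA subrK; lra.
Qed.

End UltraLimit.

(** * The G-heat semigroup as a limit of walks *)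

Section Existence.
Variables (R : realType) (k : nat) (lo up : R) (U : set_system nat).
Hypothesis k0 : (0 < k)%N.
Hypothesis lo0 : 0 <= lo.
Hypothesis loup : lo <= up.
Hypothesis UU : UltraFilter U.
Hypothesis hU : \oo `<=` U.
Let PU : ProperFilter U := @ultra_proper _ _ UU.
Local Existing Instance PU.
Implicit Types (x y z : 'rV[R]_k) (f g : 'rV[R]_k -> R).
Let up0 : 0 <= up := le_trans lo0 loup.
Let k0' : 0 < k%:R :> R. Proof. by rewrite ltr0n. Qed.

(** Step lengths for the mesh 1 / n: one step along one of k axes has variance
    s ^ 2 / k in each direction, whence the factor k. *)
Definition step_up (n : nat) : R := Num.sqrt (k%:R * up / n%:R).
Definition step_lo (n : nat) : R := Num.sqrt (k%:R * lo / n%:R).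
Definition mesh_walk n := maxwalk (k := k) (step_lo n) (step_up n).

Lemma mesh_walk_sub n : subop (mesh_walk n).
Proof. exact: maxwalk_subop. Qed.

Lemma mesh_iter_sub n m : subop (iter m (mesh_walk n)).
Proof. exact/subop_iter/mesh_walk_sub. Qed.

Lemma step_up2 n : step_up n ^+ 2 = k%:R * up / n%:R.
Proof. by rewrite sqr_sqrtr // divr_ge0 // mulr_ge0. Qed.

Lemma step_lo2 n : step_lo n ^+ 2 = k%:R * lo / n%:R.
Proof. by rewrite sqr_sqrtr // divr_ge0 // mulr_ge0. Qed.

Lemma step_lo_up n : step_lo n <= step_up n.
Proof. by apply: ler_wsqrtr; rewrite ler_wpM2r ?invr_ge0 // ler_wpM2l. Qed.

Lemma step_up_small d : 0 < d -> \forall n \near \oo, step_up n <= d /\ (0 < n)%N.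
Proof.
move=> d0; near=> n.
have n0 : (0 < n)%N by near: n; exact: nbhs_infty_gt.
have n0' : 0 < n%:R :> R by rewrite ltr0n.
split=> //; rewrite -[d]gtr0_norm // -sqrtr_sqr; apply: ler_wsqrtr.
rewrite ler_pdivrMr // -ler_pdivrMl ?exprn_gt0 //.
by near: n; exact: nbhs_infty_ger.
Unshelve. all: by end_near. Qed.

Lemma mesh_walk_vmom p (c t : R) : 0 < c -> 0 <= t ->
  \forall n \near \oo, forall m, m%:R <= t * n%:R ->
    iter m (mesh_walk n) (vmom p c) 0 <= expR (Cmom R p * (t * up / c)) * (k%:R * c ^+ p).
Proof.
move=> c0 t0; have sc0 : 0 < Num.sqrt c by rewrite sqrtr_gt0.
apply: filterS (step_up_small sc0) => n [sn n0] m hm.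
have n0' : 0 < n%:R :> R by rewrite ltr0n.
have sc : step_up n ^+ 2 <= c.
  rewrite -[c]sqr_sqrtr ?(ltW c0) //; apply: lerXn2r; rewrite ?nnegrE ?sqrtr_ge0 //.
apply: le_trans; first exact: (iter_vmom k0 p m 0 c0 (sqrtr_ge0 _) (step_lo_up n) sc).
have -> : vmom p c (0 : 'rV[R]_k) = k%:R * c ^+ p.
  rewrite /vmom; under eq_bigr do rewrite mxE expr0n addr0.
  by rewrite sumr_const card_ord mulr_natl.
rewrite ler_wpM2r ?mulr_ge0 ?exprn_ge0 ?(ltW c0) // ler_expR ler_wpM2l ?Cmom_ge0 //.
rewrite step_up2 (_ : _ / _ = m%:R / n%:R * (up / c)); last by field; rewrite !gt_eqF.
rewrite -[leRHS]mulrA ler_wpM2r ?divr_ge0 ?(ltW c0) //.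
by rewrite ler_pdivrMr.
Qed.

Lemma pm_le q x : (1 + nrm x) ^+ q <= 4 ^+ q * (1 + k%:R ^+ (2 * q) * vmom q 1 x).
Proof.
have a0 := nrm_ge0 x; set a := nrm x in a0 *.
have h1 : (1 + a) ^+ q <= (2 * (1 + a ^+ 2)) ^+ q.
  by apply: lerXn2r; rewrite ?nnegrE ?addr_ge0 ?mulr_ge0 ?addr_ge0 ?sqr_ge0 //; nra.
apply: (le_trans h1); rewrite (_ : 4 = 2 * 2 :> R); last by ring.
rewrite [(2 * 2) ^+ q]exprMn exprMn -mulrA ler_wpM2l ?exprn_ge0 //.
have a20 : 0 <= a ^+ 2 by rewrite sqr_ge0.
have : (1 + a ^+ 2) ^+ q <= 2 ^+ q * (1 + (a ^+ 2) ^+ q).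
  have [h|h] := leP (a ^+ 2) 1.
    apply: (@le_trans _ _ (2 ^+ q)); first by apply: lerXn2r; rewrite ?nnegrE ?addr_ge0 //; lra.
    by rewrite ler_peMr ?exprn_ge0 // lerDl exprn_ge0.
  apply: (@le_trans _ _ (2 ^+ q * (a ^+ 2) ^+ q)).
    by rewrite -exprMn; apply: lerXn2r; rewrite ?nnegrE ?addr_ge0 ?mulr_ge0 //; lra.
  by rewrite ler_wpM2l ?exprn_ge0 // lerDr.
move=> h; apply: (le_trans h); rewrite ler_wpM2l ?exprn_ge0 // lerD2l -exprM.
exact: nrm_vmom.
Qed.

(** By [mesh_walk_vmom] at scale 1: the bound does not depend on the mesh, nor on
    the number of steps up to time t. *)
Lemma walk_moments q (t : R) : 0 <= t -> exists B : R, 0 <= B /\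
  \forall n \near U, forall m, m%:R <= t * n%:R -> forall f (C : R),
    (forall x, `|f x| <= C * (1 + nrm x) ^+ q) -> `|iter m (mesh_walk n) f 0| <= C * B.
Proof.
move=> t0; set E : R := expR (Cmom R q * (t * up / 1)) * (k%:R * 1 ^+ q).
have E0 : 0 <= E by rewrite mulr_ge0 ?expR_ge0 // mulr_ge0 // exprn_ge0.
exists (4 ^+ q * (1 + k%:R ^+ (2 * q) * E)); split.
  by rewrite mulr_ge0 ?exprn_ge0 // addr_ge0 // mulr_ge0 ?exprn_ge0.
apply: filterS (hU (mesh_walk_vmom q ltr01 t0)) => n hn m hm f C hf.
have C0 : 0 <= C.
  by have := hf 0; rewrite nrm0 addr0 expr1n mulr1; exact: le_trans.
have hs := mesh_iter_sub n m.
have := @subop_dist _ _ _ f (fun=> 0) (fun x => C * (1 + nrm x) ^+ q) 0 hs.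
rewrite (op_cst hs) subr0 => h; apply: (le_trans (h _)).
  by move=> y; rewrite subr0.
rewrite (op_hom hs) // ler_wpM2l //.
apply: (le_trans (op_mono hs (@pm_le q) _)).
rewrite (op_hom hs) ?exprn_ge0 // ler_wpM2l ?exprn_ge0 //.
rewrite (_ : (fun y => _) = (fun y => k%:R ^+ (2 * q) * vmom q 1 y + 1)); last first.
  by apply/funext => y; rewrite addrC.
rewrite (subop_addc _ _ _ hs) (op_hom hs) ?exprn_ge0 // addrC lerD2l ler_wpM2l ?exprn_ge0 //.
exact: hn.
Qed.

(** The walk of mesh 1 / n run up to time t. *)
Definition mesh_value (n : nat) (t : R) f : R := iter (Num.truncn (t * n%:R)) (mesh_walk n) f 0.

Definition gsg (t : R) f : R := ulim U (fun n => mesh_value n t f).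

Lemma trn_le t n : 0 <= t -> (Num.truncn (t * n%:R))%:R <= t * n%:R :> R.
Proof. by move=> t0; rewrite truncn_le mulr_ge0. Qed.

Lemma mesh_value_bounded t f : 0 <= t -> slip f -> ubounded U (fun n => mesh_value n t f).
Proof.
move=> t0 /slip_bound[C [q [C0 hf]]]; have [B [B0 hB]] := walk_moments q t0.
exists (C * B); apply: filterS hB => n hn; apply: hn => //; exact: trn_le.
Qed.

Lemma gsg_sublin t : 0 <= t -> sublin (gsg t).
Proof.
move=> t0; split.
- move=> f g hf hg h; apply: (ulim_le UU); try exact: mesh_value_bounded.
  by apply: nearW => n; apply: (op_mono (mesh_iter_sub _ _)).
- move=> c; rewrite /gsg (_ : (fun n => _) = (fun=> c)) ?(ulim_cst UU) //.
  by apply/funext => n; rewrite /mesh_value (op_cst (mesh_iter_sub _ _)).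
- move=> f g hf hg; rewrite /gsg -(ulimD UU); try exact: mesh_value_bounded.
  apply: (ulim_le UU).
  + by apply: mesh_value_bounded => //; exact: slipD.
  + by apply: (uboundedD UU); exact: mesh_value_bounded.
  + by apply: nearW => n; exact: (op_add (mesh_iter_sub _ _)).
- move=> c f c0 hf; rewrite /gsg -(ulimZ UU); last exact: mesh_value_bounded.
  by congr ulim; apply/funext => n; rewrite /mesh_value (op_hom (mesh_iter_sub _ _)).
Qed.

Lemma gsg0 f : gsg 0 f = f 0.
Proof.
rewrite /gsg (_ : (fun n => _) = (fun=> f 0)) ?(ulim_cst UU) //.
by apply/funext => n; rewrite /mesh_value mul0r truncn0.
Qed.

(** The moments at scale c = t of order two and four are of order t and t ^ 2,
    and nrm x ^+ 3 lies below sqrt t * nrm x ^+ 2 + nrm x ^+ 4 / sqrt t. *)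
Lemma gsg_third : exists M, 0 <= M /\
  forall t, 0 <= t -> gsg t (fun x => nrm x ^+ 3) <= M * (t * Num.sqrt t).
Proof.
pose M : R := k%:R ^+ 2 * (expR (Cmom R 1 * up) * k%:R) + k%:R ^+ 4 * (expR (Cmom R 2 * up) * k%:R).
have M0 : 0 <= M by rewrite addr_ge0 // !mulr_ge0 ?exprn_ge0 ?expR_ge0.
exists M; split=> // t; rewrite le_eqVlt => /orP[/eqP<-|t0].
  by rewrite gsg0 nrm0 expr0n mul0r mulr0.
have sn3 : slip (fun x : 'rV[R]_k => nrm x ^+ 3) by apply: slipX; exact: slip_nrm.
rewrite -(ulim_cst UU (M * _)); apply: (ulim_le UU).
- by apply: mesh_value_bounded => //; exact: ltW.
- exact: (ubounded_cst UU).
have s0 : 0 < Num.sqrt t by rewrite sqrtr_gt0.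
have tt : t = Num.sqrt t ^+ 2 by rewrite sqr_sqrtr // ltW.
apply: filterS2 (hU (mesh_walk_vmom 1 t0 (ltW t0))) (hU (mesh_walk_vmom 2 t0 (ltW t0))) => n h1 h2.
have hm := @trn_le t n (ltW t0).
have {}h1 := h1 _ hm; have {}h2 := h2 _ hm.
have e1 : t * up / t = up by rewrite mulrAC divff ?mul1r // gt_eqF.
rewrite e1 in h1 h2.
have hs := mesh_iter_sub n (Num.truncn (t * n%:R)).
apply: (@le_trans _ _ (iter (Num.truncn (t * n%:R)) (mesh_walk n)
   (fun x => Num.sqrt t * k%:R ^+ 2 * vmom 1 t x + (Num.sqrt t)^-1 * k%:R ^+ 4 * vmom 2 t x) 0)).
  apply: (op_mono hs) => x.
  have b1 := nrm_vmom k0 1 x (ltW t0); have b2 := nrm_vmom k0 2 x (ltW t0).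
  rewrite /= in b1 b2.
  have x0 := nrm_ge0 x.
  apply: (@le_trans _ _ (Num.sqrt t * nrm x ^+ 2 + (Num.sqrt t)^-1 * nrm x ^+ 4)).
    rewrite -subr_ge0 (_ : _ - _ = (Num.sqrt t)^-1 * nrm x ^+ 2 * ((nrm x - Num.sqrt t) ^+ 2 + Num.sqrt t * nrm x)).
      have si : 0 <= (Num.sqrt t)^-1 by rewrite invr_ge0 ltW.
      apply: mulr_ge0; first by apply: mulr_ge0 => //; exact: sqr_ge0.
      by apply: addr_ge0; [exact: sqr_ge0|apply: mulr_ge0].
    by field; rewrite gt_eqF.
  rewrite -[X in _ <= X + _]mulrA -[X in _ <= _ + X]mulrA; apply: lerD.
    exact: (ler_wpM2l (ltW s0)).
  by apply: ler_wpM2l => //; rewrite invr_ge0 ltW.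
apply: (le_trans (op_add hs _ _ _)).
have c1 : 0 <= Num.sqrt t * k%:R ^+ 2 by rewrite mulr_ge0 ?exprn_ge0.
have c2 : 0 <= (Num.sqrt t)^-1 * k%:R ^+ 4 by rewrite mulr_ge0 ?exprn_ge0 // invr_ge0 ltW.
rewrite !(op_hom hs) //.
apply: (le_trans (lerD (ler_wpM2l c1 h1) (ler_wpM2l c2 h2))).
rewrite le_eqVlt; apply/orP; left; apply/eqP; rewrite /M expr1.
have -> : t ^+ 2 = t * Num.sqrt t ^+ 2 by rewrite -tt expr2.
by field; rewrite gt_eqF.
Qed.

Lemma gsg_linquad t (p : 'rV[R]_k) (Q : 'M[R]_k) : 0 <= t ->
  gsg t (linquad p Q) = t * Num.max (lo * \tr Q) (up * \tr Q).
Proof.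
move=> t0; apply: (ulim_unique UU) => e e0.
set m := Num.max _ _.
have me : 0 < e / (`|m| + 1) by rewrite divr_gt0 // ltr_wpDl.
apply: hU; near=> n.
have n0 : (0 < n)%N by near: n; exact: nbhs_infty_gt.
have n0' : 0 < n%:R :> R by rewrite ltr0n.
rewrite /mesh_value iter_linquad // linquad0 add0r step_up2 step_lo2.
have -> : Num.max (k%:R * lo / n%:R / k%:R * \tr Q) (k%:R * up / n%:R / k%:R * \tr Q) = n%:R^-1 * m.
  rewrite /m maxr_pMr ?invr_ge0 //; congr Num.max; field; rewrite !gt_eqF //.
set a := Num.truncn _.
have := truncn_itv (mulr_ge0 t0 (ler0n R n)); rewrite -/a -natr1 => /andP[h1 h2].
rewrite mulrA -mulrBl normrM.
have h3 : `|a%:R * n%:R^-1 - t| <= n%:R^-1.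
  rewrite -(ler_pM2r n0') -{2}[n%:R]ger0_norm // -normrM mulrBl divfK ?gt_eqF // mulVf ?gt_eqF //.
  by rewrite ler_norml; apply/andP; split; lra.
have h4 : n%:R^-1 <= e / (`|m| + 1).
  rewrite -[leRHS]invrK lef_pV2 ?posrE ?invr_gt0 //.
  by near: n; exact: nbhs_infty_ger.
apply: (@le_trans _ _ (e / (`|m| + 1) * `|m|)).
  by rewrite ler_wpM2r // (le_trans h3).
rewrite mulrAC ler_pdivrMr ?ltr_wpDl // ler_wpM2l ?(ltW e0) // lerDl //.
Unshelve. all: by end_near. Qed.

End Existence.

Lemma sub_le1 (a b c : nat) : (c < a.+1 + b.+1)%N -> (c - (a + b) <= 1)%N.
Proof. lia. Qed.

Section SemigroupProperty.
Variables (R : realType) (k : nat) (lo up : R) (U : set_system nat).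
Hypothesis k0 : (0 < k)%N.
Hypothesis lo0 : 0 <= lo.
Hypothesis loup : lo <= up.
Hypothesis UU : UltraFilter U.
Hypothesis hU : \oo `<=` U.
Let PU : ProperFilter U := @ultra_proper _ _ UU.
Local Existing Instance PU.
Implicit Types (x y z : 'rV[R]_k) (f g : 'rV[R]_k -> R).
Local Notation Jn := (@mesh_walk R k lo up).
Local Notation mu := (gsg lo up U).

Lemma slip2_add f : slip f -> slip2 (fun x y : 'rV[R]_k => f (x + y)).
Proof. by move=> hf; apply: (@slip2_lin _ _ _ _ _ _ _ f id id). Qed.

Lemma nbhs_nrm x d : 0 < d -> nbhs x [set y | nrm (x - y) <= d].
Proof.
move=> d0; apply/nbhs_ballP; exists (d / k.+1%:R) => /=; first by rewrite divr_gt0.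
move=> y [_ hy] /=; rewrite nrm_row; apply: (@le_trans _ _ (\sum_(i < k) d / k.+1%:R)).
  by apply: ler_sum => i _; have := hy 0 i; rewrite /ball /= !mxE => /ltW.
rewrite sumr_const card_ord -[leLHS]mulr_natr mulrAC ler_pdivrMr // ler_wpM2l ?(ltW d0) //.
by rewrite ler_nat.
Qed.

Lemma compact_box (r : R) : compact [set x : 'rV[R]_k | forall i, `|x ord0 i| <= r].
Proof.
have := @rV_compact R k (fun=> `[- r, r]%classic) (fun=> @segment_compact R _ _).
congr compact; apply/seteqP; split=> x /= h i; have := h i; rewrite /= in_itv /= ler_norml //.
Qed.

(** The iterates are equicontinuous on compact sets uniformly in n, since they
    preserve the modulus of continuity of f up to moments; pointwise
    convergence along the ultrafilter is therefore locally uniform. *)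
Lemma unif_conv f t (r e : R) : slip f -> 0 <= t -> 0 < e ->
  \forall n \near U, forall x, nrm x <= r ->
    `|iter (Num.truncn (t * n%:R)) (Jn n) f x - mu t (fun y => f (x + y))| <= e.
Proof.
move=> sf t0 e0.
pose fn n x := iter (Num.truncn (t * n%:R)) (Jn n) f x.
pose F x := mu t (fun y => f (x + y)).
have fnE n x : fn n x = mesh_value lo up n t (fun y => f (x + y)).
  by rewrite /fn /mesh_value (op_shift (mesh_iter_sub _ _ k0 _ _)) addr0.
have sF : slip F.
  exact: (slip_param (gsg_sublin k0 lo0 loup UU hU t0) (slip2_add sf)).
have [C' [q' [C'0 hF]]] := sF.
have [C [q [C0 hf]]] := sf.
have [B [B0 hB]] := walk_moments k0 lo0 loup UU hU q t0.
pose A := C * 2 ^+ q * B.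
have A0 : 0 <= A by rewrite /A !mulr_ge0 ?exprn_ge0.
have equi : \forall n \near U, forall x x', `|fn n x - fn n x'| <= A * wgt x x' ^+ q * nrm (x - x').
  apply: filterS hB => n hn x x'; rewrite !fnE /mesh_value.
  set m := Num.truncn _; have hs := mesh_iter_sub lo up k0 n m.
  pose c := C * (2 * wgt x x') ^+ q * nrm (x - x').
  have c0 : 0 <= c by rewrite /c !mulr_ge0 ?exprn_ge0 ?mulr_ge0 ?wgt_ge0 ?nrm_ge0.
  apply: (@le_trans _ _ (iter m (Jn n) (fun y => c * (1 + nrm y) ^+ q) 0)).
    apply: subop_dist => // y; apply: (le_trans (hf _ _)).
    rewrite opprD addrACA subrr addr0 /c.
    rewrite [leRHS](_ : _ = C * ((2 * wgt x x') * (1 + nrm y)) ^+ q * nrm (x - x')); last by rewrite [(_ * (1 + _)) ^+ q]exprMn; ring.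
    rewrite ler_wpM2r ?nrm_ge0 // ler_wpM2l //.
    apply: lerXn2r; rewrite ?nnegrE ?mulr_ge0 ?wgt_ge0 ?addr_ge0 ?nrm_ge0 //.
    rewrite /wgt; have := nrmD x y; have := nrmD x' y; have := nrm_ge0 x; have := nrm_ge0 x'; have := nrm_ge0 y.
    move: (nrm x) (nrm x') (nrm y) => a b d d0 b0 a0 h1 h2.
    have := mulr_ge0 a0 d0; have := mulr_ge0 b0 d0; lra.
  have := hn m (trn_le n t0) (fun y => c * (1 + nrm y) ^+ q) c.
  move=> h; apply: (le_trans (ler_norm _)); apply: (le_trans (h _)).
    by move=> y; rewrite ger0_norm // mulr_ge0 // exprn_ge0 // addr_ge0 // nrm_ge0.
  by rewrite /c /A le_eqVlt; apply/orP; left; apply/eqP; rewrite exprMn; ring.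
have bd x : ubounded U (fun n => mesh_value lo up n t (fun y => f (x + y))).
  apply: (mesh_value_bounded k0 lo0 loup UU hU t0); exact: slip2_sec (slip2_add sf).
have cov := (compact_near_coveringP _).1 (@compact_box r) _ U
   (fun n x => `|fn n x - F x| <= e).
have : \forall n \near U, [set x : 'rV[R]_k | forall i, `|x ord0 i| <= r] `<=` (fun x => `|fn n x - F x| <= e).
  apply: cov => x _.
  pose W := 2 + 2 * nrm x.
  have W0 : 0 <= W by rewrite addr_ge0 // mulr_ge0 ?nrm_ge0.
  pose D := A * W ^+ q + C' * W ^+ q' + 1.
  have D0 : 0 < D by rewrite ltr_wpDl // addr_ge0 // mulr_ge0 ?exprn_ge0.
  pose d := Num.min 1 (e / 2 / D).
  have d0 : 0 < d by rewrite lt_min ltr01 !divr_gt0.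
  have d1 : d <= 1 by rewrite ge_min lexx.
  have dD : D * d <= e / 2.
    have : d <= e / 2 / D by rewrite ge_min lexx orbT.
    by rewrite ler_pdivlMr // mulrC.
  have e2 : 0 < e / 2 by rewrite divr_gt0.
  exists ([set y | nrm (x - y) <= d],
          [set n | `|fn n x - F x| <= e / 2 /\
             forall x x', `|fn n x - fn n x'| <= A * wgt x x' ^+ q * nrm (x - x')]).
    split; first exact: nbhs_nrm.
    apply: filterS2 (ulimP UU (bd x) e2) equi => n h1 h2; split=> //.
    by rewrite fnE.
  move=> [y n] /= [hy [h1 h2]].
  have ww : wgt x y <= W.
    have := nrmB x (x - y); rewrite opprB addrCA subrr addr0 /wgt /W; lra.
  have u1 := h2 x y; have u2 := hF x y.
  have hx0 := nrm_ge0 (x - y).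
  have {}u1 : `|fn n x - fn n y| <= A * W ^+ q * d.
    apply: (le_trans u1); apply: ler_pM; rewrite ?mulr_ge0 ?exprn_ge0 ?wgt_ge0 //.
    by rewrite ler_wpM2l //; apply: lerXn2r; rewrite ?nnegrE ?wgt_ge0.
  have {}u2 : `|F x - F y| <= C' * W ^+ q' * d.
    apply: (le_trans u2); apply: ler_pM; rewrite ?mulr_ge0 ?exprn_ge0 ?wgt_ge0 //.
    by rewrite ler_wpM2l //; apply: lerXn2r; rewrite ?nnegrE ?wgt_ge0.
  have -> : fn n y - F y = (fn n x - F x) - (fn n x - fn n y) + (F x - F y) by ring.
  rewrite (le_trans (ler_normD _ _)) // (le_trans (lerD (ler_normB _ _) (lexx _))) //.
  rewrite /D in dD; lra.
by apply: filterS => n h x hx; apply: h => i /=; exact: le_trans (nrm_coord x 0 i) hx.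
Qed.

(** After the first b steps the iterate is uniformly close to the limit at
    time t on a large ball, and outside of it the moments make both
    negligible. The integer parts of the numbers of steps may differ by one,
    and one step changes f by little. *)
Lemma gsg_add s t f : 0 <= s -> 0 <= t -> slip f ->
  mu s (fun x => mu t (fun y => f (x + y))) = mu (s + t) f.
Proof.
move=> s0 t0 sf; have st0 : 0 <= s + t by rewrite addr_ge0.
pose F x := mu t (fun y => f (x + y)); rewrite -/F.
have sF : slip F.
  exact: (slip_param (gsg_sublin k0 lo0 loup UU hU t0) (slip2_add sf)).
have bF := mesh_value_bounded k0 lo0 loup UU hU s0 sF.
have bf := mesh_value_bounded k0 lo0 loup UU hU st0 sf.
apply: (ulim_near UU bF bf) => e e0.
have [C [q [C0 hf]]] := sf.
have [C1 [q1 [C10 hf1]]] := slip_bound sf.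
have [C2 [q2 [C20 hF2]]] := slip_bound sF.
have [B1 [B10 hB1]] := walk_moments k0 lo0 loup UU hU q1 t0.
pose q3 := (maxn q1 q2).+1.
have [B3 [B30 hB3]] := walk_moments k0 lo0 loup UU hU q3 s0.
have [B4 [B40 hB4]] := walk_moments k0 lo0 loup UU hU q st0.
pose C3 := C1 * B1 + C2.
have C30 : 0 <= C3 by rewrite addr_ge0 // mulr_ge0.
pose d := e / 4 / (B3 + 1).
have B31 : 0 < B3 + 1 by rewrite ltr_wpDl.
have d0 : 0 < d by rewrite !divr_gt0.
(* Outside the ball of radius r the crude bounds have one power of nrm y to
   spare, which contributes the factor d. *)
pose r := C3 / d + 1.
have r0 : 0 < r by rewrite ltr_wpDl // divr_ge0 // ltW.
have C3r : C3 <= d * r by rewrite /r mulrDr mulrCA divff ?gt_eqF // !mulr1 lerDl ltW.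
have e4 : 0 < e / 2 / (C * 3 ^+ q * B4 + 1).
  by rewrite !divr_gt0 // ltr_wpDl // mulr_ge0 // mulr_ge0 // exprn_ge0.
pose dl := Num.min 1 (e / 2 / (C * 3 ^+ q * B4 + 1)).
have dl0 : 0 < dl by rewrite lt_min ltr01.
have dl1 : dl <= 1 by rewrite ge_min lexx.
have dle : C * 3 ^+ q * B4 * dl <= e / 2.
  have h : dl <= e / 2 / (C * 3 ^+ q * B4 + 1) by rewrite ge_min lexx orbT.
  rewrite ler_pdivlMr in h; last by rewrite ltr_wpDl // mulr_ge0 // mulr_ge0 // exprn_ge0.
  have := dl0; move: h; rewrite mulrDr mulr1 [dl * _]mulrC; lra.
have small := hU (step_up_small k up dl0).
apply: filterS2 (filterI small hB1) (filterI (filterI hB3 hB4) (unif_conv r sf t0 d0)).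
move=> n [/= [hs hn0] h1] [/= [h3 h4] hu].
rewrite /mesh_value.
set a := Num.truncn (s * _); set b := Num.truncn (t * n%:R); set c := Num.truncn _.
have ha : a%:R <= s * n%:R by exact: trn_le.
have hb : b%:R <= t * n%:R by exact: trn_le.
have hc : c%:R <= (s + t) * n%:R by exact: trn_le.
have hJa := mesh_iter_sub lo up k0 n a.
have hJb := mesh_iter_sub lo up k0 n b.
have hab : (a + b)%:R <= (s + t) * n%:R by rewrite natrD mulrDl lerD.
have [eps heps hce] : exists2 eps : nat, (eps <= 1)%N & c = (a + b + eps)%N.
  exists (c - (a + b))%N.
    have : (c < a.+1 + b.+1)%N.
      rewrite truncn_lt_nat ?mulr_ge0 // mulrDl natrD; apply: ltrD; exact: truncnS_gt.
    exact: sub_le1.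
  have : (a + b <= c)%N by rewrite truncn_ge_nat // mulr_ge0.
  by move/subnKC => ->.
have step1 : `|iter (a + b) (Jn n) (iter eps (Jn n) f) 0 - iter (a + b) (Jn n) f 0| <= e / 2.
  have hJab := mesh_iter_sub lo up k0 n (a + b).
  have k0' : 0 < k%:R :> R by rewrite ltr0n.
  have su0 : 0 <= step_up k up n by exact: sqrtr_ge0.
  have one sg y (i : 'I_k) : `|sg| <= step_up k up n -> `|f (y + sg *: evec R i) - f y| <= C * 3 ^+ q * dl * (1 + nrm y) ^+ q.
    move=> hsg; apply: (le_trans (hf _ _)).
    have ne : nrm (sg *: evec R i) <= dl.
      rewrite nrmZ (_ : nrm (evec R i) = 1) ?mulr1 ?(le_trans hsg) //.
      rewrite nrm_row (bigD1 i) //= big1 ?addr0 => [|j ji]; first by rewrite mxE !eqxx normr1.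
      by rewrite mxE (negbTE ji) andbF normr0.
    rewrite [y + _ - y]addrC addKr mulrAC -[leRHS]mulrAC.
    apply: (@le_trans _ _ (C * nrm (sg *: evec R i) * (3 * (1 + nrm y)) ^+ q)).
      rewrite ler_wpM2l ?mulr_ge0 ?nrm_ge0 //; apply: lerXn2r; rewrite ?nnegrE ?wgt_ge0 ?mulr_ge0 ?addr_ge0 ?nrm_ge0 //.
      rewrite /wgt; have := nrmD y (sg *: evec R i); have := nrm_ge0 y; lra.
    rewrite exprMn (_ : _ * _ = C * (3 ^+ q * (1 + nrm y) ^+ q) * nrm (sg *: evec R i)); last by ring.
    rewrite (_ : C * 3 ^+ q * _ * dl = C * (3 ^+ q * (1 + nrm y) ^+ q) * dl); last by ring.
    by rewrite ler_wpM2l // !mulr_ge0 ?exprn_ge0 ?addr_ge0 ?nrm_ge0.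
  have gen (Y : R) : Y * (2 * k%:R) = \sum_(i < k) (Y + Y).
    by rewrite sumr_const card_ord -[RHS]mulr_natr; ring.
  have wk sg y : 0 <= sg -> sg <= step_up k up n -> `|walk sg f y - f y| <= C * 3 ^+ q * dl * (1 + nrm y) ^+ q.
    move=> sg0 hsg; set X := C * _ * _ * _ in one *.
    have -> : walk sg f y - f y = (2 * k%:R)^-1 * \sum_i ((f (y + sg *: evec R i) - f y) + (f (y - sg *: evec R i) - f y)).
      rewrite /walk [in RHS](eq_bigr (fun i => (f (y + sg *: evec R i) + f (y - sg *: evec R i)) + (- (2 * f y)))); last by move=> i _; ring.
      rewrite [in RHS]big_split /= sumr_const card_ord mulrDr -[_ *+ k]mulr_natr; congr (_ + _).
      by field; rewrite gt_eqF.
    rewrite normrM ger0_norm ?invr_ge0 ?mulr_ge0 // mulrC ler_pdivrMr ?mulr_gt0 //.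
    rewrite (le_trans (ler_norm_sum _ _ _)) //.
    rewrite gen.
    apply: ler_sum => i _; rewrite (le_trans (ler_normD _ _)) // lerD //.
      by apply: one; rewrite ger0_norm.
    by rewrite -scaleNr; apply: one; rewrite normrN ger0_norm.
  have Jf y : `|iter eps (Jn n) f y - f y| <= C * 3 ^+ q * dl * (1 + nrm y) ^+ q.
    case: eps heps {hce} => [_|[_|//]] /=.
      by rewrite subrr normr0 !mulr_ge0 ?exprn_ge0 ?addr_ge0 ?nrm_ge0 // ltW.
    have w1 := wk (step_lo k lo n) y (sqrtr_ge0 _) (step_lo_up k loup n).
    have w2 := wk (step_up k up n) y su0 (lexx _).
    by rewrite /mesh_walk /maxwalk maxEle; case: ifP.
  apply: (le_trans (subop_dist _ hJab Jf)).
  have := h4 _ hab (fun y => C * 3 ^+ q * dl * (1 + nrm y) ^+ q) (C * 3 ^+ q * dl).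
  move=> h; apply: (le_trans (ler_norm _)); apply: (le_trans (h _)).
    move=> y; rewrite ger0_norm // !mulr_ge0 ?exprn_ge0 ?addr_ge0 ?nrm_ge0 // ltW //.
  by rewrite mulrAC.
have step2 : `|iter a (Jn n) F 0 - iter (a + b) (Jn n) f 0| <= e / 2.
  rewrite iterD -[iter b _ f]/(fun y => iter b (Jn n) f y).
  have fnb y : `|iter b (Jn n) f y| <= C1 * B1 * (1 + nrm y) ^+ q1.
    have -> : iter b (Jn n) f y = iter b (Jn n) (fun z => f (y + z)) 0.
      by rewrite (op_shift hJb) addr0.
    rewrite mulrAC; apply: h1 => // z; apply: (le_trans (hf1 _)).
    rewrite -mulrA -exprMn ler_wpM2l //; apply: lerXn2r; rewrite ?nnegrE ?mulr_ge0 ?addr_ge0 ?nrm_ge0 //.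
    have := nrmD y z; have := mulr_ge0 (nrm_ge0 y) (nrm_ge0 z); lra.
  have dd y : `|iter b (Jn n) f y - F y| <= 2 * d * (1 + nrm y) ^+ q3.
    have y1 : 1 <= 1 + nrm y by rewrite lerDl nrm_ge0.
    have y0 : 0 <= 1 + nrm y by exact: le_trans y1.
    have p1 : 1 <= (1 + nrm y) ^+ q3 by exact: exprn_ege1.
    have [hy|hy] := leP (nrm y) r.
      apply: (le_trans (hu y hy)); rewrite -mulrA mulrCA ler_peMr ?(ltW d0) //; lra.
    have g1 : C1 * B1 * (1 + nrm y) ^+ q1 <= C1 * B1 * (1 + nrm y) ^+ (maxn q1 q2).
      by rewrite ler_wpM2l ?mulr_ge0 // ler_weXn2l // leq_maxl.
    have g2 : C2 * (1 + nrm y) ^+ q2 <= C2 * (1 + nrm y) ^+ (maxn q1 q2).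
      by rewrite ler_wpM2l // ler_weXn2l // leq_maxr.
    have g3 : C3 * (1 + nrm y) ^+ (maxn q1 q2) <= d * (1 + nrm y) ^+ q3.
      rewrite /q3 exprS mulrA ler_wpM2r ?exprn_ge0 // (le_trans C3r) // ler_wpM2l ?(ltW d0) //; lra.
    have g4 : 0 <= d * (1 + nrm y) ^+ q3 by rewrite mulr_ge0 ?exprn_ge0 // ltW.
    rewrite (le_trans (ler_normB _ _)) //.
    have := fnb y; have := hF2 y; move: g3; rewrite /C3; lra.
  rewrite distrC; apply: (le_trans (subop_dist _ hJa dd)).
  have := h3 _ ha (fun y => 2 * d * (1 + nrm y) ^+ q3) (2 * d).
  move=> h; apply: (le_trans (ler_norm _)); apply: (le_trans (h _)).
    move=> y; rewrite ger0_norm // mulr_ge0 ?exprn_ge0 ?addr_ge0 ?nrm_ge0 //.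
    exact: (mulr_ge0 (ler0n R 2) (ltW d0)).
  have hd : d * (B3 + 1) = e / 4 by rewrite /d divfK // gt_eqF.
  rewrite (_ : 2 * d * B3 = 2 * (d * (B3 + 1) - d)); last by ring.
  by rewrite hd; lra.
rewrite hce iterD.
have -> : iter a (Jn n) F 0 - iter (a + b) (Jn n) (iter eps (Jn n) f) 0 =
  (iter a (Jn n) F 0 - iter (a + b) (Jn n) f 0) - (iter (a + b) (Jn n) (iter eps (Jn n) f) 0 - iter (a + b) (Jn n) f 0) by ring.
rewrite (le_trans (ler_normB _ _)) //; lra.
Qed.

Lemma gsg_csg : csg (k := k) mu.
Proof.
split.
- exact: gsg_sublin.
- exact: gsg0.
- exact: gsg_add.
- exact: gsg_third.
Qed.

End SemigroupProperty.

(** * G-normal laws *)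

Section Laws.
Variable R : realType.

(** The law of a G-normal vector, as a functional on test functions. *)
Record law k (nu : ('rV[R]_k -> R) -> R) : Prop := Law {
  law_sub : sublin nu ;
  law_stable : forall a b f, 0 <= a -> 0 <= b -> slip f ->
    nu (fun x => nu (fun y => f (a *: x + b *: y))) =
    nu (fun x => f (Num.sqrt (a ^+ 2 + b ^+ 2) *: x)) }.

Lemma scale_linear m n (c : R) : linear (fun x : 'M[R]_(m, n) => c *: x).
Proof. by move=> a x y; rewrite scalerDr !scalerA mulrC. Qed.

Lemma mulmx_linear m n p (P : 'M[R]_(n, p)) : linear (fun x : 'M[R]_(m, n) => x *m P).
Proof. by move=> a x y; rewrite mulmxDl -scalemxAl. Qed.

Lemma slip_lin m n m' n' (f : 'M[R]_(m', n') -> R) (L : 'M[R]_(m, n) -> 'M[R]_(m', n')) :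
  slip f -> linear L -> slip (fun x => f (L x)).
Proof. by move=> hf hL; apply: slip_comp => //; exact: lin_vlip. Qed.

Lemma slip_scale m n c (f : 'M[R]_(m, n) -> R) : slip f -> slip (fun x => f (c *: x)).
Proof. by move=> hf; exact: (slip_lin hf (scale_linear c)). Qed.

Lemma slip2_scale m n a b (f : 'M[R]_(m, n) -> R) : slip f ->
  slip2 (fun x y : 'M[R]_(m, n) => f (a *: x + b *: y)).
Proof. by move=> hf; exact: (slip2_lin hf (scale_linear a) (scale_linear b)). Qed.

Lemma linquadE k (p : 'rV[R]_k) (Q : 'M[R]_k) (x : 'rV[R]_k) :
  linquad p Q x = (x *m p^T) 0 0 + (x *m Q *m x^T) 0 0.
Proof.
rewrite /linquad !mxE; congr (_ + _).
  by apply: eq_bigr => i _; rewrite !mxE mulrC.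
rewrite exchange_big; apply: eq_bigr => j _ /=.
rewrite !mxE mulr_suml; apply: eq_bigr => i _; ring.
Qed.

Lemma linquad_lin k (p x : 'rV[R]_k) : linquad p 0 x = (x *m p^T) 0 0.
Proof. by rewrite linquadE mulmx0 mul0mx [X in _ + X]mxE addr0. Qed.

Lemma linquad_quad k (Q : 'M[R]_k) (x : 'rV[R]_k) : linquad 0 Q x = (x *m Q *m x^T) 0 0.
Proof. by rewrite linquadE trmx0 mulmx0 [X in X + _]mxE add0r. Qed.

Lemma linquad_split k (p : 'rV[R]_k) (Q : 'M[R]_k) x :
  linquad p Q x = linquad p 0 x + linquad 0 Q x.
Proof. by rewrite linquadE linquad_lin linquad_quad. Qed.

Lemma linquad_mulmx k k' (P : 'M[R]_(k, k')) (Q : 'M[R]_k') (x : 'rV[R]_k) :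
  linquad 0 Q (x *m P) = linquad 0 (P *m Q *m P^T) x.
Proof. by rewrite !linquad_quad trmx_mul !mulmxA. Qed.

Lemma linquad_sym k (Q : 'M[R]_k) (x : 'rV[R]_k) :
  linquad 0 (2^-1 *: (Q + Q^T)) x = linquad 0 Q x.
Proof.
rewrite !linquad_quad -scalemxAr -scalemxAl mulmxDr mulmxDl.
have -> : x *m Q^T *m x^T = (x *m Q *m x^T)^T by rewrite !trmx_mul trmxK mulmxA.
move: (x *m Q *m x^T) => q; rewrite !mxE; lra.
Qed.

Section One.
Variables (k : nat) (nu : ('rV[R]_k -> R) -> R).
Hypothesis hnu : law nu.
Let sn := law_sub hnu.

(** Stability with a = sqrt s and b = sqrt t is the semigroup property. *)
Lemma law_csg : csg (fun t f => nu (fun x => f (Num.sqrt t *: x))).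
Proof.
split.
- move=> t t0; apply: (sublin_image sn); apply: lin_vlip; exact: scale_linear.
- move=> f; rewrite (_ : (fun x => _) = (fun=> f 0)) ?(sub_cst sn) //.
  by apply/funext => x; rewrite sqrtr0 scale0r.
- move=> s t f s0 t0 hf; rewrite (law_stable hnu) ?sqrtr_ge0 //.
  by rewrite !sqr_sqrtr.
- exists (nu (fun x => nrm x ^+ 3)); have s3 : slip (fun x : 'rV[R]_k => nrm x ^+ 3).
    by apply: slipX; exact: slip_nrm.
  split; first by apply: (sub_ge0 sn) => // x; rewrite exprn_ge0 // nrm_ge0.
  move=> t t0; rewrite (_ : (fun x => _) = (fun x => (t * Num.sqrt t) * nrm x ^+ 3)).
    by rewrite (sub_hom sn) ?mulr_ge0 ?sqrtr_ge0 // mulrC.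
  apply/funext => x; rewrite nrmZ ger0_norm ?sqrtr_ge0 // exprMn; congr (_ * _).
  by rewrite exprSr sqr_sqrtr.
Qed.

(** By stability with a = b = 1 the value v of a linear form satisfies 2 v =
    sqrt 2 v, so it is 0; linear forms can then be dropped by subadditivity.
    *)
Lemma law_centered (p : 'rV[R]_k) (Q : 'M[R]_k) : nu (linquad p Q) = nu (linquad 0 Q).
Proof.
have hl (p' : 'rV[R]_k) : nu (linquad p' 0) = 0.
  have sl := linquad_slip p' (0 : 'M[R]_k).
  have e := linquad_lin p'.
  have := law_stable hnu ler01 ler01 sl.
  have -> : (fun x => nu (fun y => linquad p' 0 (1 *: x + 1 *: y))) =
            (fun x => linquad p' 0 x + nu (linquad p' 0)).
    apply/funext => x; rewrite addrC -(sub_addc sn) //; congr nu; apply/funext => y.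
    by rewrite !e !scale1r mulmxDl mxE addrC.
  rewrite (sub_addc sn) //.
  have -> : (fun x => linquad p' 0 (Num.sqrt (1 ^+ 2 + 1 ^+ 2) *: x)) =
     (fun x => Num.sqrt (1 ^+ 2 + 1 ^+ 2) * linquad p' 0 x).
    by apply/funext => x; rewrite !e -scalemxAl mxE.
  rewrite (sub_hom sn) ?sqrtr_ge0 // expr1n.
  set s := Num.sqrt _; set v := nu _ => h.
  have s2 : s ^+ 2 = 2 by rewrite sqr_sqrtr //; ring.
  have : v * (2 - s) = 0 by lra.
  move/eqP; rewrite mulf_eq0 => /orP[/eqP//|/eqP h2].
  by have : s = 2; [lra|move=> s2'; move: s2; rewrite s2'; lra].
have sQ := linquad_slip (0 : 'rV[R]_k) Q.
have split q : linquad q Q = (fun x => linquad q 0 x + linquad 0 Q x).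
  by apply/funext => x; exact: linquad_split.
apply/eqP; rewrite eq_le; apply/andP; split.
  rewrite split; apply: (le_trans (sub_add sn _ _)) => //; first exact: linquad_slip.
  by rewrite hl add0r.
have := sub_add sn (linquad_slip (- p) 0) (linquad_slip p Q); rewrite hl add0r.
rewrite (_ : (fun x => _) = linquad 0 Q) //.
apply/funext => x; rewrite (linquad_split p) addrA !linquad_lin linearN /= mulmxN.
by rewrite [X in X + _ + _]mxE addNr add0r.
Qed.

Lemma law_mx k' (P : 'M[R]_(k, k')) : law (fun f => nu (fun x => f (x *m P))).
Proof.
split; first by apply: (sublin_image sn); apply: lin_vlip; exact: mulmx_linear.
move=> a b f a0 b0 hf.
have sf := slip_lin hf (@mulmx_linear 1 _ _ P).
have := law_stable hnu a0 b0 sf.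
under eq_fun do under eq_fun do rewrite mulmxDl -!scalemxAl.
by move=> ->; congr nu; apply/funext => x; rewrite -scalemxAl.
Qed.

End One.

(** The law is the time 1 functional of the semigroup of [law_csg]. Linear
    parts have no influence by [law_centered], and a quadratic form is that of
    its symmetric part. *)
Theorem law_unique k (nu nu' : ('rV[R]_k -> R) -> R) : law nu -> law nu' ->
  (forall Q : 'M[R]_k, Q^T = Q -> nu (linquad 0 Q) = nu' (linquad 0 Q)) ->
  forall f, slip f -> nu f = nu' f.
Proof.
move=> h h' agree f sf.
have := @csg_unique _ _ _ _ (law_csg h) (law_csg h') _ 1 f ler01 sf.
rewrite sqrtr1 (_ : (fun x => f (1 *: x)) = f); last by apply/funext => x; rewrite scale1r.
apply=> t p Q t0.
rewrite (_ : (fun x => _) = linquad (Num.sqrt t *: p) (Num.sqrt t ^+ 2 *: Q)); last first.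
  by apply/funext => x; rewrite linquad_scale.
rewrite !law_centered //; set Q' := _ *: Q.
rewrite (_ : linquad 0 Q' = linquad 0 (2^-1 *: (Q' + Q'^T))); last first.
  by apply/funext => x; rewrite linquad_sym.
by apply: agree; rewrite linearZ /= linearD /= trmxK addrC.
Qed.

Section Standard.
Variables (lo up : R).
Hypothesis lo0 : 0 <= lo.
Hypothesis loup : lo <= up.

Lemma csg_scale k (mu : R -> ('rV[R]_k -> R) -> R) c : csg mu -> 0 < c ->
  csg (fun t f => mu (t / c ^+ 2) (fun x => f (c *: x))).
Proof.
move=> hmu c0; have c2 : 0 < c ^+ 2 by rewrite exprn_gt0.
have tc t : 0 <= t -> 0 <= t / c ^+ 2 by move=> t0; rewrite divr_ge0 // ltW.
split.
- move=> t /tc t0; apply: (sublin_image (csg_sub hmu t0)); apply: lin_vlip; exact: scale_linear.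
- by move=> f; rewrite mul0r csg_0 // scaler0.
- move=> s t f /tc s0 /tc t0 hf; rewrite mulrDl -(csg_add hmu) //; last exact: slip_scale.
  by congr (mu _); apply/funext => x; congr (mu _); apply/funext => y; rewrite scalerDr.
- have [M [M0 hM]] := csg_third hmu; exists M; split=> // t t0.
  have s3 : slip (fun x : 'rV[R]_k => nrm x ^+ 3) by apply: slipX; exact: slip_nrm.
  rewrite (_ : (fun x => _) = (fun x => c ^+ 3 * nrm x ^+ 3)); last first.
    by apply/funext => x; rewrite nrmZ ger0_norm ?(ltW c0) // exprMn.
  have c3 : 0 <= c ^+ 3 by rewrite exprn_ge0 // ltW.
  rewrite (sub_hom (csg_sub hmu (tc _ t0))) //.
  apply: (le_trans (ler_wpM2l c3 (hM _ (tc _ t0)))).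
  rewrite sqrtrM // sqrtrV ?(ltW c2) // sqrtr_sqr ger0_norm ?(ltW c0) //.
  by rewrite le_eqVlt; apply/orP; left; apply/eqP; field; rewrite gt_eqF.
Qed.

(** The rescaling of the limit semigroup has the same values on quadratic
    polynomials, so it is the same semigroup; that is the self-similarity
    which stability expresses. *)
Lemma std_law_pos k : exists nu : ('rV[R]_k.+1 -> R) -> R, law nu /\
  forall Q, nu (linquad 0 Q) = Num.max (lo * \tr Q) (up * \tr Q).
Proof.
have [U [UU hU]] := ultraFilterLemma (@eventually_filter).
have k0 : (0 < k.+1)%N by [].
have hg := gsg_csg k0 lo0 loup UU hU.
have gl := @gsg_linquad R k.+1 lo up U k0 lo0 loup UU hU.
pose mu := @gsg R k.+1 lo up U; rewrite -/mu in hg.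
have s1 := csg_sub hg ler01.
have scale c f : 0 <= c -> slip f -> mu 1 (fun x => f (c *: x)) = mu (c ^+ 2) f.
  rewrite le_eqVlt => /orP[/eqP<-|c0] sf.
    rewrite expr0n csg_0 // (_ : (fun x => _) = (fun=> f 0)) ?(sub_cst s1) //.
    by apply/funext => x; rewrite scale0r.
  have c2 : c ^+ 2 != 0 by rewrite expf_eq0 /= gt_eqF.
  have := @csg_unique _ _ _ _ (csg_scale hg c0) hg _ (c ^+ 2) f (sqr_ge0 _) sf.
  rewrite divff //; apply=> t p Q t0.
  rewrite (_ : (fun x => _) = linquad (c *: p) (c ^+ 2 *: Q)); last first.
    by apply/funext => x; rewrite linquad_scale.
  rewrite /mu !gl //; last by rewrite divr_ge0 // sqr_ge0.
  rewrite mxtraceZ (mulrCA lo) (mulrCA up) -maxr_pMr ?sqr_ge0 // mulrA divfK //.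
exists (mu 1); split; last by move=> Q; rewrite /mu gl // mul1r.
split=> // a b f a0 b0 sf.
have a2 := sqr_ge0 a; have b2 := sqr_ge0 b.
rewrite scale ?sqrtr_ge0 // sqr_sqrtr ?addr_ge0 // -(csg_add hg) //.
have sh : slip (fun z => mu (b ^+ 2) (fun y => f (z + y))).
  by apply: (slip_param (csg_sub hg b2)); exact: slip2_add.
rewrite -(scale a) //; congr (mu 1); apply/funext => x.
rewrite -(scale b) //; exact: slip2_sec (slip2_add sf).
Qed.

(** The walks need at least one axis. A law in dimension k is obtained as the
    image of one in dimension k + 1, which also covers k = 0. *)
Lemma std_law k : exists nu : ('rV[R]_k -> R) -> R, law nu /\
  forall Q, nu (linquad 0 Q) = Num.max (lo * \tr Q) (up * \tr Q).
Proof.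
have [nu [hnu hQ]] := std_law_pos k.
exists (fun f => nu (fun x => f (x *m pid_mx k))); split; first exact: law_mx.
move=> Q; rewrite (_ : (fun x => _) = linquad 0 (pid_mx k *m Q *m (pid_mx k)^T)).
  rewrite hQ; set P := (pid_mx k : 'M[R]_(k.+1, k)).
  have -> : \tr (P *m Q *m P^T) = \tr Q; last by [].
  rewrite -mulmxA mxtrace_mulC -mulmxA /P tr_pid_mx mul_pid_mx !minnn (minn_idPr (leqnSn k)).
  by rewrite pid_mx_1 mulmx1.
by apply/funext => x; rewrite linquad_mulmx.
Qed.

Lemma max_Gfun q : Num.max (lo * q) (up * q) = 2 * Gfun lo up q.
Proof.
rewrite /Gfun; have /orP[q0|q0] := le_total 0 q.
  have q1 : - q <= 0 by rewrite oppr_le0.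
  rewrite (max_l q0) (max_r q1) max_r; last exact: (ler_wpM2r q0 loup).
  by field.
have q1 : 0 <= - q by rewrite oppr_ge0.
rewrite (max_r q0) (max_l q1) max_l; last exact: (ler_wnM2r q0 loup).
by field.
Qed.

End Standard.

End Laws.

(** * Iterated expectations *)

Section Iterated.
Variable R : realType.

Definition upd N m (M : 'M[R]_(N, m)) (j : nat) (y : 'rV[R]_m) : 'M[R]_(N, m) :=
  \matrix_(i, l) if i == j :> nat then y 0 l else M i l.

(** Rows 0, ..., n.-1 are integrated out one after the other, the last one
    first; the remaining rows are set to zero. *)
Fixpoint En N m (nu : ('rV[R]_m -> R) -> R) (n : nat) (F : 'M[R]_(N, m) -> R) : R :=
  if n is j.+1 then En nu j (fun M => nu (fun y => F (upd M j y))) else F 0.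

Definition merge N m (a : nat) (M M' : 'M[R]_(N, m)) : 'M[R]_(N, m) :=
  \matrix_(i, l) if (i < a)%N then M i l else M' i l.

Lemma updE N m (M : 'M[R]_(N, m)) j y : upd M j y = upd M j 0 + upd 0 j y.
Proof.
by apply/matrixP => i l; rewrite !mxE; case: ifP => _; rewrite ?mxE ?add0r ?addr0.
Qed.

Lemma upd_linl N m j : linear (fun M : 'M[R]_(N, m) => upd M j 0).
Proof.
by move=> a x y; apply/matrixP => i l; rewrite !mxE; case: ifP => // _; rewrite mulr0 addr0.
Qed.

Lemma upd_linr N m j : linear (fun y : 'rV[R]_m => upd (0 : 'M[R]_(N, m)) j y).
Proof.
by move=> a x y; apply/matrixP => i l; rewrite !mxE; case: ifP => // _; rewrite mulr0 addr0.
Qed.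

Lemma slip2_upd N m j (F : 'M[R]_(N, m) -> R) : slip F -> slip2 (fun M y => F (upd M j y)).
Proof.
move=> hF; rewrite (_ : (fun M y => _) = (fun M y => F (upd M j 0 + upd 0 j y))).
  by apply: slip2_lin => //; [exact: upd_linl|exact: upd_linr].
by apply/funext => M; apply/funext => y; rewrite updE.
Qed.

Section OneLaw.
Variables (m : nat) (nu : ('rV[R]_m -> R) -> R).

Section Basic.
Hypothesis sn : sublin nu.

Lemma slip_step N j (F : 'M[R]_(N, m) -> R) : slip F ->
  slip (fun M => nu (fun y => F (upd M j y))).
Proof. by move=> hF; apply: (slip_param sn); exact: slip2_upd. Qed.

Lemma En_sublin N n : sublin (@En N m nu n).
Proof.
elim: n => [|n ih].
  by split=> //= f g _ _ h; rewrite h.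
have s1 F M : slip F -> slip (fun y : 'rV[R]_m => F (upd (M : 'M[R]_(N, m)) n y)).
  by move=> hF; exact: slip2_sec (slip2_upd n hF).
split=> /=.
- move=> F G hF hG h; apply: (sub_mono ih); try exact: slip_step.
  by move=> M; apply: (sub_mono sn) => //; exact: s1.
- move=> c; rewrite (_ : (fun M => _) = (fun=> c)) ?(sub_cst ih) //.
  by apply/funext => M; rewrite (sub_cst sn).
- move=> F G hF hG; have h1 := slip_step n hF; have h2 := slip_step n hG.
  apply: (le_trans _ (sub_add ih h1 h2)); apply: (sub_mono ih).
  + exact: (slip_step n (slipD hF hG)).
  + exact: slipD h1 h2.
  + by move=> M; apply: (sub_add sn); exact: s1.
- move=> c F c0 hF; rewrite -(sub_hom ih) //; last exact: slip_step.
  by congr En; apply/funext => M; rewrite (sub_hom sn) //; exact: s1.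
Qed.

Lemma En_cst N n c : En nu n (fun _ : 'M[R]_(N, m) => c) = c.
Proof. exact: (sub_cst (En_sublin N n)). Qed.

Lemma En_stop N b n (F : 'M[R]_(N, m) -> R) : (b <= n)%N ->
  (forall M j y, (b <= j)%N -> F (upd M j y) = F M) -> En nu n F = En nu b F.
Proof.
elim: n F => [|n ih] F; first by rewrite leqn0 => /eqP->.
rewrite leq_eqVlt => /orP[/eqP->//|bn] hF /=; rewrite -ih //; congr En.
apply/funext => M; under eq_fun do rewrite hF //.
exact: (sub_cst sn).
Qed.

Lemma En_inv N n (F : 'M[R]_(N, m) -> R) :
  (forall M j y, (j < n)%N -> F (upd M j y) = F M) -> En nu n F = F 0.
Proof.
elim: n F => [//|n ih] F hF /=; rewrite ih; last first.
  move=> M j y jn; congr nu; apply/funext => z; rewrite hF // hF ?(ltnW jn) //; first by rewrite hF.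
  exact: ltn_trans jn _.
by under eq_fun do rewrite hF //; exact: (sub_cst sn).
Qed.

(** Rows before a are read from the first copy, the others from the second;
    integrating a row that is not read leaves the value unchanged. *)
Lemma En_merge N a n (F : 'M[R]_(N, m) -> R) :
  En nu n F = En nu n (fun M => En nu n (fun M' => F (merge a M M'))).
Proof.
elim: n F => [|n ih] F /=; first by congr F; apply/matrixP => i l; rewrite !mxE if_same.
rewrite ih; have [na|an] := ltnP n a.
- congr En; apply/funext => M.
  have e (M' : 'M[R]_(N, m)) y : upd (merge a M M') n y = merge a (upd M n y) M'.
    apply/matrixP => i l; rewrite !mxE; case: (ltnP i a) => // ia.
    by case: eqP => // ei; move: ia; rewrite ei leqNgt na.
  have mi (X M' : 'M[R]_(N, m)) j y : (j < a)%N -> merge a X (upd M' j y) = merge a X M'.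
    move=> ja; apply/matrixP => i l; rewrite !mxE; case: (ltnP i a) => // ia.
    by case: eqP => // ei; move: ia; rewrite ei leqNgt ja.
  rewrite En_inv; last first.
    by move=> M' j y jn; congr nu; apply/funext => z; rewrite !e mi // (ltn_trans jn).
  congr nu; apply/funext => x; rewrite e.
  rewrite (_ : (fun M0 => _) = (fun M' => F (merge a (upd M n x) M'))); last first.
    apply/funext => M'; under eq_fun do rewrite mi //.
    exact: (sub_cst sn).
  by rewrite En_inv // => M' j y jn; rewrite mi // (ltn_trans jn).
- congr En; apply/funext => M.
  rewrite -[LHS](sub_cst sn); congr nu; apply/funext => x; congr En; apply/funext => M'.
  congr nu; apply/funext => y; congr F; apply/matrixP => i l; rewrite !mxE.
  case: (ltnP i a) => ia; last by [].
  by case: eqP => // ei; move: ia; rewrite ei ltnNge an.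
Qed.

Lemma En_indep N p q a (X : 'M[R]_(N, m) -> 'rV[R]_p) (Y : 'M[R]_(N, m) -> 'rV[R]_q) :
  (forall M M', X (merge a M M') = X M) -> (forall M M', Y (merge a M M') = Y M') ->
  independent_from (En nu N) Y X.
Proof.
move=> hX hY phi _; rewrite (En_merge a); congr En; apply/funext => M; congr En.
by apply/funext => M'; rewrite hX hY.
Qed.

End Basic.

Lemma En_eq (nu' : ('rV[R]_m -> R) -> R) N n (F : 'M[R]_(N, m) -> R) :
  sublin nu -> (forall f, slip f -> nu f = nu' f) -> slip F -> En nu n F = En nu' n F.
Proof.
move=> sn h; elim: n F => [//|n ih] F hF /=; rewrite ih; last exact: slip_step.
congr En; apply/funext => M; apply: h; exact: slip2_sec (slip2_upd n hF).
Qed.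

Lemma En_mulmx k (P : 'M[R]_(m, k)) N n (F : 'M[R]_(N, k) -> R) :
  En (fun f => nu (fun x => f (x *m P))) n F = En nu n (fun M => F (M *m P)).
Proof.
elim: n F => [|n ih] F /=; first by rewrite mul0mx.
rewrite ih; congr En; apply/funext => M; congr nu; apply/funext => y; congr F.
apply/matrixP => i l; rewrite !mxE; case: ifP => ij.
  by apply: eq_bigr => a _; rewrite !mxE ij.
by apply: eq_bigr => a _; rewrite !mxE ij.
Qed.

Section Blocks.
Hypothesis hnu : law nu.
Let sn := law_sub hnu.
Variables (N n : nat) (c : nat -> R) (g : nat -> nat).
Hypothesis c0 : forall i, 0 <= c i.
Hypothesis gmono : forall i j, (i <= j)%N -> (g i <= g j)%N.

Let Sb j (M : 'M[R]_(N, m)) : 'M[R]_(n, m) := \matrix_(i, l)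
  \sum_(a < N) (if (a < j)%N && (g a == i) then c a * M a l else 0).
Let Cb j (i : nat) : R := \sum_(a < N) (if (a < j)%N && (g a == i) then c a ^+ 2 else 0).
Let Rb j (M : 'M[R]_(n, m)) : 'M[R]_(n, m) := \matrix_(i, l) (Num.sqrt (Cb j i) * M i l).

Lemma Cb_ge0 j i : 0 <= Cb j i.
Proof. by apply: sumr_ge0 => a _; case: ifP => // _; exact: sqr_ge0. Qed.

Lemma CbS j i : (j < N)%N -> Cb j.+1 i = Cb j i + (if g j == i then c j ^+ 2 else 0).
Proof.
move=> jN; pose oj := Ordinal jN; rewrite /Cb (bigD1 oj) //= ltnSn andTb addrC.
congr (_ + _); rewrite [RHS](bigD1 oj) //= ltnn add0r.
by apply: eq_bigr => a aj; rewrite ltnS leq_eqVlt (negbTE (aj : (a : nat) != j)).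
Qed.

Lemma Sb_upd j M y : (j < N)%N -> Sb j.+1 (upd M j y) = Sb j M + upd 0 (g j) (c j *: y).
Proof.
move=> jN; pose oj := Ordinal jN; apply/matrixP => i l; rewrite !mxE.
rewrite (bigD1 oj) //= ltnSn andTb addrC [in RHS](bigD1 oj) //= ltnn add0r.
congr (_ + _).
  apply: eq_bigr => a aj; rewrite ltnS leq_eqVlt (negbTE (aj : (a : nat) != j)) /=.
  by rewrite mxE (negbTE (aj : (a : nat) != j)).
by rewrite [i == _ :> nat]eq_sym; case: eqP => _; rewrite ?mxE ?eqxx.
Qed.

(** The rows are added one at a time. The last row joins the block b = g j,
    which is the last nonempty one because g is monotone, so it can be
    combined by stability with the row b of the merged matrix before any other
    row is integrated. *)
Lemma En_blocks_rec j F : (j <= N)%N -> slip F ->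
  En nu j (fun M => F (Sb j M)) = En nu n (fun M => F (Rb j M)).
Proof.
elim: j F => [|j ih] F jN sF.
  have z1 : Sb 0 0 = 0 by apply/matrixP => i l; rewrite !mxE big1.
  have z2 : (fun M => F (Rb 0 M)) = (fun=> F 0).
    apply/funext => M; congr F; apply/matrixP => i l; rewrite !mxE.
    by rewrite (_ : Cb 0 i = 0) ?sqrtr0 ?mul0r //; exact: big1.
  by rewrite /= z1 z2 En_cst.
set b := g j; pose F' (u : 'M[R]_(n, m)) := nu (fun y => F (u + upd 0 b (c j *: y))).
have lin2 : linear (fun y : 'rV[R]_m => upd (0 : 'M[R]_(n, m)) b (c j *: y)).
  by move=> a x y; rewrite -upd_linr; congr upd; rewrite scalerDr !scalerA mulrC.
have lin1 : linear (id : 'M[R]_(n, m) -> 'M[R]_(n, m)) by [].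
have sF' : slip F'.
  exact: (slip_param sn (slip2_lin sF lin1 lin2)).
transitivity (En nu j (fun M => F' (Sb j M))).
  rewrite /=; congr En; apply/funext => M; rewrite /F'; congr nu; apply/funext => y.
  by rewrite Sb_upd.
rewrite ih ?(ltnW jN) //.
have [nb|bn] := leqP n b.
  congr En; apply/funext => M; rewrite /F'.
  have u0 (y : 'rV[R]_m) : upd (0 : 'M[R]_(n, m)) b y = 0.
    apply/matrixP => i l; rewrite !mxE; case: eqP => // ib.
    by have := ltn_ord i; rewrite ib ltnNge nb.
  under eq_fun do rewrite u0 addr0.
  rewrite (sub_cst sn); congr F; apply/matrixP => i l; rewrite !mxE CbS // -/b.
  by case: eqP => [bi|_]; rewrite ?addr0 //; have := ltn_ord i; rewrite -bi ltnNge nb.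
have cb0 i : (b < i)%N -> Cb j i = 0.
  move=> bi; apply: big1 => a _; case: ifP => // /andP[aj /eqP ga].
  by have := gmono (ltnW aj); rewrite ga leqNgt bi.
have rinv i M y : (b < i)%N -> Rb j (upd M i y) = Rb j M.
  move=> bi; apply/matrixP => i' l; rewrite !mxE; case: eqP => // ei.
  by rewrite ei cb0 // sqrtr0 !mul0r.
have rinv' i M y : (b < i)%N -> Rb j.+1 (upd M i y) = Rb j.+1 M.
  move=> bi; apply/matrixP => i' l; rewrite !mxE; case: eqP => // ei.
  by rewrite ei CbS // cb0 // -/b (ltn_eqF bi) addr0 sqrtr0 !mul0r.
rewrite (En_stop sn bn); last by move=> M i y bi; rewrite rinv.
rewrite [RHS](En_stop sn bn) /=; last by move=> M i y bi; rewrite rinv'.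
congr En; apply/funext => M.
(* Only the row b is still to be integrated, twice: once for the block and
   once for the new row. *)
pose psi v := F (Rb j (upd M b 0) + upd 0 b v).
have spsi : slip psi.
  exact: (slip2_sec (Rb j (upd M b 0)) (slip2_lin sF lin1 (@upd_linr n m b))).
transitivity (nu (fun x => nu (fun y => psi (Num.sqrt (Cb j b) *: x + c j *: y)))).
  congr nu; apply/funext => x; congr nu; apply/funext => y; congr F.
  apply/matrixP => i l; rewrite !mxE; case: eqP => [->|_]; rewrite ?mxE; ring.
rewrite (law_stable hnu) ?sqrtr_ge0 //; congr nu; apply/funext => x; congr F.
rewrite sqr_sqrtr ?Cb_ge0 //.
apply/matrixP => i l; rewrite !mxE CbS // -/b [b == i]eq_sym.
by case: eqP => [->|_]; rewrite ?mxE ?addr0 ?mulr0 ?add0r.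
Qed.

(** Consecutive rows merged into blocks: by stability the weighted sum of a
    block has the law of one row times the Euclidean norm of the weights. *)
Lemma En_blocks F : slip F ->
  En nu N (fun M => F (\matrix_(i < n, l < m) \sum_(a < N | g a == i) c a * M a l)) =
  En nu n (fun M => F (\matrix_(i < n, l < m)
     (Num.sqrt (\sum_(a < N | g a == i) c a ^+ 2) * M i l))).
Proof.
move=> sF; have := En_blocks_rec (leqnn N) sF.
have -> : (fun M => F (Sb N M)) =
   (fun M => F (\matrix_(i < n, l < m) \sum_(a < N | g a == i) c a * M a l)).
  apply/funext => M; congr F; apply/matrixP => i l; rewrite !mxE [RHS]big_mkcond.
  by apply: eq_bigr => a _; rewrite ltn_ord.
move=> ->; congr En; apply/funext => M; congr F; apply/matrixP => i l; rewrite !mxE.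
congr (Num.sqrt _ * _); rewrite /Cb [RHS]big_mkcond.
by apply: eq_bigr => a _; rewrite ltn_ord.
Qed.

End Blocks.
End OneLaw.
End Iterated.

(** * Sequences of independent G-normal vectors *)

Section Models.
Variable R : realType.

(** The sum of X' and of its independent copy is an iterated expectation under
    the law of X; the auxiliary space disappears. *)
Lemma Gnormal_law (T : Type) (H : set (T -> R)) (E : (T -> R) -> R) k (X : T -> 'rV[R]_k) :
  sublinear_expectation_space H E -> G_normal H E X ->
  law (fun f => E (fun w => f (X w))).
Proof.
move=> hE [rX [T' [H' [E' [X' [Xb [hE' [rX' rXb] dX [dXb iXb] hab]]]]]]].
have inH f : slip f -> H (fun w => f (X w)).
  by move=> /slipP hf; exact: (sle_comp hE rX hf).
have sn : sublin (fun f => E (fun w => f (X w))).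
  split.
  - by move=> f g hf hg h; apply: (sle_monotone hE); [exact: inH|exact: inH|move=> w; exact: h].
  - by move=> c; rewrite (sle_const hE).
  - by move=> f g hf hg; apply: (sle_subadditive hE); exact: inH.
  - by move=> c f c0 hf; rewrite (sle_pos_homogeneous hE) //; exact: inH.
split=> // a b f a0 b0 sf.
have := hab a b a0 b0 f (proj2 (slipP f) sf); rewrite [in RHS]/= => <-.
pose phi (v : 'rV[R]_(k + k)) := f (a *: lsubmx v + b *: rsubmx v).
have sphi : C_lLip phi.
  apply/slipP; apply: (slip_lin (L := fun v => a *: lsubmx v + b *: rsubmx v) sf).
  by move=> c u v; apply/rowP => i; rewrite !mxE; ring.
have := iXb phi sphi.
under eq_fun do rewrite /phi row_mxKl row_mxKr.
move=> ->.
have s2 : slip (fun x => E (fun w' => f (a *: x + b *: X w'))).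
  exact: (slip_param sn (slip2_scale a b sf)).
rewrite -(dX _ (proj2 (slipP _) s2)).
congr E'; apply/funext => w.
have s1 : slip (fun y => f (a *: X' w + b *: y)) by exact: slip2_sec (slip2_scale a b sf).
have c1 := proj2 (slipP _) s1.
rewrite -(dX _ c1) -(dXb _ c1); congr E'; apply/funext => w'.
by rewrite /phi row_mxKl row_mxKr.
Qed.

(** Total in the row number, to match sequences indexed by all integers. *)
Definition rowof N m (i : nat) (M : 'M[R]_(N, m)) : 'rV[R]_m :=
  \row_l (if insub i is Some k then M k l else 0).

Lemma rowof_upd N m i (M : 'M[R]_(N, m)) y : (i < N)%N -> rowof i (upd M i y) = y.
Proof.
move=> iN; by apply/rowP => l; rewrite mxE insubT mxE /= eqxx.
Qed.

Lemma rowof_upd_neq N m i j (M : 'M[R]_(N, m)) y : i != j -> rowof i (upd M j y) = rowof i M.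
Proof.
move=> ij; apply/rowP => l; rewrite !mxE; case: insubP => // k _ ki.
by rewrite mxE ki (negbTE ij).
Qed.

Lemma rowof_slip N m i l : slip (fun M : 'M[R]_(N, m) => rowof i M 0 l).
Proof.
rewrite (_ : (fun M => _) = (fun M : 'M[R]_(N, m) => if (insub i : option 'I_N) is Some k then M k l else 0)).
  by case: insubP => [k _ _|_]; [exact: slip_coord|exact: slip_cst].
by apply/funext => M; rewrite mxE.
Qed.

Lemma slip_of_coord m n k (f : 'rV[R]_k -> R) (X : 'M[R]_(m, n) -> 'rV[R]_k) :
  slip f -> (forall i, slip (fun M => X M 0 i)) -> slip (fun M => f (X M)).
Proof.
move=> sf hX; apply: (slip_comp sf); apply: vlipP => i j.
by rewrite (ord1 i); exact: hX.
Qed.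

Lemma rowof_comp N m i (f : 'rV[R]_m -> R) : slip f -> slip (fun M : 'M[R]_(N, m) => f (rowof i M)).
Proof. by move=> sf; apply: slip_of_coord => // l; exact: rowof_slip. Qed.

Section Model.
Variables (m : nat) (nu : ('rV[R]_m -> R) -> R).
Hypothesis hnu : law nu.
Let sn := law_sub hnu.

Lemma En_space N : sublinear_expectation_space (@slip R N m) (En nu N).
Proof.
have hE := En_sublin sn N N; split.
- exact: slip_cst.
- by move=> c X Y hX hY; apply: slipD => //; exact: slipZ.
- by move=> n X phi hX /slipP hphi; exact: slip_of_coord.
- by move=> X Y hX hY h; apply: (sub_mono hE).
- exact: (sub_cst hE).
- exact: (sub_add hE).
- exact: (sub_hom hE).
Qed.

Lemma En_row N i (f : 'rV[R]_m -> R) : (i < N)%N ->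
  En nu N (fun M : 'M[R]_(N, m) => f (rowof i M)) = nu f.
Proof.
move=> iN; rewrite (En_stop sn iN) /=; last first.
  by move=> M j y ij; rewrite rowof_upd_neq // ltn_eqF.
rewrite (_ : (fun M => _) = (fun=> nu f)) ?En_cst //.
by apply/funext => M; congr nu; apply/funext => y; rewrite rowof_upd.
Qed.

Lemma rowof_merge_l N i a (M M' : 'M[R]_(N, m)) : (i < a)%N -> rowof i (merge a M M') = rowof i M.
Proof.
by move=> ia; apply/rowP => l; rewrite !mxE; case: insubP => // k _ ki; rewrite mxE ki ia.
Qed.

Lemma rowof_merge_r N i a (M M' : 'M[R]_(N, m)) : (a <= i)%N -> rowof i (merge a M M') = rowof i M'.
Proof.
move=> ia; apply/rowP => l; rewrite !mxE; case: insubP => // k _ ki; rewrite mxE ki.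
by rewrite ltnNge ia.
Qed.

(** The independent copy lives on the space of two-row matrices with iterated
    expectation. *)
Lemma Gnormal_of_law (T : Type) (H : set (T -> R)) (E : (T -> R) -> R) (X : T -> 'rV[R]_m) :
  random_vector H X -> (forall f, slip f -> E (fun w => f (X w)) = nu f) -> G_normal H E X.
Proof.
move=> rX hX; split=> //.
exists 'M[R]_(2, m), (@slip R 2 m), (En nu 2), (rowof 0), (rowof 1); split.
- exact: En_space.
- by split=> i; exact: rowof_slip.
- by move=> f /slipP sf; rewrite En_row // hX.
- split; first by move=> f _; rewrite !En_row.
  by apply: (En_indep sn (a := 1)) => M M'; [exact: rowof_merge_l|exact: rowof_merge_r].
- move=> a b a0 b0 f /slipP sf.
  rewrite (hX _ (slip_scale _ sf)) -(law_stable hnu) //.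
  have i1 : independent_from (En nu 2) (rowof 1 (N := 2) (m := m)) (rowof 0).
    by apply: (En_indep sn (a := 1)) => M M'; [exact: rowof_merge_l|exact: rowof_merge_r].
  pose phi (v : 'rV[R]_(m + m)) := f (a *: lsubmx v + b *: rsubmx v).
  have sphi : C_lLip phi.
    apply/slipP; apply: (slip_lin (L := fun v => a *: lsubmx v + b *: rsubmx v) sf).
    by move=> c u v; apply/rowP => i; rewrite !mxE; ring.
  have := i1 phi sphi.
  under eq_fun do rewrite /phi row_mxKl row_mxKr.
  move=> ->.
  rewrite -(En_row (N := 2) (i := 0)) //; congr En; apply/funext => M.
  under eq_fun do rewrite /phi row_mxKl row_mxKr.
  exact: (En_row (N := 2) (i := 1) (fun y => f (a *: rowof 0 M + b *: y))).
Qed.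

Lemma model_sequence d N (A : 'I_m -> B0 R d) (lo up : R) :
  (forall Q : 'M[R]_m, nu (linquad 0 Q) = 2 * Gfun lo up (\sum_(j < m) Q j j * lambda (A j))) ->
  normal_sequence N lo up A (@slip R N m) (En nu N) (@rowof N m).
Proof.
move=> hQ; split.
- exact: En_space.
- move=> i iN; apply: Gnormal_of_law; first by move=> l; exact: rowof_slip.
  by move=> f sf; rewrite En_row.
- move=> i /andP[i0 iN]; apply: (En_indep sn (a := i)) => M M'.
    congr mxvec; apply/matrixP => k l; rewrite !mxE.
    by have := rowof_merge_l M M' (ltn_ord k); move/rowP/(_ l); rewrite !mxE.
  exact: rowof_merge_r.
- move=> i Q iN _; rewrite (_ : (fun w => _) = (fun w => linquad 0 Q (rowof i w))).
    by rewrite En_row // hQ mulrA mulVf ?mul1r // pnatr_eq0.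
  by apply/funext => w; rewrite linquad_quad.
Qed.

(** By induction on the number of vectors: independence allows the last one to be
    integrated first, with the others frozen. *)
Lemma sequence_law n (T : Type) (H : set (T -> R)) (E : (T -> R) -> R) (xi : nat -> T -> 'rV[R]_m) :
  (forall c, E (fun=> c) = c) ->
  (forall i f, (i < n)%N -> slip f -> E (fun w => f (xi i w)) = nu f) ->
  (forall i, (0 < i < n)%N -> independent_from E (xi i)
          (fun w => mxvec (\matrix_(k < i, j < m) xi k w 0 j))) ->
  forall F : 'M[R]_(n, m) -> R, slip F ->
  E (fun w => F (\matrix_(k < n, j < m) xi k w 0 j)) = En nu n F.
Proof.
move=> hc hl hi.
pose tr i w : 'M[R]_(n, m) := \matrix_(k, l) (if (k < i)%N then xi k w 0 l else 0).
have tr0 w : tr 0 w = 0 by apply/matrixP => k l; rewrite !mxE.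
have trS i w : tr i.+1 w = upd (tr i w) i (xi i w).
  apply/matrixP => k l; rewrite !mxE ltnS leq_eqVlt; case: eqP => [->|_] //=.
have main i F : (i <= n)%N -> slip F -> E (fun w => F (tr i w)) = En nu i F.
  elim: i F => [|i ih] F iN sF.
    by under eq_fun do rewrite tr0; rewrite hc.
  have sF' := slip_step sn i sF.
  rewrite /= -ih ?(ltnW iN) //.
  rewrite (_ : (fun w => F (tr i.+1 w)) = (fun w => F (upd (tr i w) i (xi i w)))); last first.
    by apply/funext => w; rewrite trS.
  have [i0|i0] := posnP i.
    subst i; rewrite (_ : tr 0%N = (fun=> 0)); last exact/funext.
    rewrite hc; apply: (hl 0%N (fun y => F (upd 0 0 y))) => //.
    exact: slip2_sec (slip2_upd 0 sF).
  pose ex (M : 'M[R]_(i, m)) : 'M[R]_(n, m) :=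
    \matrix_(k, l) (if insub (k : nat) is Some k' then M k' l else 0).
  have exl : linear ex.
    move=> a x y; apply/matrixP => k l; rewrite !mxE; case: insubP => [k' _ _|_].
      by rewrite !mxE.
    by rewrite mulr0 addr0.
  have exE w : ex (\matrix_(k < i, j < m) xi k w 0 j) = tr i w.
    apply/matrixP => k l; rewrite !mxE; case: insubP => [k' ki kE|/negbTE->//].
    by rewrite mxE kE ki.
  pose phi (v : 'rV[R]_(i * m + m)) := F (upd (ex (vec_mx (lsubmx v))) i (rsubmx v)).
  have sphi : C_lLip phi.
    apply/slipP.
    pose L (v : 'rV[R]_(i * m + m)) := upd (ex (vec_mx (lsubmx v))) i (rsubmx v).
    apply: (slip_lin (L := L) sF) => a u v; rewrite /L updE [upd (ex (vec_mx (lsubmx u))) _ _]updE [upd (ex (vec_mx (lsubmx v))) _ _]updE.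
    rewrite !linearD /= !linearZ /= exl upd_linl upd_linr.
    by rewrite addrACA.
  have phiE w y : phi (row_mx (mxvec (\matrix_(k < i, j < m) xi k w 0 j)) y) = F (upd (tr i w) i y).
    by rewrite /phi row_mxKl row_mxKr mxvecK exE.
  have := hi i; rewrite i0 iN => /(_ isT) /(_ phi sphi).
  under eq_fun do rewrite phiE.
  move=> ->; congr E; apply/funext => w; under eq_fun do rewrite phiE.
  by apply: (hl i (fun y => F (upd (tr i w) i y))) => //; exact: slip2_sec (slip2_upd i sF).
move=> F sF; rewrite -(main n F) //; congr E; apply/funext => w; congr F.
by apply/matrixP => k l; rewrite !mxE ltn_ord.
Qed.

End Model.
End Models.

(** * Additivity of Lebesgue measure on Borel sets *)

Section Lebesgue.
Variables (R : realType) (d' : nat).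
Local Notation d := d'.+1.
Local Notation borel := (<<s [set U : set 'rV[R]_d | open U] >>).
Local Notation leb := (@lebesgue R d).
Local Open Scope ereal_scope.

Definition vol (a b : 'rV[R]_d) : \bar R := (\prod_(i < d) (b 0%R i - a 0%R i)%R)%:E.

Definition box_cover (X : set 'rV[R]_d) (a b : nat -> 'rV[R]_d) :=
  (forall k i, (a k 0 i <= b k 0 i)%R) /\ X `<=` \bigcup_k half_open_box (a k) (b k).

Lemma vol_ge0 (a b : 'rV[R]_d) : (forall i, (a 0 i <= b 0 i)%R) -> 0 <= vol a b.
Proof. by move=> h; rewrite lee_fin; apply: prodr_ge0 => i _; rewrite subr_ge0. Qed.

Lemma leb_le X a b : box_cover X a b -> leb X <= \sum_(0 <= k <oo) vol (a k) (b k).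
Proof. by move=> [h1 h2]; apply: ereal_inf_lbound; exists a, b. Qed.

Lemma leb_lb X (v : \bar R) :
  (forall a b, box_cover X a b -> v <= \sum_(0 <= k <oo) vol (a k) (b k)) -> v <= leb X.
Proof. by move=> h; apply: le_ereal_inf_tmp => _ [a [b [h1 h2 ->]]]; exact: h. Qed.

Lemma leb_ge0 X : 0 <= leb X.
Proof. by apply: leb_lb => a b [h _]; apply: nneseries_ge0 => k _ _; exact: vol_ge0. Qed.

Lemma leb_mono : {homo leb : A B / A `<=` B >-> A <= B}.
Proof.
move=> A B AB; apply: leb_lb => a b [h1 h2]; apply: leb_le; split=> //.
exact: subset_trans h2.
Qed.

Lemma leb_set0 : leb set0 = 0.
Proof.
apply/eqP; rewrite eq_le leb_ge0 andbT.
apply: (le_trans (@leb_le set0 (fun=> 0%R) (fun=> 0%R) _)); first by split.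
rewrite eseries0 // => k _ _; rewrite /vol (bigD1 ord0) //= mxE subr0 mul0r //.
Qed.

(** Near-optimal covers of the sets, with total error e, are enumerated into
    one cover of the union through a bijection of nat with nat * nat. *)
Lemma leb_subadditive : sigma_subadditive leb.
Proof.
move=> A; have [[i ioo]|] := pselect (exists i, leb (A i) = +oo).
  rewrite (eseries_pinfty _ _ ioo) ?leey // => n _.
  by rewrite -ltNye (lt_le_trans _ (leb_ge0 _)).
rewrite -forallNE => Aoo; apply/lee_addgt0Pr => e e0.
apply: le_trans (epsilon_trick xpredT (fun n => leb_ge0 (A n)) (ltW e0)).
have [G PG] : {G : nat -> (nat -> 'rV[R]_d) * (nat -> 'rV[R]_d) & forall n,
    box_cover (A n) (G n).1 (G n).2 /\
    \sum_(0 <= k <oo) vol ((G n).1 k) ((G n).2 k) <= leb (A n) + (e / (2 ^ n.+1)%:R)%:E}.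
  apply: (@choice _ _ (fun n (G : (nat -> 'rV[R]_d) * (nat -> 'rV[R]_d)) =>
    box_cover (A n) G.1 G.2 /\
    \sum_(0 <= k <oo) vol (G.1 k) (G.2 k) <= leb (A n) + (e / (2 ^ n.+1)%:R)%:E)) => n.
  have en : (0 < e / (2 ^ n.+1)%:R)%R by rewrite divr_gt0 // ltr0n expn_gt0.
  have fn : leb (A n) \is a fin_num.
    by rewrite ge0_fin_numE ?leb_ge0 // lt_neqAle leey andbT; apply/eqP; exact: Aoo.
  have [_ [a [b [h1 h2 ->]]] h3] := lb_ereal_inf_adherent en fn.
  by exists (a, b); split; [split|exact: ltW].
pose w (p : nat * nat) := vol ((G p.1).1 p.2) ((G p.1).2 p.2).
have w0 p : 0 <= w p by apply: vol_ge0; exact: (PG p.1).1.1.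
have /card_esym/ppcard_eqP[f] := card_nat2.
apply: (@le_trans _ _ (\sum_(0 <= k <oo) w (f k))).
  apply: leb_le; split; first by move=> k i; exact: (PG (f k).1).1.1.
  move=> x [n _ Anx]; have [j _ hj] := (PG n).1.2 x Anx.
  by exists (f^-1%FUN (n, j)) => //=; rewrite invK ?inE.
rewrite nneseries_esum // (_ : [set x | true] = [set: nat]); last exact/seteqP.
rewrite -(reindex_esum [set: nat] [set: nat * nat] f) //.
rewrite (_ : [set: nat * nat] = [set: nat] `*`` (fun=> [set: nat])); last first.
  by apply/seteqP; split.
rewrite -(esum_esum (a := fun i j => w (i, j))) //.
rewrite (_ : [set: nat] = [set x | xpredT x]); last exact/seteqP.
rewrite -nneseries_esum //; last by move=> n _; exact: esum_ge0.
apply: lee_nneseries; first by move=> n _ _; exact: esum_ge0.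
by move=> n _; rewrite -nneseries_esum //; exact: (PG n).2.
Qed.

HB.instance Definition _ := isOuterMeasure.Build R 'rV[R]_d leb
  leb_set0 leb_ge0 leb_mono leb_subadditive.

Let M (A : set 'rV[R]_d) := caratheodory_measurable leb A.

(** Every box of a cover is cut by the hyperplane into two boxes, possibly
    degenerate, whose volumes add up. *)
Lemma half_space_caratheodory (i : 'I_d) (c : R) : M [set x | (x 0 i < c)%R].
Proof.
apply: le_caratheodory_measurable => X; apply: leb_lb => a b [ab Xab].
pose m k := Num.max (a k 0%R i) (Num.min (b k 0%R i) c).
pose b' k : 'rV[R]_d := (\row_j if j == i then m k else b k 0 j)%R.
pose a' k : 'rV[R]_d := (\row_j if j == i then m k else a k 0 j)%R.
have am k : (a k 0 i <= m k)%R by rewrite /m le_max lexx.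
have mb k : (m k <= b k 0 i)%R by rewrite /m ge_max ab ge_min lexx.
have h1 k j : (a k 0 j <= b' k 0 j)%R by rewrite mxE; case: eqP => [->|].
have h2 k j : (a' k 0 j <= b k 0 j)%R by rewrite mxE; case: eqP => [->|].
have c1 : box_cover (X `&` [set x | (x 0 i < c)%R]) a b'.
  split=> // x [Xx xc]; have [k _ hk] := Xab x Xx; exists k => // j.
  have /andP[u1 u2] := hk j; rewrite u1 mxE; case: eqP => // ji.
  by rewrite ji /m lt_max lt_min -ji u2 ji xc orbT.
have c2 : box_cover (X `&` ~` [set x | (x 0 i < c)%R]) a' b.
  split=> // x [Xx /negP]; rewrite -leNgt => xc; have [k _ hk] := Xab x Xx; exists k => // j.
  have /andP[u1 u2] := hk j; rewrite u2 andbT mxE; case: eqP => // ji.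
  by rewrite /m -ji ge_max u1 ge_min ji xc orbT.
apply: (le_trans (leeD (leb_le c1) (leb_le c2))).
rewrite -nneseriesD; try by move=> k _ _; exact: vol_ge0.
rewrite le_eqVlt; apply/orP; left; apply/eqP; apply: eq_eseriesr => k _.
rewrite /vol -EFinD !(bigD1 (P := xpredT) i) //= !mxE eqxx.
rewrite (eq_bigr (fun j => (b k 0 j - a k 0 j)%R)); last first.
  by move=> j ji; rewrite mxE (negbTE ji).
rewrite [X in (_ + _ * X)%R](eq_bigr (fun j => (b k 0 j - a k 0 j)%R)); last first.
  by move=> j ji; rewrite mxE (negbTE ji).
congr EFin; ring.
Qed.

Lemma box_caratheodory (a b : 'rV[R]_d) : M (half_open_box a b).
Proof.
pose G (k : nat) : set 'rV[R]_d := if (insub k : option 'I_d) is Some i then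
  ~` (~` [set x | (x 0 i < a 0 i)%R] `&` [set x | (x 0 i < b 0 i)%R]) else set0.
have -> : half_open_box a b = ~` \bigcup_k G k.
  apply/seteqP; split=> x.
    move=> h [k _]; rewrite /G; case: insubP => // i _ _; apply; split.
      by apply/negP; rewrite -leNgt; case/andP: (h i).
    by case/andP: (h i).
  move=> h i; apply/negPn/negP => hi; apply: h; exists (i : nat) => //.
  rewrite /G; case: insubP => [i' _ ii'|]; last by rewrite ltn_ord.
  have {ii'}-> : i' = i by exact/val_inj.
  by move=> [/= /negP h1 h2]; apply: (negP hi); rewrite h2 andbT leNgt.
refine (@caratheodory_measurable_setC R _ leb _ _).
refine (@caratheodory_measurable_bigcup R _ leb _ _) => k.
rewrite /G; case: insubP => [i _ _|_]; last exact: caratheodory_measurable_set0.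
refine (@caratheodory_measurable_setC R _ leb _ _).
refine (@caratheodory_measurable_setI R _ leb _ _ _ _); last exact: half_space_caratheodory.
refine (@caratheodory_measurable_setC R _ leb _ _); exact: half_space_caratheodory.
Qed.

(** An open set is the union of the boxes with rational vertices that it
    contains. *)
Lemma open_caratheodory (U : set 'rV[R]_d) : open U -> M U.
Proof.
move=> oU; pose tor (p : 'rV[rat]_d) : 'rV[R]_d := (\row_i ratr (p 0 i))%R.
pose F (k : nat) : set 'rV[R]_d :=
  if (unpickle k : option ('rV[rat]_d * 'rV[rat]_d)) is Some p then
    (if `[< half_open_box (tor p.1) (tor p.2) `<=` U >] then half_open_box (tor p.1) (tor p.2) else set0)
  else set0.
have -> : U = \bigcup_k F k.
  apply/seteqP; split=> x; last first.
    move=> [k _]; rewrite /F; case: unpickle => // p; case: asboolP => // h; exact: h.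
  move=> Ux; have /nbhs_ballP[e /= e0 he] : nbhs x U by exact: open_nbhs_nbhs.
  have hp i : exists q : rat, (x 0 i - e < ratr q < x 0 i)%R.
    have l1 : (x 0 i - e < x 0 i)%R by rewrite ltrBlDr ltrDl.
    have [q] := rat_in_itvoo l1.
    by rewrite in_itv /= => hq; exists q.
  have hq i : exists q : rat, (x 0 i < ratr q < x 0 i + e)%R.
    have l1 : (x 0 i < x 0 i + e)%R by rewrite ltrDl.
    have [q] := rat_in_itvoo l1.
    by rewrite in_itv /= => hq; exists q.
  have [p hp'] := choice hp; have [q hq'] := choice hq.
  pose pq : 'rV[rat]_d * 'rV[rat]_d := (\row_i p i, \row_i q i)%R.
  have sub : half_open_box (tor pq.1) (tor pq.2) `<=` U.
    move=> y hy; apply: he; split=> // i j; rewrite (ord1 i) /ball /=.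
    have := hy j; rewrite !mxE => /andP[y1 y2]; have /andP[p1 p2] := hp' j.
    have /andP[q1 q2] := hq' j; rewrite ltr_norml; apply/andP; split; lra.
  exists (pickle pq) => //; rewrite /F pickleK; case: asboolP => // _ i.
  rewrite !mxE; have /andP[p1 p2] := hp' i; have /andP[q1 q2] := hq' i.
  by rewrite (ltW p2) q1.
refine (@caratheodory_measurable_bigcup R _ leb _ _) => k; rewrite /F.
case: unpickle => [p|]; last exact: caratheodory_measurable_set0.
by case: ifP => _; [exact: box_caratheodory|exact: caratheodory_measurable_set0].
Qed.

Lemma borel_caratheodory (A : set 'rV[R]_d) :
  borel A -> M A.
Proof.
move: A; apply: smallest_sub; last exact: open_caratheodory.
split.
- exact: caratheodory_measurable_set0.
- by move=> A hA; rewrite setTD; exact: (@caratheodory_measurable_setC R _ leb _ hA).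
- by move=> A hA; exact: (@caratheodory_measurable_bigcup R _ leb _ hA).
Qed.

Lemma lambda_ge0 (A : set 'rV[R]_d) : (0 <= lambda A)%R.
Proof. by rewrite fine_ge0 // leb_ge0. Qed.

Lemma lambda0 : lambda (set0 : set 'rV[R]_d) = 0%R.
Proof. by rewrite /lambda leb_set0. Qed.

(** The Caratheodory criterion for A1, tested against the union. *)
Lemma lambda_additive (A1 A2 A12 : B0 R d) : A1 `&` A2 = set0 ->
  A12 = A1 `|` A2 :> set _ -> (lambda A1 + lambda A2 = lambda A12)%R.
Proof.
move=> h0 h; have := borel_caratheodory (@B0_borel _ _ A1) A12; rewrite /lambda.
have -> : A12 `&` A1 = A1 by rewrite h setIUl setIid [A2 `&` _]setIC h0 setU0.
have -> : A12 `&` ~` A1 = A2.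
  rewrite h setIUl setICr set0U -setDE; apply/seteqP; split=> x; first by case.
  by move=> A2x; split=> // A1x; have : set0 x by rewrite -h0.
move=> ->; rewrite fineD // ge0_fin_numE ?leb_ge0 //; exact: B0_finite.
Qed.

End Lebesgue.

(** * Space-time grids and additive paths *)

Section Paths.
Variables (R : realType) (d' : nat).
Local Notation d := d'.+1.
Local Notation borel := (<<s [set U : set 'rV[R]_d | open U] >>).
Local Notation B0 := (B0 R d).

(** Indices of the field are sets; the witness of being a rectangle is a
    proposition. *)
Lemma Gamma_eq (g g' : Gamma R d) : Gamma_set g = Gamma_set g' -> g = g'.
Proof.
case: g g' => S hS [S' hS'] /= e; case: S' / e hS' => hS'.
by rewrite (Prop_irrelevance hS hS').
Qed.

Lemma rect_bounds (s t : R) : 0 <= Num.max 0 s <= Num.max (Num.max 0 s) t.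
Proof. by apply/andP; split; rewrite le_max lexx. Qed.

(** Rectangles without a side condition on the times. *)
Definition trect (s t : R) (A : B0) : Gamma R d := rect (rect_bounds s t) A.

Lemma rectE s t (h : 0 <= s <= t) (A : B0) : rect h A = trect s t A.
Proof.
apply: Gamma_eq => /=; case/andP: h => s0 st.
by rewrite (max_r s0) (max_r st).
Qed.

Lemma additive_time (w : Omega R d) r s t A : additive_path w ->
  0 <= r -> r <= s -> s <= t -> w (trect r s A) + w (trect s t A) = w (trect r t A).
Proof.
move=> [h _] r0 rs st.
have h1 : 0 <= r <= s by rewrite r0 rs.
have h2 : 0 <= s <= t by rewrite (le_trans r0 rs) st.
have h3 : 0 <= r <= t by rewrite r0 (le_trans rs st).
by have := h r s t h1 h2 h3 A; rewrite !rectE.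
Qed.

Lemma additive_space (w : Omega R d) s t (A1 A2 A12 : B0) : additive_path w ->
  A1 `&` A2 = set0 -> A12 = A1 `|` A2 :> set _ ->
  w (trect s t A1) + w (trect s t A2) = w (trect s t A12).
Proof. by move=> [_ h] h1 h2; exact: h. Qed.

Lemma borelI (A B : set 'rV[R]_d) :
  borel A -> borel B ->
  borel (A `&` B).
Proof. exact: (@measurableI _ (g_sigma_algebraType [set U : set 'rV[R]_d | open U])). Qed.

Lemma borelC (A : set 'rV[R]_d) :
  borel A ->
  borel (~` A).
Proof. exact: (@measurableC _ (g_sigma_algebraType [set U : set 'rV[R]_d | open U])). Qed.

Lemma borelT : borel setT.
Proof. exact: (@measurableT _ (g_sigma_algebraType [set U : set 'rV[R]_d | open U])). Qed.

Lemma borel0 : borel set0.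
Proof. exact: (@measurable0 _ (g_sigma_algebraType [set U : set 'rV[R]_d | open U])). Qed.

Lemma borelU (A B : set 'rV[R]_d) :
  borel A -> borel B ->
  borel (A `|` B).
Proof. exact: (@measurableU _ (g_sigma_algebraType [set U : set 'rV[R]_d | open U])). Qed.

Lemma borel_sub_B0 (S : set 'rV[R]_d) (A : B0) :
  borel S -> S `<=` A -> exists B : B0, B0_set B = S.
Proof.
move=> bS SA; unshelve eexists (MkB0 bS _) => //.
by apply: le_lt_trans (B0_finite A); exact: leb_mono.
Qed.

(** A time grid together with disjoint nonempty cells, each marked by one of
    its points. *)
Record frame : Type := Frame {
  fn : nat ; fm : nat ; ft : nat -> R ; fA : 'I_fm -> B0 ; fx : 'I_fm -> 'rV[R]_d ;
  ft0 : ft 0 = 0 ;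
  ftS : forall i, (i < fn)%N -> ft i < ft i.+1 ;
  fdisj : forall j k, j != k -> fA j `&` fA k = set0 ;
  fxin : forall k, B0_set (fA k) (fx k) }.

Section OneFrame.
Variable f : frame.
Local Notation n := (fn f).
Local Notation m := (fm f).

Definition tgrid (t : R) := exists2 i, (i <= n)%N & ft f i = t.

(** A is a union of cells. *)
Definition sgrid (A : set 'rV[R]_d) :=
  (forall y, A y -> exists k, B0_set (fA (f := f) k) y) /\
  (forall k y y', B0_set (fA (f := f) k) y -> B0_set (fA (f := f) k) y' -> A y -> A y').

Lemma ft_ge0 i : (i <= n)%N -> 0 <= ft f i.
Proof.
elim: i => [|i ih] h; first by rewrite ft0.
by rewrite (le_trans (ih (ltnW h))) // ltW // ftS.
Qed.

Lemma ft_lt i j : (i < j)%N -> (j <= n)%N -> ft f i < ft f j.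
Proof.
elim: j => [//|j ih]; rewrite ltnS leq_eqVlt => /orP[/eqP->|ij] jn; first exact: ftS.
by rewrite (lt_trans (ih ij (ltnW jn))) // ftS.
Qed.

Lemma ft_ltE i j : (i <= n)%N -> (j <= n)%N -> (ft f i < ft f j) = (i < j)%N.
Proof.
move=> hi hj; case: ltngtP => h; first by rewrite ft_lt.
  by apply/negbTE; rewrite -leNgt ltW // ft_lt.
by rewrite h ltxx.
Qed.

Lemma ft_leE i j : (i <= n)%N -> (j <= n)%N -> (ft f i <= ft f j) = (i <= j)%N.
Proof. by move=> hi hj; rewrite leNgt ft_ltE // -leqNgt. Qed.

(** A telescoping sum. *)
Lemma time_sum (F : R -> R) s t : tgrid s -> tgrid t -> s <= t ->
  \sum_(i < n) (F (ft f i.+1) - F (ft f i)) * (s <= ft f i < t)%R%:R = F t - F s.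
Proof.
move=> [a an <-] [b bn <-]; rewrite ft_leE // => ab.
have H c N : (c <= n)%N -> (N <= n)%N ->
    \sum_(i < N) (F (ft f i.+1) - F (ft f i)) * (i < c)%:R = F (ft f (minn N c)) - F (ft f 0).
  move=> cn; elim: N => [|N ih] Nn; first by rewrite big_ord0 min0n subrr.
  rewrite big_ord_recr /= ih ?(ltnW Nn) //; case: (boolP (N < c)%N) => h.
    rewrite (minn_idPl (ltnW h)) (minn_idPl h) mulr1; ring.
  rewrite -leqNgt in h.
  by rewrite (minn_idPr h) (minn_idPr (leqW h)) mulr0 addr0.
have := H b n bn (leqnn n); have := H a n an (leqnn n).
rewrite (minn_idPr an) (minn_idPr bn) => ha hb.
rewrite (_ : F (ft f b) - F (ft f a) = (F (ft f b) - F (ft f 0)) - (F (ft f a) - F (ft f 0))); last by ring.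
rewrite -ha -hb -sumrB; apply: eq_bigr => i _.
rewrite ft_leE ?ft_ltE ?(ltnW (ltn_ord i)) // -mulrBr; congr (_ * _).
case: (ltnP i a) => ia /=; last by rewrite subr0.
by rewrite (leq_trans ia ab) subrr.
Qed.

(** The cells contained in A are added one at a time; the partial unions are
    Borel subsets of A, hence have finite measure. *)
Lemma space_sum (g : B0 -> R) (A : B0) :
  (forall A1 A2 A12 : B0, A1 `&` A2 = set0 -> A12 = A1 `|` A2 :> set _ -> g A1 + g A2 = g A12) ->
  sgrid A -> g A = \sum_(k < m) g (fA k) * (`[< B0_set A (fx k) >])%:R.
Proof.
move=> gadd [cov hom].
have g0 (E : B0) : B0_set E = set0 -> g E = 0.
  by move=> E0; have := gadd E E E; rewrite E0 setI0 setU0 => /(_ erefl erefl); lra.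
have part j : (j <= m)%N -> exists2 B : B0,
    B0_set B = [set y | B0_set A y /\ exists2 k : 'I_m, (k < j)%N & B0_set (fA k) y] &
    g B = \sum_(k < m | (k < j)%N) g (fA k) * (`[< B0_set A (fx k) >])%:R.
  elim: j => [|j ih] jm.
    have [E hE] := borel_sub_B0 borel0 (@sub0set _ A).
    exists E; last by rewrite g0 // big1 // => k.
    by rewrite hE; apply/seteqP; split=> // y [_ [k]].
  have [B hB gB] := ih (ltnW jm).
  pose kj : 'I_m := Ordinal jm.
  have sumE : \sum_(k < m | (k < j.+1)%N) g (fA k) * (`[< B0_set A (fx k) >])%:R =
     g B + g (fA kj) * (`[< B0_set A (fx kj) >])%:R.
    rewrite (bigD1 kj) //= addrC gB; congr (_ + _); apply: eq_bigl => k.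
    by rewrite ltnS -(inj_eq val_inj) /= ltn_neqAle andbC.
  have dj (k : 'I_m) y : B0_set (fA k) y -> B0_set (fA kj) y -> k = kj.
    move=> h1 h2; apply/eqP/negPn/negP => /fdisj h3.
    have : (fA k `&` fA kj) y by [].
    by rewrite h3.
  have [Ax|Ax] := pselect (B0_set A (fx kj)).
  - have hsub : B `|` fA kj `<=` A.
      by move=> y [|hy]; [rewrite hB => -[]|exact: (hom kj (fx kj) y (fxin _) hy Ax)].
    have [B' hB'] := borel_sub_B0 (borelU (B0_borel B) (B0_borel (fA kj))) hsub.
    exists B'.
      rewrite hB' hB; apply/seteqP; split=> y /=.
        move=> [[Ay [k kj' hk]]|hy]; first by split=> //; exists k => //; exact: ltnW.
        by split; [exact: (hom kj (fx kj) y (fxin _) hy Ax)|exists kj].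
      move=> [Ay [k]]; rewrite ltnS leq_eqVlt => /orP[/eqP kE|kl] hk.
        by right; rewrite (_ : kj = k) //; exact/val_inj.
      by left; split=> //; exists k.
    rewrite sumE asboolT // mulr1; apply/esym/gadd => //.
    rewrite hB; apply/seteqP; split=> // y [[_ [k kl hk]] hj].
    by move: kl; rewrite (dj k y hk hj) ltnn.
  - exists B; last by rewrite sumE asboolF // mulr0 addr0.
    rewrite hB; apply/seteqP; split=> y /= [Ay [k kl hk]]; split=> //.
      by exists k => //; exact: ltnW.
    exists k => //; move: kl; rewrite ltnS leq_eqVlt => /orP[/eqP kE|//].
    case: Ax; have kE' : k = kj by exact/val_inj.
    by apply: (hom kj y) => //; [rewrite -kE'|exact: fxin].
have [B hB gB] := part m (leqnn m).
(* B and A are equal as sets; g takes the same value on them by additivity,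
   with an empty second set. *)
have -> : g A = g B.
  have [E hE] := borel_sub_B0 borel0 (@sub0set _ A).
  rewrite -[g B]addr0 -(g0 E hE); apply/esym/gadd; first by rewrite hE setI0.
  rewrite hE setU0 hB; apply/seteqP; split=> y /=; last by case.
  by move=> Ay; split=> //; have [k hk] := cov y Ay; exists k.
by rewrite gB; apply: eq_bigl => k; rewrite ltn_ord.
Qed.

(** Sums of point masses at the marked space-time points. They are additive
    paths, and they realise every array of values on the cells. *)
Definition pmass (M : 'M[R]_(n, m)) : Omega R d := fun g =>
  \sum_(i < n) \sum_(k < m) M i k * (`[< Gamma_set g (ft f i, fx k) >])%:R.

Definition cell_values (w : Omega R d) : 'M[R]_(n, m) :=
  \matrix_(i, k) w (trect (ft f i) (ft f i.+1) (fA k)).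

Lemma pmass_rect M s t (h : 0 <= s <= t) (A : B0) :
  pmass M (rect h A) = \sum_(i < n) \sum_(k < m) M i k * ((s <= ft f i < t)%R%:R * (`[< B0_set A (fx k) >])%:R).
Proof.
apply: eq_bigr => i _; apply: eq_bigr => k _; congr (_ * _).
rewrite -natrM mulnb; congr (_%:R); congr nat_of_bool.
apply/asboolP/andP => /=; rewrite in_itv /=.
  by move=> [h1 h2]; split=> //; exact/asboolP.
by move=> [h1 /asboolP h2].
Qed.

Lemma pmass_additive M : additive_path (pmass M).
Proof.
split.
- move=> r s t hrs hst hrt A; rewrite !pmass_rect -big_split; apply: eq_bigr => i _ /=.
  rewrite -big_split; apply: eq_bigr => k _ /=; rewrite -mulrDr -mulrDl; congr (_ * (_ * _)).
  rewrite -natrD; congr (_%:R).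
  move: hrs hst => /andP[_ rs] /andP[_ st].
  case: (ltP (ft f i) s) => h; rewrite ?(le_trans rs h) ?(lt_le_trans h st) /= ?addn0 ?andbT ?andbF //.
- move=> s t hst A1 A2 A12 h0 h; rewrite !pmass_rect -big_split; apply: eq_bigr => i _ /=.
  rewrite -big_split; apply: eq_bigr => k _ /=; rewrite -mulrDr -mulrDr; congr (_ * (_ * _)).
  rewrite -natrD; congr (_%:R); rewrite h.
  case: (asboolP (B0_set A1 (fx k))) => h1; case: (asboolP (B0_set A2 (fx k))) => h2.
  + by exfalso; have : (A1 `&` A2) (fx k) by []; rewrite h0.
  + by rewrite asboolT //; left.
  + by rewrite asboolT //; right.
  + by rewrite asboolF // => -[].
Qed.

Lemma pmass_values w s t (h : 0 <= s <= t) (A : B0) : additive_path w ->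
  tgrid s -> tgrid t -> sgrid A -> w (rect h A) = pmass (cell_values w) (rect h A).
Proof.
move=> wa gs gt gA; rewrite pmass_rect.
have := @time_sum (fun u => w (trect 0 u A)) s t gs gt (proj2 (andP h)).
have -> : w (trect 0 t A) - w (trect 0 s A) = w (rect h A).
  case/andP: (h) => s0 st; rewrite rectE -(additive_time A wa (lexx 0) s0 st); ring.
move=> <-; apply: eq_bigr => i _.
have -> : w (trect 0 (ft f i.+1) A) - w (trect 0 (ft f i) A) = w (trect (ft f i) (ft f i.+1) A).
  rewrite -(additive_time A wa (lexx 0) (ft_ge0 (ltnW (ltn_ord i))) (ltW (ftS (ltn_ord i)))); ring.
rewrite (@space_sum (fun B => w (trect (ft f i) (ft f i.+1) B)) A _ gA); last first.
  by move=> A1 A2 A12 h1 h2; exact: additive_space.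
by rewrite mulr_suml; apply: eq_bigr => k _; rewrite mxE; ring.
Qed.

End OneFrame.

(** The times are sorted; the cells are the nonempty atoms of the algebra
    generated by the sets A i, apart from the complement of their union, which
    may have infinite measure. *)
Lemma frame_exists (I : finType) (s t : I -> R) (A : I -> B0) :
  (forall i, 0 <= s i <= t i) ->
  exists f : frame, forall i, [/\ tgrid f (s i), tgrid f (t i) & sgrid f (A i)].
Proof.
move=> hst.
pose L := sort <=%R (undup (0 :: [seq s i | i <- enum I] ++ [seq t i | i <- enum I])).
have memL u : (u \in L) = (u \in 0 :: [seq s i | i <- enum I] ++ [seq t i | i <- enum I]).
  by rewrite mem_sort mem_undup.
have L0 u : u \in L -> 0 <= u.
  rewrite memL inE mem_cat => /orP[/eqP->//|/orP[]/mapP[i _ ->]]; case/andP: (hst i) => // a.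
  exact: le_trans.
have sL : sorted <%R L by rewrite sort_lt_sorted undup_uniq.
have zL : 0 \in L by rewrite memL inE eqxx.
have Lsz : (0 < size L)%N by case: (L) zL.
have tL u : u \in L -> exists2 i, (i <= (size L).-1)%N & nth 0 L i = u.
  move=> uL; exists (index u L); last by rewrite nth_index.
  by rewrite -ltnS prednK // index_mem.
have n0 : nth 0 L 0 = 0.
  pose z := index (0 : R) L.
  have zi : (z < size L)%N by rewrite index_mem.
  have [e|e] := posnP z; first by rewrite -[X in nth _ _ X]e nth_index.
  apply/eqP; rewrite eq_le L0 ?mem_nth // andbT -{2}(nth_index 0 zL).
  exact/ltW/(sorted_ltn_nth lt_trans 0 sL 0%N z Lsz zi e).
pose cell (sg : {ffun I -> bool}) : set 'rV[R]_d := [set x | forall i, `[< B0_set (A i) x >] = sg i].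
pose valid := [set sg : {ffun I -> bool} | `[< exists i, sg i >] && `[< exists x, cell sg x >]]%SET.
have vP (k : 'I_#|valid|) : (exists i, enum_val k i) /\ (exists x, cell (enum_val k) x).
  by have := enum_valP k; rewrite inE => /andP[/asboolP h1 /asboolP h2].
have [fA' hA] : {B : 'I_#|valid| -> B0 & forall k, B0_set (B k) = cell (enum_val k)}.
  apply: (@choice _ _ (fun k B => B0_set B = cell (enum_val k))) => k.
  have [[i hi] _] := vP k.
  apply: (@borel_sub_B0 _ (A i)); last first.
    by move=> x /(_ i); rewrite hi => /asboolP.
  have -> : cell (enum_val k) = \big[setI/setT]_(j <- enum I) (if enum_val k j then B0_set (A j) else ~` A j).
    rewrite -bigcap_seq; apply/seteqP; split=> x /= h j.
      by move=> _; have := h j; case: (enum_val k j) => /asboolP.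
    have := h j; rewrite /= mem_enum => /(_ isT); case: (enum_val k j) => ?; first exact/asboolP.
    exact/asboolPn.
  elim/big_rec: _ => [|j B _ hB]; first exact: borelT.
  apply: borelI => //; case: (enum_val k j); first exact: B0_borel.
  by apply: borelC; exact: B0_borel.
have [fx' hx] := choice (fun k => (vP k).2).
have fS' i : (i < (size L).-1)%N -> nth 0 L i < nth 0 L i.+1.
  by move=> iL; move/sortedP: sL => /(_ 0); apply; rewrite -ltn_predRL.
have dj (j k : 'I_#|valid|) : j != k -> fA' j `&` fA' k = set0.
  move=> jk; rewrite !hA; apply/seteqP; split=> // x [h1 h2].
  move/negP: jk; apply; apply/eqP/enum_val_inj/ffunP => i.
  by rewrite -(h1 i) -(h2 i).
have xin k : B0_set (fA' k) (fx' k) by rewrite hA; exact: hx.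
exists (@Frame (size L).-1 #|valid| (nth 0 L) fA' fx' n0 fS' dj xin) => i; split.
- apply: tL; rewrite memL inE mem_cat; apply/orP; right; apply/orP; left.
  by apply/mapP; exists i; rewrite ?mem_enum.
- apply: tL; rewrite memL inE mem_cat; apply/orP; right; apply/orP; right.
  by apply/mapP; exists i; rewrite ?mem_enum.
- split=> /=.
    move=> y Ay; pose sg := [ffun j => `[< B0_set (A j) y >]].
    have vs : sg \in valid.
      rewrite inE; apply/andP; split; apply/asboolP.
        by exists i; rewrite ffunE; exact/asboolP.
      by exists y => j; rewrite ffunE.
    exists (enum_rank_in vs sg); rewrite hA enum_rankK_in // => j.
    by rewrite ffunE.
  move=> k y y'; rewrite !hA => h1 h2 Ay.
  by apply/asboolP; rewrite h2 -h1; exact/asboolP.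
Qed.

End Paths.

(** * The expectation computed on a grid *)

Lemma trace_diag_conj (R : comPzRingType) m (v : 'rV[R]_m) (Q : 'M[R]_m) :
  \tr (diag_mx v *m Q *m (diag_mx v)^T) = \sum_j Q j j * v 0 j ^+ 2.
Proof.
rewrite tr_diag_mx mul_mx_diag mul_diag_mx; apply: eq_bigr => j _.
by rewrite !mxE mulrAC -expr2 mulrC.
Qed.

Section Values.
Variables (R : realType) (d' : nat) (lo up : R).
Hypothesis lo0 : 0 <= lo.
Hypothesis loup : lo <= up.
Local Notation d := d'.+1.
Local Notation B0 := (B0 R d).

(** The G-normal law with second moments 2 G (tr Q), for the given bounds on
    the variance. *)
Definition std_normal (m : nat) : ('rV[R]_m -> R) -> R := projT1 (cid (std_law lo0 loup m)).

Lemma std_normal_law m : law (@std_normal m).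
Proof. exact: (projT2 (cid (std_law lo0 loup m))).1. Qed.

Lemma std_normal_quad m (Q : 'M[R]_m) : std_normal (linquad 0 Q) = 2 * Gfun lo up (\tr Q).
Proof. by rewrite -max_Gfun //; exact: (projT2 (cid (std_law lo0 loup m))).2. Qed.

(** The law of the vectors that the construction attaches to the sets A j; see
    [cell_law_quad]. *)
Definition cell_law m (A : 'I_m -> B0) (f : 'rV[R]_m -> R) : R :=
  std_normal (fun x => f (x *m diag_mx (\row_k Num.sqrt (lambda (A k))))).

Lemma cell_law_stable m (A : 'I_m -> B0) : law (cell_law A).
Proof. exact: (law_mx (std_normal_law m) (diag_mx (\row_k Num.sqrt (lambda (A k))))). Qed.

Lemma cell_law_quad m (A : 'I_m -> B0) (Q : 'M[R]_m) :
  cell_law A (linquad 0 Q) = 2 * Gfun lo up (\sum_(j < m) Q j j * lambda (A j)).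
Proof.
rewrite /cell_law (_ : (fun x => _) = linquad 0
   (diag_mx (\row_k Num.sqrt (lambda (A k))) *m Q *m (diag_mx (\row_k Num.sqrt (lambda (A k))))^T)).
  rewrite std_normal_quad trace_diag_conj; congr (_ * Gfun _ _ _); apply: eq_bigr => j _.
  by rewrite mxE sqr_sqrtr // lambda_ge0.
by apply/funext => x; rewrite linquad_mulmx.
Qed.

Section Frame.
Variable f : frame R d'.
Local Notation n := (fn f).
Local Notation m := (fm f).
Local Notation nu := (cell_law (fA (f := f))).

(** The normalised vectors of the construction become increments over the grid
    of times. *)
Definition sqrt_dt (M : 'M[R]_(n, m)) : 'M[R]_(n, m) :=
  \matrix_(i, k) (Num.sqrt (ft f i.+1 - ft f i) * M i k).

(** The value that the construction gives to X on the grid f. *)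
Definition grid_value (X : Omega R d -> R) : R := En nu n (fun M => X (pmass (sqrt_dt M))).

(** X is a function of the increments over the grid: it takes on an additive
    path the same value as on the point masses with the same increments. *)
Definition adapted (X : Omega R d -> R) : Prop :=
  slip (fun M => X (pmass (f := f) M)) /\
  forall w, additive_path w -> X w = X (pmass (cell_values f w)).

Definition ind_mx p (A : 'I_p -> B0) : 'M[R]_(m, p) :=
  \matrix_(k, j) (`[< B0_set (A j) (fx k) >])%:R.

Lemma sqrt_dt_linear : linear sqrt_dt.
Proof. by move=> a x y; apply/matrixP => i k; rewrite !mxE; ring. Qed.

Lemma adapted_slip X : adapted X -> slip (fun M => X (pmass (sqrt_dt M))).
Proof. by move=> [h _]; exact: (slip_lin h sqrt_dt_linear). Qed.

(** The rows of a matrix under iterated expectation are a normal sequence for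
    the grid. *)
Lemma constructed X : adapted X -> constructed_value lo up X (grid_value X).
Proof.
move=> [sX aX].
have ht (i : 'I_n) : 0 <= ft f i <= ft f i.+1.
  by rewrite ft_ge0 ?(ltnW (ltn_ord i)) // ltW // ftS.
exists n, m, (ft f), (fA (f := f)), (fun M => X (pmass M)), 'M[R]_(n, m), (@slip R n m), (En nu n), (@rowof R n m).
split.
- exists ht; split.
  + by split; [exact: ft0|move=> i /andP[_ ?]; exact: ftS].
  + by move=> j k jk; exact: fdisj.
  + exact/slipP.
  + move=> w wa; rewrite (aX w wa); congr (X (pmass _)).
    by apply/matrixP => i j; rewrite !mxE /canonical_process rectE.
- by apply: model_sequence; [exact: cell_law_stable|move=> Q; rewrite cell_law_quad].
- congr (En nu n _); apply/funext => M; congr (X (pmass _)).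
  by apply/matrixP => i j; rewrite !mxE valK.
Qed.

Lemma sum_lt (N i : nat) : (\sum_(a < N) (a < i))%N = minn N i.
Proof.
elim: N => [|N ih]; first by rewrite big_ord0 min0n.
rewrite big_ord_recr /= ih; case: (boolP (N < i)%N) => h.
  by rewrite (minn_idPl (ltnW h)) (minn_idPl h) addn1.
by rewrite -leqNgt in h; rewrite (minn_idPr h) (minn_idPr (leqW h)) addn0.
Qed.

(** The number of the coarse interval that contains x is a count of grid
    times, hence monotone in x. *)
Lemma group_index (N : nat) (T : nat -> R) (x : R) i : T 0%N = 0 ->
  (forall j, (j < N)%N -> T j <= T j.+1) -> 0 <= x -> (i <= N)%N ->
  (i <= \sum_(a < N) (T a.+1 <= x)%R)%N = (T i <= x).
Proof.
move=> T0 TS x0 iN.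
have Tm a b : (a <= b)%N -> (b <= N)%N -> T a <= T b.
  elim: b => [|b ih]; first by rewrite leqn0 => /eqP->.
  rewrite leq_eqVlt => /orP[/eqP->//|ab] bN.
  by rewrite (le_trans (ih ab (ltnW bN))) // TS.
have [h|h] := leP (T i) x.
  rewrite -[X in (X <= _)%N](minn_idPr iN) -sum_lt; apply: leq_sum => a _.
  case: (ltnP a i) => // ai; rewrite (_ : T a.+1 <= x) //.
  by apply: le_trans h; exact: Tm.
apply/negbTE; rewrite -ltnNge.
case: i iN h => [|i] iN h; first by move: h; rewrite T0 ltNge x0.
rewrite ltnS -[X in (_ <= X)%N](minn_idPr (ltnW iN)) -sum_lt; apply: leq_sum => a _.
case: (ltnP a i) => [_|ia]; first by case: (T a.+1 <= x).
rewrite (_ : (T a.+1 <= x) = false) //; apply/negbTE; rewrite -ltNge.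
by apply: (lt_le_trans h); exact: Tm.
Qed.

(** Every row is assigned to the coarse interval that contains it, and
    [En_blocks] merges the rows of an interval. *)
Lemma coarse_law N p (T : nat -> R) (A : 'I_p -> B0) (F : 'M[R]_(N, p) -> R) :
  T 0%N = 0 -> (forall j, (j < N)%N -> T j <= T j.+1) ->
  (forall j, (j <= N)%N -> tgrid f (T j)) -> slip F ->
  En nu n (fun M => F (\matrix_(i < N, j < p) pmass (sqrt_dt M) (trect (T i) (T i.+1) (A j)))) =
  En nu N (fun M => F (\matrix_(i < N, j < p)
     (Num.sqrt (T i.+1 - T i) * (M *m ind_mx A) i j))).
Proof.
move=> T0 TS Tg sF.
have T_ge0 i : (i <= N)%N -> 0 <= T i.
  elim: i => [|i ih] h; first by rewrite T0.
  by rewrite (le_trans (ih (ltnW h))) // TS.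
pose c a := Num.sqrt (ft f a.+1 - ft f a).
(* The number of the coarse interval that contains the fine interval starting
   at ft f a. *)
pose g a := (\sum_(i < N) (T i.+1 <= ft f (minn a n))%R)%N.
have c0 a : 0 <= c a by exact: sqrtr_ge0.
have gm a b : (a <= b)%N -> (g a <= g b)%N.
  move=> ab; apply: leq_sum => i _.
  have h : ft f (minn a n) <= ft f (minn b n).
    by rewrite ft_leE ?geq_minr // leq_min geq_minr andbT (leq_trans (geq_minl _ _)).
  by case: (leP (T i.+1) (ft f (minn a n))) => // h'; rewrite (le_trans h' h).
have gE (a : 'I_n) (i : 'I_N) : (g a == i) = (T i <= ft f a < T i.+1).
  have an : minn a n = a by exact/minn_idPl/ltnW.
  have a0 : 0 <= ft f a by rewrite ft_ge0 // ltnW.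
  have h1 := group_index T0 TS a0 (ltnW (ltn_ord i)).
  have h2 := group_index T0 TS a0 (ltn_ord i).
  rewrite ltNge -h1 -h2 -ltnNge /g an; set G := (\sum_(_ < N) _)%N.
  by rewrite ltnS eqn_leq andbC.
pose F' (V : 'M[R]_(N, m)) := F (V *m ind_mx A).
have sF' : slip F' by exact: (slip_lin sF (@mulmx_linear _ N _ _ (ind_mx A))).
have := En_blocks (cell_law_stable (fA (f := f))) n c0 gm sF'.
set l1 := En nu n _; set r1 := En nu N _ => lr.
have -> : En nu n (fun M => F (\matrix_(i < N, j < p) pmass (sqrt_dt M) (trect (T i) (T i.+1) (A j)))) = l1.
  congr En; apply/funext => M; congr F; apply/matrixP => i j.
  have hT : 0 <= T i <= T i.+1 by rewrite T_ge0 ?(ltnW (ltn_ord i)) // TS.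
  rewrite mxE -(rectE hT) pmass_rect exchange_big [RHS]mxE; apply: eq_bigr => k _ /=.
  rewrite !mxE [in RHS]big_mkcond mulr_suml; apply: eq_bigr => a _.
  rewrite ?mxE gE /c; by case: (T i <= ft f a < T i.+1); rewrite /= ?mulr1n ?mulr0n ?mul1r ?mul0r ?mulr0.
rewrite lr; congr En; apply/funext => M; congr F; apply/matrixP => i j.
rewrite !mxE mulr_sumr; apply: eq_bigr => k _; rewrite !mxE mulrA; congr (Num.sqrt _ * _ * _).
have hT := TS i (ltn_ord i).
rewrite -(time_sum id (Tg i (ltnW (ltn_ord i))) (Tg i.+1 (ltn_ord i)) hT) big_mkcond.
apply: eq_bigr => a _; rewrite gE /c; case: (T i <= ft f a < T i.+1); rewrite ?mulr0 // mulr1 sqr_sqrtr //.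
by rewrite subr_ge0 ltW // ftS.
Qed.

(** Disjoint unions of cells have additive measures, so the second moments
    match; [law_unique] concludes. *)
Lemma cell_law_coarse p (A : 'I_p -> B0) (phi : 'rV[R]_p -> R) :
  (forall j, sgrid f (A j)) -> (forall j k, j != k -> A j `&` A k = set0) -> slip phi ->
  cell_law A phi = nu (fun x => phi (x *m ind_mx A)).
Proof.
move=> gA dA; apply: (law_unique (cell_law_stable A) (law_mx (cell_law_stable (fA (f := f))) (ind_mx A))) => Q _.
rewrite cell_law_quad (_ : (fun x => _) = linquad 0 (ind_mx A *m Q *m (ind_mx A)^T)); last first.
  by apply/funext => x; rewrite linquad_mulmx.
rewrite cell_law_quad; congr (_ * Gfun _ _ _).
under [LHS]eq_bigr => j _ do rewrite (space_sum (@lambda_additive R d') (gA j)) mulr_sumr.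
rewrite exchange_big; apply: eq_bigr => k _ /=.
rewrite mxE mulr_suml; apply: eq_bigr => j _.
rewrite [(_ *m Q) _ _]mxE !mulr_suml (bigD1 j) //= big1 ?addr0 => [|i ij].
  by rewrite !mxE; case: asboolP => _; rewrite /= ?mulr1n ?mulr0n; ring.
rewrite !mxE; case: (asboolP (B0_set (A i) (fx k))) => h1; last by rewrite !mul0r.
case: (asboolP (B0_set (A j) (fx k))) => h2; last by rewrite mulr0 mul0r.
by exfalso; have : (A i `&` A j) (fx k) by []; rewrite dA.
Qed.

End Frame.
End Values.

(** * The expectation does not depend on the grid *)

Section Expectation.
Variables (R : realType) (d' : nat) (lo up : R).
Hypothesis lo0 : 0 <= lo.
Hypothesis loup : lo <= up.
Local Notation d := d'.+1.
Local Notation B0 := (B0 R d).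
Local Notation Om := (Omega R d).

Lemma b0_empty : exists E : B0, B0_set E = set0.
Proof.
have fin : (lebesgue (set0 : set 'rV[R]_d) < +oo)%E by rewrite leb_set0.
by exists (MkB0 (@borel0 R d') fin).
Qed.

(** Any admissible model is first replaced by iterated expectation
    ([sequence_law], [law_unique]), then its sets are expressed in terms of
    the cells of f ([cell_law_coarse]), and finally its times by those of f
    ([coarse_law]). *)
Lemma rep_value (f : frame R d') n m (t : nat -> R) (A : 'I_m -> B0) (phi : 'M[R]_(n, m) -> R)
    (X : Om -> R) (T : Type) (H : set (T -> R)) (E : (T -> R) -> R) (xi : nat -> T -> 'rV[R]_m) :
  represents t A phi X -> normal_sequence n lo up A H E xi ->
  (forall i, (i <= n)%N -> tgrid f (t i)) -> (forall j, sgrid f (A j)) ->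
  E (fun w => phi (\matrix_(i < n, j < m) (Num.sqrt (t i.+1 - t i) * xi i w 0 j))) =
  grid_value lo0 loup f X.
Proof.
move=> [ht [[t0 tS] dA /slipP sphi rX]] [hE hG hI hQ] Tg Ag.
have TS j : (j < n)%N -> t j <= t j.+1 by move=> jn; case/andP: (ht (Ordinal jn)).
pose F (M : 'M[R]_(n, m)) := phi (\matrix_(i < n, j < m) (Num.sqrt (t i.+1 - t i) * M i j)).
have sF : slip F.
  apply: (slip_lin (L := fun M => \matrix_(i < n, j < m) (Num.sqrt (t i.+1 - t i) * M i j)) sphi).
  by move=> a x y; apply/matrixP => i j; rewrite !mxE; ring.
transitivity (En (cell_law lo0 loup A) n F).
  rewrite -(sequence_law (cell_law_stable lo0 loup A) H (sle_const hE) _ hI sF).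
    congr E; apply/funext => w; congr phi; apply/matrixP => i j.
    by rewrite !mxE.
  move=> i g iN sg; apply: (law_unique (Gnormal_law hE (hG i iN)) (cell_law_stable lo0 loup A)) => // Q sQ.
  rewrite cell_law_quad -(hQ i Q iN sQ) mulrA divff ?mul1r ?pnatr_eq0 //.
  by congr E; apply/funext => w; rewrite linquad_quad.
rewrite (En_eq n (law_sub (cell_law_stable lo0 loup A)) (fun g sg => cell_law_coarse lo0 loup Ag dA sg) sF).
rewrite En_mulmx -(@coarse_law _ _ _ _ lo0 loup f n m t A phi t0 TS Tg sphi).
congr En; apply/funext => M; rewrite (rX _ (pmass_additive _)); congr phi.
by apply/matrixP => i j; rewrite !mxE /canonical_process rectE.
Qed.

(** Both representations are transferred to a grid that refines the times and
    the sets of the two. The empty set is only a filler, for the times. *)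
Lemma constructed_unique (X : Om -> R) v1 v2 :
  constructed_value lo up X v1 -> constructed_value lo up X v2 -> v1 = v2.
Proof.
move=> [n1 [m1 [t1 [A1 [phi1 [T1 [H1 [E1 [xi1 [r1 s1 ->]]]]]]]]]].
move=> [n2 [m2 [t2 [A2 [phi2 [T2 [H2 [E2 [xi2 [r2 s2 ->]]]]]]]]]].
have [B hB] := b0_empty.
pose I : finType := (('I_n1 + 'I_m1) + ('I_n2 + 'I_m2))%type.
pose s (i : I) := match i with inl (inl a) => t1 a | inr (inl a) => t2 a | _ => 0 end.
pose t (i : I) := match i with inl (inl a) => t1 a.+1 | inr (inl a) => t2 a.+1 | _ => 0 end.
pose A (i : I) := match i with inl (inr a) => A1 a | inr (inr a) => A2 a | _ => B end.
have [ht1 [[t10 _] _ _ _]] := r1; have [ht2 [[t20 _] _ _ _]] := r2.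
have hst i : 0 <= s i <= t i by case: i => -[] a //=; rewrite ?lexx.
have [f hf] := frame_exists A hst.
have g0 : tgrid f 0 by exists 0%N => //; exact: ft0.
have g1 i : (i <= n1)%N -> tgrid f (t1 i).
  case: i => [|i] h; first by rewrite t10.
  by have [_ ? _] := hf (inl (inl (Ordinal h))).
have g2 i : (i <= n2)%N -> tgrid f (t2 i).
  case: i => [|i] h; first by rewrite t20.
  by have [_ ? _] := hf (inr (inl (Ordinal h))).
have a1 j : sgrid f (A1 j) by have [_ _ ?] := hf (inl (inr j)).
have a2 j : sgrid f (A2 j) by have [_ _ ?] := hf (inr (inr j)).
by rewrite (rep_value r1 s1 g1 a1) (rep_value r2 s2 g2 a2).
Qed.

Lemma EhatE (f : frame R d') (X : Om -> R) : adapted f X -> Ehat lo up X = grid_value lo0 loup f X.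
Proof.
move=> aX; have h := constructed lo0 loup aX.
apply: (constructed_unique _ h); exact: (xgetPex 0 (ex_intro _ _ h)).
Qed.

Lemma row_slip (f : frame R d') (g : Gamma R d) : slip (fun M => pmass (f := f) M g).
Proof.
apply: slip_sum => i; apply: slip_sum => k.
rewrite (_ : (fun x => _) = (fun x : 'M[R]_(fn f, fm f) => (`[< Gamma_set g (ft f i, fx k) >])%:R * x i k)).
  by apply: slipZ; exact: slip_coord.
by apply/funext => x; rewrite mulrC.
Qed.

(** An integer above all the times serves as horizon, and the rectangles
    become total in their times. *)
Lemma LipE (X : Om -> R) : Lip X <-> exists (N : nat) (s t : 'I_N -> R) (A : 'I_N -> B0) (phi : 'rV[R]_N -> R),
  [/\ forall i, 0 <= s i <= t i, slip phi & forall w, X w = phi (\row_i w (trect (s i) (t i) (A i)))].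
Proof.
split.
- move=> [n n1 [N [s [t [h [A [phi [hT /slipP sphi ->]]]]]]]].
  exists N, s, t, A, phi; split=> // w; congr phi.
  by apply/rowP => i; rewrite !mxE /canonical_process rectE.
- move=> [N [s [t [A [phi [h sphi hX]]]]]].
  exists ((\sum_i (Num.truncn (t i)).+1).+1)%N => //.
  exists N, s, t, h, A, phi; split; last first.
  + apply/funext => w; rewrite hX; congr phi.
    by apply/rowP => i; rewrite !mxE /canonical_process rectE.
  + exact/slipP.
  + move=> i; apply: (@le_trans _ _ (Num.truncn (t i)).+1%:R); first exact/ltW/truncnS_gt.
    by rewrite ler_nat ltnW // ltnS (bigD1 i) //= leq_addr.
Qed.

Lemma Lip_fin (I : finType) (s t : I -> R) (A : I -> B0) (phi : 'rV[R]_#|I| -> R) (X : Om -> R) :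
  (forall i, 0 <= s i <= t i) -> slip phi ->
  (forall w, X w = phi (\row_j w (trect (s (enum_val j)) (t (enum_val j)) (A (enum_val j))))) ->
  Lip X.
Proof.
move=> h sphi hX; apply/LipE.
by exists #|I|, (fun j => s (enum_val j)), (fun j => t (enum_val j)), (fun j => A (enum_val j)), phi.
Qed.

Lemma adapted_of (f : frame R d') N (s t : 'I_N -> R) (A : 'I_N -> B0) (phi : 'rV[R]_N -> R) (X : Om -> R) :
  (forall i, 0 <= s i <= t i) -> slip phi ->
  (forall w, X w = phi (\row_i w (trect (s i) (t i) (A i)))) ->
  (forall i, [/\ tgrid f (s i), tgrid f (t i) & sgrid f (A i)]) -> adapted f X.
Proof.
move=> h sphi hX hf; split.
- rewrite (_ : (fun M => _) = (fun M => phi (\row_i pmass (f := f) M (trect (s i) (t i) (A i))))).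
    apply: slip_of_coord => // i.
    rewrite (_ : (fun M => _) = (fun M => pmass (f := f) M (trect (s i) (t i) (A i)))).
      exact: row_slip.
    by apply/funext => M; rewrite mxE.
  by apply/funext => M; rewrite hX.
- move=> w wa; rewrite !hX; congr phi; apply/rowP => i; rewrite !mxE.
  by have [g1 g2 g3] := hf i; rewrite -(rectE (h i)); exact: pmass_values.
Qed.

Lemma common_frame (X Y : Om -> R) : Lip X -> Lip Y -> exists f : frame R d', adapted f X /\ adapted f Y.
Proof.
move=> /LipE[N [s [t [A [phi [h sphi hX]]]]]] /LipE[N' [s' [t' [A' [phi' [h' sphi' hX']]]]]].
pose I : finType := ('I_N + 'I_N')%type.
pose S (i : I) := match i with inl a => s a | inr a => s' a end.
pose T (i : I) := match i with inl a => t a | inr a => t' a end.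
pose B (i : I) := match i with inl a => A a | inr a => A' a end.
have hST i : 0 <= S i <= T i by case: i.
have [f hf] := frame_exists B hST; exists f; split.
  by apply: (adapted_of h sphi hX) => i; exact: (hf (inl i)).
by apply: (adapted_of h' sphi' hX') => i; exact: (hf (inr i)).
Qed.

Lemma Lip_comp (n : nat) (X : Om -> 'rV[R]_n) (phi : 'rV[R]_n -> R) :
  random_vector (@Lip R d) X -> C_lLip phi -> Lip (fun w => phi (X w)).
Proof.
move=> rX /slipP sphi.
pose P (i : 'I_n) (x : {N : nat & ((('I_N -> R) * ('I_N -> R)) * ('I_N -> B0) * ('rV[R]_N -> R))%type}) :=
  let: (((s, t), A), psi) := projT2 x in
  [/\ forall i, 0 <= s i <= t i, slip psi & forall w, X w 0 i = psi (\row_j w (trect (s j) (t j) (A j)))].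
have [D hD] : {D & forall i, P i (D i)}.
  apply: choice => i; have /LipE[N [s [t [A [psi h]]]]] := rX i.
  by exists (existT _ N (((s, t), A), psi)).
pose N i := projT1 (D i).
pose s i : 'I_(N i) -> R := (projT2 (D i)).1.1.1.
pose t i : 'I_(N i) -> R := (projT2 (D i)).1.1.2.
pose A i : 'I_(N i) -> B0 := (projT2 (D i)).1.2.
pose psi i : 'rV[R]_(N i) -> R := (projT2 (D i)).2.
have hD' i : [/\ forall j, 0 <= s i j <= t i j, slip (psi i) &
    forall w, X w 0 i = psi i (\row_j w (trect (s i j) (t i j) (A i j)))].
  by have := hD i; rewrite /P /s /t /A /psi /N; case: (D i) => n' [[[? ?] ?] ?].
pose I : finType := {i : 'I_n & 'I_(N i)}.
pose S (x : I) := s (tag x) (tagged x).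
pose T (x : I) := t (tag x) (tagged x).
pose B (x : I) := A (tag x) (tagged x).
pose Phi (v : 'rV[R]_#|I|) := phi (\row_i psi i (\row_j v 0 (enum_rank (Tagged (fun i => 'I_(N i)) j : I)))).
apply: (@Lip_fin I S T B Phi).
- by move=> [i j]; have [h _ _] := hD' i; exact: h.
- apply: slip_of_coord => // i.
  rewrite (_ : (fun M => _) = (fun v : 'rV[R]_#|I| => psi i (\row_j v 0 (enum_rank (Tagged (fun i => 'I_(N i)) j : I))))); last first.
    by apply/funext => v; rewrite mxE.
  have [_ sp _] := hD' i; apply: slip_of_coord => // j.
  rewrite (_ : (fun M => _) = (fun v : 'rV[R]_#|I| => v 0 (enum_rank (Tagged (fun i => 'I_(N i)) j : I)))).
    exact: slip_coord.
  by apply/funext => v; rewrite mxE.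
- move=> w; congr phi; apply/rowP => i; rewrite mxE.
  have [_ _ ->] := hD' i; congr psi; apply/rowP => j; rewrite !mxE enum_rankK //.
Qed.

Lemma Lip_proc (g : Gamma R d) : Lip (@canonical_process R d g).
Proof.
have [s [t [A [h hS]]]] := Gamma_rect g.
apply/LipE; exists 1%N, (fun=> s), (fun=> t), (fun=> A), (fun v => v 0 0); split=> //.
  exact: slip_coord.
move=> w; rewrite mxE -(rectE h) /canonical_process; congr w.
exact: Gamma_eq.
Qed.

Lemma Ehat_space : sublinear_expectation_space (@Lip R d) (@Ehat R d lo up).
Proof.
have lin (c : R) (X Y : Om -> R) : Lip X -> Lip Y -> Lip (fun w => c * X w + Y w).
  move=> hX hY.
  pose Z w : 'rV[R]_2 := \row_i (if i == 0 then X w else Y w).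
  pose phi (v : 'rV[R]_2) := c * v 0 0 + v 0 1.
  have -> : (fun w => c * X w + Y w) = (fun w => phi (Z w)).
    by apply/funext => w; rewrite /phi /Z !mxE.
  apply: Lip_comp.
    move=> i; rewrite (_ : (fun w => _) = if i == 0 then X else Y); first by case: ifP.
    by apply/funext => w; rewrite mxE; case: ifP.
  apply/slipP; apply: slipD; last exact: slip_coord.
  by apply: slipZ; exact: slip_coord.
have L0 : Lip (fun _ : Om => 0 : R).
  have := @Lip_comp 0%N (fun=> 0) (fun=> 0); apply; first by move=> [].
  by apply/slipP; exact: slip_cst.
have sE (f : frame R d') := En_sublin (law_sub (cell_law_stable lo0 loup (fA (f := f)))) (fn f) (fn f).
split=> //.
- exact: Lip_comp.
- move=> X Y hX hY h; have [f [aX aY]] := common_frame hX hY.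
  rewrite (EhatE aX) (EhatE aY); apply: (sub_mono (sE f)); try exact: adapted_slip.
  by move=> M; exact: h.
- move=> c; have [f [[_ aX] _]] := common_frame L0 L0.
  have ac : adapted f (fun=> c) by split=> //; exact: slip_cst.
  by rewrite (EhatE ac) /grid_value (sub_cst (sE f)).
- move=> X Y hX hY; have [f [aX aY]] := common_frame hX hY.
  have aXY : adapted f (fun w => X w + Y w).
    split; first by apply: slipD; [exact: aX.1|exact: aY.1].
    by move=> w wa; rewrite (aX.2 w wa) (aY.2 w wa).
  rewrite (EhatE aX) (EhatE aY) (EhatE aXY); apply: (sub_add (sE f)); exact: adapted_slip.
- move=> c X c0 hX; have [f [aX _]] := common_frame hX hX.
  have acX : adapted f (fun w => c * X w).
    split; first by apply: slipZ; exact: aX.1.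
    by move=> w wa; rewrite (aX.2 w wa).
  rewrite (EhatE aX) (EhatE acX); apply: (sub_hom (sE f)) => //; exact: adapted_slip.
Qed.

End Expectation.

(** * White noise *)

Section WhiteNoise.
Variables (R : realType) (d' : nat) (lo up : R).
Hypothesis lo0 : 0 <= lo.
Hypothesis loup : lo <= up.
Local Notation d := d'.+1.
Local Notation B0 := (B0 R d).
Local Notation Om := (Omega R d).
Local Notation W := (@canonical_process R d).
Local Notation Eh := (@Ehat R d lo up).

Lemma Gfun_homo (c q : R) : 0 <= c -> Gfun lo up (c * q) = c * Gfun lo up q.
Proof.
move=> c0; rewrite /Gfun mulrBr.
have h x : Num.max (c * x) 0 = c * Num.max x 0 by rewrite (maxr_pMr _ _ c0) mulr0.
by rewrite -[- (c * q)]mulrN !h [X in X - _]mulrCA [X in _ - X]mulrCA.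
Qed.

Lemma Lip_subvector n (g : 'I_n -> Gamma R d) (phi : 'rV[R]_n -> R) : slip phi ->
  Lip (fun w => phi (subvector W g w)).
Proof.
move=> sphi; apply: Lip_comp; last exact/slipP.
move=> i; rewrite (_ : (fun w => _) = W (g i)); first exact: Lip_proc.
by apply/funext => w; rewrite mxE.
Qed.

(** Additivity of the field holds on additive paths only, but the expectation
    sees nothing else. *)
Lemma Ehat_vanish (X : Om -> R) : Lip X -> (forall w, additive_path w -> X w = 0) -> Eh X = 0.
Proof.
move=> LX X0; have [f [aX _]] := common_frame LX LX.
rewrite (EhatE lo0 loup aX) /grid_value (_ : (fun M => _) = (fun=> 0)).
  by rewrite En_cst //; exact: law_sub (cell_law_stable lo0 loup _).
by apply/funext => M; rewrite X0 //; exact: pmass_additive.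
Qed.

(** The interval [s, t) is the second of the two intervals of the coarse grid
    0, s, t; the joint law of the field over it is a linear image of the law
    of one vector over the cells. *)
Lemma rect_law (f : frame R d') (s t : R) (h : 0 <= s <= t) p (A : 'I_p -> B0) (phi : 'rV[R]_p -> R) :
  tgrid f s -> tgrid f t -> (forall j, sgrid f (A j)) -> slip phi ->
  Eh (fun w => phi (subvector (fun A => W (rect h A)) A w)) =
  cell_law lo0 loup (fA (f := f)) (fun x => phi (x *m (Num.sqrt (t - s) *: ind_mx f A))).
Proof.
move=> gs gt gA sphi; have [s0 st] := andP h.
have aX : adapted f (fun w => phi (subvector (fun A => W (rect h A)) A w)).
  apply: (adapted_of (s := fun=> s) (t := fun=> t) (A := A) (fun=> h) sphi) => // w.
  by congr phi; apply/rowP => i; rewrite !mxE rectE.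
rewrite (EhatE lo0 loup aX) /grid_value.
pose T i : R := match i with 0%N => 0 | 1%N => s | _ => t end.
have TS j : (j < 2)%N -> T j <= T j.+1 by case: j => [|[|]].
have Tg j : (j <= 2)%N -> tgrid f (T j).
  by case: j => [|[|[|]]] //= _; exists 0%N => //; exact: ft0.
have one2 : (1 < 2)%N by [].
have sF := rowof_comp 2 1 sphi.
have := @coarse_law _ _ _ _ lo0 loup f 2 p T A _ erefl TS Tg sF.
set l1 := En _ _ _; set r1 := En _ _ _ => lr.
rewrite -(En_row (cell_law_stable lo0 loup (fA (f := f))) _ one2).
transitivity l1.
  congr En; apply/funext => M; congr phi; apply/rowP => i.
  by rewrite !mxE insubT mxE /canonical_process rectE.
rewrite lr; congr En; apply/funext => M; congr phi; apply/rowP => i.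
by rewrite -scalemxAr !mxE insubT !mxE; congr (_ * _); apply: eq_bigr => k _; rewrite !mxE insubT.
Qed.

(** The measures of the intersections of the sets A i are sums over the cells,
    which turns the trace of the quadratic form over the cells into the
    covariance sum. *)
Lemma rect_quad (s t : R) (h : 0 <= s <= t) p (A : 'I_p -> B0) (Q : 'M[R]_p) :
  Eh (fun w => \sum_(i < p) \sum_(j < p) Q i j * W (rect h (A i)) w * W (rect h (A j)) w) =
  2 * ((t - s) * Gfun lo up (\sum_(i < p) \sum_(j < p) Q i j * lambda (A i `&` A j))).
Proof.
have [s0 st] := andP h; have ts0 : 0 <= t - s by rewrite subr_ge0.
have /choice[B hB] : forall ij : 'I_p * 'I_p, exists B : B0, B0_set B = A ij.1 `&` A ij.2.
  move=> ij; apply: (@borel_sub_B0 _ _ _ (A ij.1)); last by move=> x [].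
  by apply: borelI; exact: B0_borel.
have [E _] := b0_empty R d'.
pose C (x : 'I_p + option ('I_p * 'I_p)) :=
  match x with inl i => A i | inr (Some ij) => B ij | inr None => E end.
have [f hf] := frame_exists C (fun=> h).
have gA j : sgrid f (A j) by have [] := hf (inl j).
have gB ij : sgrid f (B ij) by have [] := hf (inr (Some ij)).
have [gs gt _] := hf (inr None).
set c := Num.sqrt (t - s).
have sQ : slip (linquad 0 Q) by exact: linquad_slip.
transitivity (Eh (fun w => linquad 0 Q (subvector (fun A => W (rect h A)) A w))).
  congr Ehat; apply/funext => w; rewrite /linquad [X in _ = X + _]big1 ?add0r => [|i _]; last first.
    by rewrite !mxE mul0r.
  by apply: eq_bigr => i _; apply: eq_bigr => j _; rewrite !mxE.
rewrite (rect_law h gs gt gA sQ) (_ : (fun x => _) = linquad 0 ((c *: ind_mx f A) *m Q *m (c *: ind_mx f A)^T)).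
  rewrite cell_law_quad; congr (_ * _); rewrite -Gfun_homo //; congr Gfun.
  have e i j : lambda (A i `&` A j) = \sum_k lambda (fA (f := f) k) * ((ind_mx f A) k i * (ind_mx f A) k j).
    rewrite -(hB (i, j)) (space_sum (@lambda_additive R d') (gB (i, j))); apply: eq_bigr => k _.
    rewrite !mxE -natrM mulnb hB; congr (_ * _%:R); congr nat_of_bool.
    apply/asboolP/andP => /= -[h1 h2]; split; exact/asboolP.
  under [in RHS]eq_bigr => i _ do under eq_bigr => j _ do rewrite e mulr_sumr.
  under [in RHS]eq_bigr => i _ do rewrite exchange_big.
  rewrite exchange_big mulr_sumr; apply: eq_bigr => k _ /=.
  rewrite linearZ /= -!scalemxAl -scalemxAr scalerA mxE -expr2 sqr_sqrtr // -mulrA; congr (_ * _).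
  rewrite mxE mulr_suml exchange_big; apply: eq_bigr => j _.
  rewrite mxE !mulr_suml; apply: eq_bigr => i _.
  by rewrite [(_^T) _ _]mxE; ring.
by apply/funext => x; rewrite linquad_mulmx.
Qed.

Lemma rect_gaussian (s t : R) (h : 0 <= s <= t) :
  G_gaussian_field (@Lip R d) Eh (fun A => W (rect h A)).
Proof.
move=> p A.
have [E _] := b0_empty R d'.
have [f hf] := @frame_exists R d' (option 'I_p) (fun=> s) (fun=> t)
  (fun i => if i is Some j then A j else E) (fun=> h).
have [gs gt _] := hf None.
have gA j : sgrid f (A j) by have [] := hf (Some j).
apply: (Gnormal_of_law (law_mx (cell_law_stable lo0 loup (fA (f := f))) (Num.sqrt (t - s) *: ind_mx f A))).
  move=> i; rewrite (_ : (fun w => _) = W (rect h (A i))); first exact: Lip_proc.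
  by apply/funext => w; rewrite mxE.
by move=> phi sphi; exact: rect_law.
Qed.

Lemma rect_noise (s t : R) (h : 0 <= s <= t) :
  spatial_white_noise ((t - s) * lo) ((t - s) * up) (@Lip R d) Eh (fun A => W (rect h A)).
Proof.
have ts0 : 0 <= t - s by rewrite subr_ge0; case/andP: h.
have up0 := le_trans lo0 loup.
split.
- exact: rect_gaussian.
- move=> A; have := rect_quad h (fun _ : 'I_1 => A) 1%:M.
  rewrite !big_ord1 mxE eqxx setIid mul1r /Gfun.
  rewrite (max_l (lambda_ge0 A)) (max_r (y := 0)) ?oppr_le0 ?lambda_ge0 // => e.
  transitivity (Eh (fun w => \sum_(i < 1) \sum_(j < 1) (1%:M : 'M[R]_1) i j * W (rect h A) w * W (rect h A) w)).
    by congr Ehat; apply/funext => w; rewrite !big_ord1 mxE eqxx mul1r expr2.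
  by rewrite e; field.
- move=> A; have := rect_quad h (fun _ : 'I_1 => A) (- 1%:M).
  rewrite !big_ord1 !mxE eqxx setIid mulN1r /Gfun opprK.
  rewrite (max_l (lambda_ge0 A)) (max_r (y := 0)) ?oppr_le0 ?lambda_ge0 // => e.
  transitivity (- Eh (fun w => \sum_(i < 1) \sum_(j < 1) (- 1%:M : 'M[R]_1) i j * W (rect h A) w * W (rect h A) w)).
    by congr (- Ehat _ _ _); apply/funext => w; rewrite !big_ord1 !mxE eqxx mulN1r expr2 mulNr.
  by rewrite e; field.
- move=> A1 A2 A12.
  pose A (i : 'I_2) := if i == 0 then A1 else A2.
  have key (c : R) : Eh (fun w => c * (W (rect h A1) w * W (rect h A2) w)) = 0.
    have := rect_quad h A (c *: delta_mx 0 1).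
    (* The quadratic form with a single entry c, off the diagonal. *)
    have sum2 (F : 'I_2 -> 'I_2 -> R) :
        \sum_(i < 2) \sum_(j < 2) (c *: delta_mx 0 1 : 'M[R]_2) i j * F i j = c * F 0 1.
      have -> : 1 = lift ord0 ord0 :> 'I_2 by exact/val_inj.
      by rewrite !big_ord_recl !big_ord0 !mxE /= ?mulr1n ?mulr0n; ring.
    rewrite sum2 /= A12 lambda0 mulr0 /Gfun oppr0 maxxx !mulr0 subr0 !mulr0 => e.
    rewrite -[RHS]e; congr Ehat; apply/funext => w.
    by under eq_bigr => i _ do under eq_bigr => j _ do rewrite -mulrA; rewrite sum2.
  split.
    by rewrite -[RHS](key 1); congr Ehat; apply/funext => w; rewrite mul1r.
  by rewrite -[RHS](key (-1)); congr Ehat; apply/funext => w; rewrite mulN1r.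
- move=> A1 A2 A12 dA uA; apply: Ehat_vanish.
    pose g (i : 'I_3) := rect h (nth A1 [:: A12; A1; A2] i).
    pose phi (v : 'rV[R]_3) := (v 0 0 - v 0 1 - v 0 2%:R) ^+ 2.
    rewrite (_ : (fun w => _) = (fun w => phi (subvector W g w))).
      apply: Lip_subvector; apply: slipX; apply: slipB; last exact: slip_coord.
      by apply: slipB; exact: slip_coord.
    by apply/funext => w; rewrite /phi !mxE.
  move=> w wa; rewrite /canonical_process !rectE -(additive_space s t wa dA uA).
  ring.
Qed.

Lemma rect_split (r s t : R) (hrs : 0 <= r <= s) (hst : 0 <= s <= t) (hrt : 0 <= r <= t) (A : B0) :
  qs_eq Eh (fun w => W (rect hrs A) w + W (rect hst A) w) (W (rect hrt A)).
Proof.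
apply: Ehat_vanish; last by move=> w [wa _]; rewrite wa subrr normr0.
pose g (i : 'I_3) := nth (rect hrs A) [:: rect hrs A; rect hst A; rect hrt A] i.
pose phi (v : 'rV[R]_3) := `|v 0 0 + v 0 1 - v 0 2%:R|.
rewrite (_ : (fun w => _) = (fun w => phi (subvector W g w))).
  apply: Lip_subvector; apply: slip_abs; apply: slipB; last exact: slip_coord.
  by apply: slipD; exact: slip_coord.
by apply/funext => w; rewrite /phi !mxE.
Qed.

Lemma rect_scaling (s t : R) (h : 0 <= s <= t) (h01 : 0 <= (0 : R) <= 1) n (A : 'I_n -> B0) :
  eq_dist Eh (subvector (fun A => W (rect h A)) A)
          Eh (subvector (fun A w => Num.sqrt (t - s) * W (rect h01 A) w) A).
Proof.
move=> phi /slipP sphi.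
have [E _] := b0_empty R d'.
pose S (i : bool + 'I_n) : R := if i is inl b then (if b then s else 0) else s.
pose T (i : bool + 'I_n) : R := if i is inl b then (if b then t else 1) else t.
pose B (i : bool + 'I_n) := if i is inr j then A j else E.
have hST i : 0 <= S i <= T i by case: i => [[]|].
have [f hf] := frame_exists B hST.
have [gs gt _] := hf (inl true); have [g0 g1 _] := hf (inl false).
have gA j : sgrid f (A j) by have [] := hf (inr j).
rewrite (rect_law h gs gt gA sphi).
rewrite (_ : (fun w => phi (subvector (fun A w => _) A w)) =
  (fun w => phi (Num.sqrt (t - s) *: subvector (fun A => W (rect h01 A)) A w))); last first.
  by apply/funext => w; congr phi; apply/rowP => i; rewrite !mxE.
rewrite (rect_law (phi := fun v => phi (Num.sqrt (t - s) *: v)) h01 g0 g1 gA); last exact: slip_scale.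
congr cell_law; apply/funext => x; congr phi.
by rewrite subr0 sqrtr1 scale1r scalemxAr.
Qed.

(** The times t_ i lie before s, a point of the grid. So the past depends on
    the rows before that point and W([s, t) x A) on the later ones, and
    iterated expectation makes these independent ([En_indep]). *)
Lemma rect_independent (s t : R) (h : 0 <= s <= t) (A : B0) n (s_ t_ : 'I_n -> R)
    (h_ : forall i, 0 <= s_ i <= t_ i) (A_ : 'I_n -> B0) :
  (forall i, t_ i < s) ->
  independent_from Eh (fun w => \row_(_ < 1) W (rect h A) w)
                      (subvector W (fun i => rect (h_ i) (A_ i))).
Proof.
move=> ts phi /slipP sphi.
pose S (i : option 'I_n) := if i is Some j then s_ j else s.
pose T (i : option 'I_n) := if i is Some j then t_ j else t.
pose B (i : option 'I_n) := if i is Some j then A_ j else A.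
have hST i : 0 <= S i <= T i by case: i.
have [f hf] := frame_exists B hST.
have [[a an] /= ea gt gA] := hf None.
set X := subvector _ _; pose Y (w : Om) : 'rV[R]_1 := \row_(_ < 1) W (rect h A) w.
have Xmat w : additive_path w -> X w = X (pmass (cell_values f w)).
  move=> wa; apply/rowP => i; rewrite !mxE; have [g1 g2 g3] := hf (Some i).
  exact: (pmass_values (h_ i) wa g1 g2 g3).
have Ymat w : additive_path w -> Y w = Y (pmass (cell_values f w)).
  by move=> wa; apply/rowP => i; rewrite !mxE; apply: (pmass_values h wa) => //; exists a.
have pmass_lin (c : R) (M M' : 'M[R]_(fn f, fm f)) g : pmass (c *: M + M') g = c * pmass M g + pmass M' g.
  rewrite /pmass mulr_sumr -big_split; apply: eq_bigr => i _ /=.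
  rewrite mulr_sumr -big_split; apply: eq_bigr => k _ /=.
  by rewrite !mxE; ring.
have lX : linear (fun M => row_mx (X (pmass (f := f) M)) (0 : 'rV[R]_1)).
  move=> c M M'; rewrite scale_row_mx add_row_mx scaler0 addr0; congr row_mx.
  by apply/rowP => i; rewrite !mxE /canonical_process pmass_lin.
have lY : linear (fun M => row_mx (0 : 'rV[R]_n) (Y (pmass (f := f) M))).
  move=> c M M'; rewrite scale_row_mx add_row_mx scaler0 addr0; congr row_mx.
  by apply/rowP => i; rewrite !mxE /canonical_process pmass_lin.
have rowE x y : row_mx x y = row_mx x (0 : 'rV[R]_1) + row_mx (0 : 'rV[R]_n) y.
  by rewrite add_row_mx addr0 add0r.
have sn := En_sublin (law_sub (cell_law_stable lo0 loup (fA (f := f)))) (fn f) (fn f).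
have aXY : adapted f (fun w => phi (row_mx (X w) (Y w))).
  split; last by move=> w wa; rewrite (Xmat w wa) (Ymat w wa).
  apply: (slip_lin (L := fun M => row_mx (X (pmass (f := f) M)) (Y (pmass (f := f) M))) sphi) => c M M'.
  by rewrite rowE lX lY [in RHS]rowE [in X in _ = _ + X]rowE scalerDr addrACA.
have sYx x : slip (fun M => phi (row_mx x (Y (pmass (f := f) M)))).
  have s2 := slip2_lin sphi (L1 := fun z : 'rV[R]_n => row_mx z (0 : 'rV[R]_1)) (L2 := fun M => row_mx (0 : 'rV[R]_n) (Y (pmass (f := f) M))).
  have l1 : linear (fun z : 'rV[R]_n => row_mx z (0 : 'rV[R]_1)).
    by move=> c z z'; rewrite scale_row_mx add_row_mx scaler0 addr0.
  have := slip2_sec x (s2 l1 lY).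
  by under eq_fun do rewrite -rowE.
have aY x : adapted f (fun w => phi (row_mx x (Y w))).
  by split=> // w wa; rewrite -(Ymat w wa).
have -> : (fun w => Eh (fun w' => phi (row_mx (X w) (Y w')))) =
    (fun w => grid_value lo0 loup f (fun w' => phi (row_mx (X w) (Y w')))).
  by apply/funext => w; exact: EhatE.
have aE : adapted f (fun w => grid_value lo0 loup f (fun w' => phi (row_mx (X w) (Y w')))).
  split; last by move=> w wa; rewrite -(Xmat w wa).
  rewrite /grid_value; apply: (slip_param sn).
  have lY' : linear (fun M => row_mx (0 : 'rV[R]_n) (Y (pmass (sqrt_dt (f := f) M)))).
    by move=> c M M'; rewrite sqrt_dt_linear lY.
  have := slip2_lin sphi lX lY'.
  congr slip2; apply/funext => M; apply/funext => M'.
  by rewrite -rowE.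
rewrite (EhatE lo0 loup aXY) (EhatE lo0 loup aE) /grid_value.
have hX (M M' : 'M[R]_(fn f, fm f)) : X (pmass (sqrt_dt (merge a M M'))) = X (pmass (sqrt_dt M)).
  apply/rowP => j; rewrite ![LHS]mxE ![RHS]mxE /canonical_process.
  rewrite !pmass_rect.
  apply: eq_bigr => i _; apply: eq_bigr => k _; rewrite !mxE.
  case: (ltnP i a) => // ai.
  rewrite (_ : (s_ j <= ft f i < t_ j) = false) ?mul0r ?mulr0 //.
  apply/negbTE; rewrite negb_and -!ltNge; apply/orP; right; rewrite -leNgt.
  by rewrite (le_trans (ltW (ts j))) // -ea ft_leE // ltnW.
have hY (M M' : 'M[R]_(fn f, fm f)) : Y (pmass (sqrt_dt (merge a M M'))) = Y (pmass (sqrt_dt M')).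
  apply/rowP => j; rewrite ![LHS]mxE ![RHS]mxE /canonical_process.
  rewrite !pmass_rect.
  apply: eq_bigr => i _; apply: eq_bigr => k _; rewrite !mxE.
  case: (ltnP i a) => // ia.
  rewrite (_ : (s <= ft f i < t) = false) ?mul0r ?mulr0 //.
  by apply/negbTE; rewrite negb_and -ltNge -ea ft_ltE ?ia // ltnW.
have := @En_indep _ _ _ (law_sub (cell_law_stable lo0 loup (fA (f := f)))) _ _ _ a
  (fun M => X (pmass (sqrt_dt M))) (fun M => Y (pmass (sqrt_dt M))) hX hY.
by apply; exact/slipP.
Qed.

End WhiteNoise.

Theorem mainTheorem5 (R : realType) (d : nat) (hd : (0 < d)%N)
    (s2lo s2up : R) (hs : 0 <= s2lo <= s2up) :
  [/\ (* the construction determines a functional on L_ip(F) *)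
      forall X : Omega R d -> R, Lip X ->
        exists! v : R, constructed_value s2lo s2up X v,
      sublinear_expectation_space (@Lip R d) (@Ehat R d s2lo s2up) &
      spatial_temporal_white_noise s2lo s2up
        (@Lip R d) (@Ehat R d s2lo s2up) (@canonical_process R d)].
Proof.
case: d hd => [//|d] _; have [lo0 loup] := andP hs; split.
- move=> X LX; have [f [aX _]] := common_frame LX LX.
  exists (grid_value lo0 loup f X); split; first exact: constructed.
  by move=> v; apply: constructed_unique (constructed lo0 loup aX).
- exact: Ehat_space.
have h01 : 0 <= (0 : R) <= 1 by rewrite lexx ler01.
exists (Omega R d.+1), (@Lip R d.+1), (@Ehat R d.+1 s2lo s2up),
  (fun A => @canonical_process R d.+1 (rect h01 A)); split.
- split; first exact: Ehat_space.
  split; first by have := rect_noise d lo0 loup h01; rewrite subr0 !mul1r.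
  move=> n A Q _; rewrite (rect_quad lo0 loup h01) subr0 mul1r mulrA mulVf ?mul1r //.
- move=> s t hst; split; first exact: rect_noise.
  by move=> n A; exact: rect_scaling.
- by move=> *; exact: rect_split.
- by move=> *; exact: rect_independent.
Qed.
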